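(* Let a sequence $a=\{a_n\}_{n\in\mathbb{N}}\in l_1$, i.e. satisfy the condition $$\|a\|_1=\sum_{n=1}^\infty|a_n|<\infty .$$ Then the discrete transformation $$f(x)=\sum_{n=0}^\infty \frac{a_n}{\cosh(\pi n/2)}\,\mathrm{Re}\left[J_{in}\left(2\sqrt{2x}\right)\right]K_{in}\left(2\sqrt{2x}\right),\qquad x>0,$$ has the inversion formula $$a_n=-\frac{32}{\pi^2}\,\sinh(\pi n)\int_0^\infty \Psi_n(x)\,f(x)\,dx,\qquad n\in\mathbb{N}_0 ,$$ where the kernel $\Psi_n(x)$ is defined by $$\Psi_n(x)=\int_0^\pi \mathrm{Im}\left[K_0\left(4e^{\pi i/4}\cosh^{1/2}(u)\sqrt{x}\right)\right]\sinh(u)\sin(nu)\,du,\qquad x>0,\ n\in\mathbb{N}_0 ,$$ and the integral over $(0,\infty)$ in the inversion formula converges absolutely.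
   Context: $\mathbb{N}=\{1,2,3,\dots\}$, $\mathbb{N}_0=\{0,1,2,\dots\}$ and $i$ is the imaginary unit. The $l_1$ condition is written with the sum over $n\ge 1$, while the series defining $f$ starts at $n=0$ (with $a_0$ the coefficient of its zeroth term) and the inversion formula is asserted for $n\in\mathbb{N}_0$. $J_\nu(z)$ is the Bessel function of the first kind, $J_\nu(z)=\sum_{k=0}^\infty\frac{(-1)^k (z/2)^{\nu+2k}}{k!\,\Gamma(\nu+k+1)}$ for $z>0$, used with purely imaginary order. $K_\nu(z)$ is the modified Bessel function of the second kind (principal branch), $K_\nu(z)=\int_0^\infty e^{-z\cosh t}\cosh(\nu t)\,dt$ for $\mathrm{Re}\,z>0$.
   Formalization: The inversion formula is stated under the added assumption a_0 = 0: at n = 0 the printed formula forces a_0 = 0 since sinh(0) = 0, and for a_0 ≠ 0 it also fails for every n ≥ 1. Convergence of f and absolute convergence of the integral hold for any a_0. *)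

(* Defs.v *)
From HB Require Import structures.
From mathcomp Require Import all_boot all_order all_algebra.
From mathcomp Require Import all_classical all_reals all_analysis.
From mathcomp Require Export complex.

Set Implicit Arguments.
Unset Strict Implicit.
Unset Printing Implicit Defensive.

Import Order.TTheory GRing.Theory Num.Theory.
Import numFieldNormedType.Exports.

Local Open Scope classical_set_scope.
Local Open Scope ring_scope.
Local Open Scope complex_scope.

Definition coshR (R : realType) (x : R) : R := (expR x + expR (- x)) / 2.

Definition sinhR (R : realType) (x : R) : R := (expR x - expR (- x)) / 2.

Definition cexp (R : realType) (z : R[i]) : R[i] :=
  (expR (complex.Re z))%:C
  * (cos (complex.Im z) +i* sin (complex.Im z)).

Definition ccosh (R : realType) (z : R[i]) : R[i] :=
  (cexp z + cexp (- z)) / 2.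

(* The library integrates real-valued functions only; complex-valued ones are
   integrated componentwise with respect to Lebesgue measure. *)
Definition cintegral (R : realType) (D : set R) (f : R -> R[i]) : R[i] :=
  (\int[lebesgue_measure]_(t in D) complex.Re (f t))
  +i* (\int[lebesgue_measure]_(t in D) complex.Im (f t)).

(* For measurable f this is equivalent to the finiteness of the integral of
   |f|, since max(|Re f|, |Im f|) <= |f| <= |Re f| + |Im f|. *)
Definition cintegrable (R : realType) (D : set R) (f : R -> R[i]) : Prop :=
  lebesgue_measure.-integrable D (fun t => (complex.Re (f t))%:E)
  /\ lebesgue_measure.-integrable D (fun t => (complex.Im (f t))%:E).

(* R[i]^o is R[i] carrying the topology of its modulus. *)
Definition cseries_cvg (R : realType) (u : nat -> R[i]) : Prop :=
  cvgn (series (u : nat -> R[i]^o)).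

Definition cseries_sum (R : realType) (u : nat -> R[i]) : R[i] :=
  limn (series (u : nat -> R[i]^o)).

(* Euler's integral: the Gamma function on the half-plane Re z > 0, which
   suffices here, Gamma being evaluated at nu + k + 1 with nu imaginary. *)
Definition cGamma (R : realType) (z : R[i]) : R[i] :=
  cintegral `]0, +oo[
    (fun t => cexp ((z - 1) * (ln t)%:C) * (expR (- t))%:C).

(* For z > 0 and Re nu > -1; (z / 2)^(nu + 2 k) is the principal power. *)
Definition besselJ (R : realType) (nu : R[i]) (z : R) : R[i] :=
  cseries_sum (fun k : nat =>
    (-1) ^+ k * cexp ((nu + (2 * k)%N%:R) * (ln (z / 2))%:C)
    / (k`!%:R * cGamma (nu + k%:R + 1))).

(* For Re z > 0. *)
Definition besselK (R : realType) (nu z : R[i]) : R[i] :=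
  cintegral `[0, +oo[
    (fun t => cexp (- z * (coshR t)%:C) * ccosh (nu * t%:C)).

Definition transform_term (R : realType) (a : nat -> R[i]) (x : R) (n : nat)
    : R[i] :=
  a n / (coshR (pi * n%:R / 2))%:C
  * (complex.Re (besselJ (0 +i* n%:R) (2 * Num.sqrt (2 * x))))%:C
  * besselK (0 +i* n%:R) (2 * Num.sqrt (2 * x))%:C.

Definition transform (R : realType) (a : nat -> R[i]) (x : R) : R[i] :=
  cseries_sum (transform_term a x).

Definition Psi (R : realType) (n : nat) (x : R) : R :=
  \int[lebesgue_measure]_(u in `[0, pi])
    (complex.Im (besselK 0
       (4 * cexp (0 +i* (pi / 4)) * (Num.sqrt (coshR u))%:C * (Num.sqrt x)%:C))
     * sinhR u * sin (n%:R * u)).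

(* Main.v *)
(* Put [P x = Re J_(i tau) (2 sqrt (2 x)) K_(i tau) (2 sqrt (2 x))] and
   [kei x = Im K_0 (4 e^(i pi / 4) sqrt x)], so that [Psi n x] is the integral over
   [0 <= u <= pi] of [kei (x cosh u) sinh u sin (n u)].  The Bessel equations of the
   three factors and integration by parts show that
   [F c = \int_0^oo kei (c x) P x dx] solves
   [(1 - c^2) F'' = 3 c F' + (1 + tau^2) F] on all of [c > 0], and
   [F 0+ = - (pi / 4) \int_0^oo P = - pi / 32].  Since [1] is a singular point of this
   equation, [F] is determined by [F 0+]: [sin t F (cos t)] satisfies [w'' = tau^2 w] and
   vanishes at [t = 0], which gives [F 1], and [sinh t F (cosh t)] satisfies
   [v'' = - tau^2 v], vanishes at [t = 0] and has slope [F 1] there.  Hence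
   [sinh t F (cosh t) = - (pi / 32) sin (tau t) / sinh (pi tau / 2)], and by Fubini the
   integrals of [Psi n] against the terms of the series reduce to the orthogonality of
   the functions [sin (n u)] on [[0, pi]].
   The series is integrated term by term by dominated convergence: the energy
   [J^2 + (x J')^2 / (2 x + tau^2 / 4)] decreases, so that [J^2 <= 4 / |Gamma (1 + i tau)|^2],
   and [|Gamma (1 + i tau)| cosh (pi tau / 2)] is bounded below. *)

Require Import Defs.
From mathcomp Require Import all_boot all_order all_algebra.
From mathcomp Require Import all_classical all_reals all_analysis.
From mathcomp Require Import measurable_realfun ring lra.

Import Order.TTheory GRing.Theory Num.Theory.
Import numFieldNormedType.Exports.

Local Open Scope classical_set_scope.
Local Open Scope ring_scope.
Local Open Scope complex_scope.

Set Implicit Arguments.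
Unset Strict Implicit.
Unset Printing Implicit Defensive.

(** * Differentiation rules and mean value estimates *)

Section Derivatives.
Variable R : realType.
Implicit Types (f g : R -> R) (x a b c : R).

(** Every Bessel function is carried as a pair of real functions, itself and its image under
    [x d/dx], so that each equation becomes a first-order system; the complex definitions are linked
    to these pairs only afterwards. The delicate constant is the value [1 / 8] of the integral of
    [P]. It is a boundary value of the Wronskian of [J] and [K], but near 0 both factors oscillate
    with [(tau / 2) ln (2 x)] and have no limit. Rotating [K] and its image by this angle gives
    combinations that do converge, to the real and imaginary parts of [Gamma (1 + i tau)]. They meet
    the denominator [|Gamma (1 + i tau)|^2] of [J], and the Wronskian tends to [1 / 2] whatever
    [tau] is. In the inversion formula [sinh (pi n) = 2 sinh (pi n / 2) cosh (pi n / 2)]: one factor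
    comes from the equation for [F], the other from the weights of the series. The same weights make
    the bound on the terms uniform in [n], so that summability of the coefficients yields a
    majorant. *)

Lemma dvC c x : is_derive x (1 : R) (fun=> c : R) 0.
Proof. exact: is_derive_cst. Qed.

Lemma dvI x : is_derive x (1 : R) (fun y : R => y : R) 1.
Proof. exact: is_derive_id. Qed.

Lemma dvD f g x a b : is_derive x (1 : R) f a -> is_derive x (1 : R) g b ->
  is_derive x (1 : R) (fun y => f y + g y) (a + b).
Proof. by move=> Hf Hg; exact: is_deriveD. Qed.

Lemma dvN f x a : is_derive x (1 : R) f a ->
  is_derive x (1 : R) (fun y => - f y) (- a).
Proof. by move=> Hf; exact: is_deriveN. Qed.

Lemma dvM f g x a b : is_derive x (1 : R) f a -> is_derive x (1 : R) g b ->
  is_derive x (1 : R) (fun y => f y * g y) (a * g x + f x * b).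
Proof.
move=> Hf Hg; apply: is_derive_eq.
by rewrite /GRing.scale /=; ring.
Qed.

Lemma dvX n f x a : is_derive x (1 : R) f a ->
  is_derive x (1 : R) (fun y => f y ^+ n) (n%:R * f x ^+ n.-1 * a).
Proof.
move=> Hf; elim: n => [|n IH].
  by rewrite mul0r mul0r; under eq_fun do rewrite expr0; exact: dvC.
under eq_fun do rewrite exprS; apply: (is_derive_eq (dvM Hf IH)).
case: n {IH} => [|n] /=; first by rewrite mul0r; ring.
by rewrite !exprS -[n.+2%:R]natr1 -natr1; ring.
Qed.

Lemma dv_comp f g x a b : is_derive (g x) (1 : R) f a ->
  is_derive x (1 : R) g b -> is_derive x (1 : R) (fun y => f (g y)) (a * b).
Proof. by move=> Hf Hg; exact: is_derive1_comp. Qed.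

Lemma dvV f x a : f x != 0 -> is_derive x (1 : R) f a ->
  is_derive x (1 : R) (fun y => (f y)^-1) (- (f x ^- 2) * a).
Proof.
move=> fx0 Hf; have := @is_deriveV R f x a 1 fx0 Hf.
by rewrite /GRing.scale /=.
Qed.

Lemma dv_exp f x a : is_derive x (1 : R) f a ->
  is_derive x (1 : R) (fun y => expR (f y)) (expR (f x) * a).
Proof. by move=> Hf; apply: (@dv_comp expR f). Qed.

Lemma dv_sin f x a : is_derive x (1 : R) f a ->
  is_derive x (1 : R) (fun y => sin (f y)) (cos (f x) * a).
Proof. by move=> Hf; apply: (@dv_comp sin f). Qed.

Lemma dv_cos f x a : is_derive x (1 : R) f a ->
  is_derive x (1 : R) (fun y => cos (f y)) (- sin (f x) * a).
Proof. by move=> Hf; apply: (@dv_comp cos f). Qed.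

Lemma dv_atan f x a : is_derive x (1 : R) f a ->
  is_derive x (1 : R) (fun y => atan (f y)) ((1 + f x ^+ 2)^-1 * a).
Proof. by move=> Hf; apply: (@dv_comp atan f). Qed.

Lemma dv_ln f x a : 0 < f x -> is_derive x (1 : R) f a ->
  is_derive x (1 : R) (fun y => ln (f y)) ((f x)^-1 * a).
Proof. by move=> fx0 Hf; apply: (@dv_comp (@ln R) f); exact: is_derive1_ln. Qed.

Lemma dv_sqrt f x a : 0 < f x -> is_derive x (1 : R) f a ->
  is_derive x (1 : R) (fun y => Num.sqrt (f y)) ((2 * Num.sqrt (f x))^-1 * a).
Proof.
by move=> fx0 Hf; apply: (@dv_comp (@Num.sqrt R) f); exact: is_derive1_sqrt.
Qed.

Lemma dv_cosh f x a : is_derive x (1 : R) f a ->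
  is_derive x (1 : R) (fun y => coshR (f y)) (sinhR (f x) * a).
Proof.
move=> Hf; rewrite /coshR /sinhR.
apply: (is_derive_eq (dvM (dvD (dv_exp Hf) (dv_exp (dvN Hf))) (dvC 2^-1 x))).
by ring.
Qed.

Lemma dv_sinh f x a : is_derive x (1 : R) f a ->
  is_derive x (1 : R) (fun y => sinhR (f y)) (coshR (f x) * a).
Proof.
move=> Hf; rewrite /coshR /sinhR.
apply: (is_derive_eq (dvM (dvD (dv_exp Hf) (dvN (dv_exp (dvN Hf)))) (dvC 2^-1 x))).
by ring.
Qed.

Lemma dv_cont f x a : is_derive x (1 : R) f a -> {for x, continuous f}.
Proof. by move=> [/derivable1_diffP df _]; exact: differentiable_continuous. Qed.

Lemma dv_eq f x a b : is_derive x (1 : R) f a -> a = b ->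
  is_derive x (1 : R) f b.
Proof. by move=> ? <-. Qed.

Lemma dv_nondec f g a b : a <= b ->
  (forall x, a <= x <= b -> is_derive x (1 : R) f (g x)) ->
  (forall x, a <= x <= b -> 0 <= g x) -> f a <= f b.
Proof.
move=> ab df g0.
have oo x : x \in `]a, b[ -> a <= x <= b.
  by rewrite in_itv/= => /andP[ax xb]; rewrite !ltW.
apply: (@ger0_derive1_le_cc _ f a b) => //.
- by move=> x /oo xab; have [] := df _ xab.
- move=> x /oo xab; rewrite derive1E (@derive_val _ _ _ _ _ _ _ (df x xab)).
  exact: g0.
- apply: derivable_within_continuous => x; rewrite in_itv/= => xab.
  by have [] := df _ xab.
- by rewrite in_itv /= lexx ab.
- by rewrite in_itv /= ab lexx.
Qed.

(** Both [M x - f x] and [M x + f x] are nondecreasing. *)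
Lemma dv_le f g a b M : a <= b ->
  (forall x, a <= x <= b -> is_derive x (1 : R) f (g x)) ->
  (forall x, a <= x <= b -> `|g x| <= M) -> `|f b - f a| <= M * (b - a).
Proof.
move=> ab df gM.
have h1 : M * a - f a <= M * b - f b.
  apply: (@dv_nondec (fun x => M * x - f x) (fun x => M - g x)) => // x xab.
    apply: dv_eq (dvD (dvM (dvC M x) (dvI x)) (dvN (df x xab))) _; ring.
  by rewrite subr_ge0 (le_trans (ler_norm _))// gM.
have h2 : M * a + f a <= M * b + f b.
  apply: (@dv_nondec (fun x => M * x + f x) (fun x => M + g x)) => // x xab.
    apply: dv_eq (dvD (dvM (dvC M x) (dvI x)) (df x xab)) _; ring.
  by have := gM _ xab; rewrite ler_norml => /andP[]; lra.
by rewrite ler_norml; apply/andP; split; lra.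
Qed.

Lemma dv_const f a b : a <= b ->
  (forall x, a <= x <= b -> is_derive x (1 : R) f 0) -> f a = f b.
Proof.
move=> ab df; have := @dv_le f (fun=> 0) a b 0 ab df.
rewrite mul0r normr0 => /(_ (fun _ _ => lexx 0)).
by rewrite normr_le0 subr_eq0 => /eqP.
Qed.

End Derivatives.

(** Syntax-directed differentiation. Derivatives known from the context come before the structural
    rules, directly or through the chain rule; the [change] branches restore the abstraction when a
    function shows up as a partial application. [dv] computes some derivative and leaves its
    equality with the expected one, together with the side conditions not found in the context. *)
Ltac dv_step :=
  first
  [ eassumption
  | notypeclasses refine (dvC _ _)
  | notypeclasses refine (dvI _)
  | match goal with H : context [is_derive _ _ ?f _] |- is_derive _ _ ?f _ =>
      solve [notypeclasses refine (H _ _); eassumption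
            | notypeclasses refine (H _)] end
  | match goal with H : context [is_derive _ _ ?f _]
      |- is_derive _ _ (fun y => ?f (@?g y)) _ =>
      notypeclasses refine (@dv_comp _ f g _ _ _ _ _);
      [first [notypeclasses refine (H _ _) | notypeclasses refine (H _)] | ] end
  | match goal with
    | |- is_derive ?x ?v (GRing.mul ?c) ?d =>
        change (is_derive x v (fun y => GRing.mul c y) d)
    | |- is_derive ?x ?v (GRing.add ?c) ?d =>
        change (is_derive x v (fun y => GRing.add c y) d)
    | |- is_derive ?x ?v (GRing.opp) ?d =>
        change (is_derive x v (fun y => GRing.opp y) d)
    | |- is_derive ?x ?v (expR) ?d =>
        change (is_derive x v (fun y => expR y) d)
    | |- is_derive ?x ?v (@sin _) ?d =>
        change (is_derive x v (fun y => @sin _ y) d)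
    | |- is_derive ?x ?v (@Num.sqrt _) ?d =>
        change (is_derive x v (fun y => Num.sqrt y) d)
    | |- is_derive ?x ?v (@GRing.inv _) ?d =>
        change (is_derive x v (fun y => y^-1) d)
    | |- is_derive ?x ?v (@cos _) ?d =>
        change (is_derive x v (fun y => @cos _ y) d)
    | |- is_derive ?x ?v (@atan _) ?d =>
        change (is_derive x v (fun y => @atan _ y) d)
    | |- is_derive ?x ?v (@ln _) ?d =>
        change (is_derive x v (fun y => @ln _ y) d)
    | |- is_derive ?x ?v (@coshR _) ?d =>
        change (is_derive x v (fun y => @coshR _ y) d)
    | |- is_derive ?x ?v (@sinhR _) ?d =>
        change (is_derive x v (fun y => @sinhR _ y) d)
    end
  | match goal with
    | |- is_derive _ _ (fun y => coshR (@?g y)) _ => notypeclasses refine (dv_cosh _)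
    | |- is_derive _ _ (fun y => sinhR (@?g y)) _ => notypeclasses refine (dv_sinh _)
    | |- is_derive _ _ (fun y => expR (@?g y)) _ => notypeclasses refine (dv_exp _)
    | |- is_derive _ _ (fun y => sin (@?g y)) _ => notypeclasses refine (dv_sin _)
    | |- is_derive _ _ (fun y => cos (@?g y)) _ => notypeclasses refine (dv_cos _)
    | |- is_derive _ _ (fun y => atan (@?g y)) _ => notypeclasses refine (dv_atan _)
    | |- is_derive _ _ (fun y => ln (@?g y)) _ => notypeclasses refine (dv_ln _ _)
    | |- is_derive _ _ (fun y => Num.sqrt (@?g y)) _ => notypeclasses refine (dv_sqrt _ _)
    | |- is_derive _ _ (fun y => (@?g y) ^+ _) _ => notypeclasses refine (dvX _ _)
    | |- is_derive _ _ (fun y => (@?g y)^-1) _ => notypeclasses refine (dvV _ _)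
    | |- is_derive _ _ (fun y => - (@?g y)) _ => notypeclasses refine (dvN _)
    | |- is_derive _ _ (fun y => (@?f y) + (@?g y)) _ => notypeclasses refine (dvD _ _)
    | |- is_derive _ _ (fun y => (@?f y) * (@?g y)) _ => notypeclasses refine (dvM _ _)
    end ].
Ltac dv := eapply dv_eq; [repeat dv_step | ]; cbv beta; cbn [Nat.pred].

(** * Integrals over the half-line *)

Section HalfLine.
Variable R : realType.
Implicit Types (f g F : R -> R) (x a b c : R).

Local Notation mu := (@lebesgue_measure R).
Local Notation ray := (`]0, +oo[%classic : set R).

Definition rayint f := \int[mu]_(t in ray) f t.
Definition ray_integrable f := mu.-integrable ray (EFin \o f).

Lemma in_ray x : ray x -> 0 < x.
Proof. by rewrite /= in_itv/= andbT. Qed.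

Lemma mem_ray x : 0 < x -> ray x.
Proof. by move=> x0; rewrite /= in_itv/= andbT. Qed.

Lemma ray_measurable f : (forall x, 0 < x -> {for x, continuous f}) ->
  measurable_fun ray f.
Proof.
move=> cf; apply: open_continuous_measurable_fun; first exact: interval_open.
by move=> x; rewrite inE => /in_ray; exact: cf.
Qed.

Lemma ray_integrable_le f g : measurable_fun ray f ->
  (forall x, 0 < x -> `|f x| <= g x) -> ray_integrable g -> ray_integrable f.
Proof.
move=> mf fg ig; apply: (@le_integrable _ _ _ mu _ _ _ (EFin \o g)) => //.
  exact/measurable_EFinP.
move=> x /in_ray x0; rewrite /= lee_fin.
by rewrite (le_trans (fg _ x0))// ler_norm.
Qed.

Lemma ray_integrable_eq f g : (forall x, 0 < x -> f x = g x) ->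
  ray_integrable f -> ray_integrable g.
Proof.
move=> fg; apply: eq_integrable => //.
by move=> x; rewrite inE => /in_ray x0 /=; rewrite fg.
Qed.

Lemma ray_integrable_meas f : ray_integrable f -> measurable_fun ray f.
Proof. by move=> /integrableP[/measurable_EFinP]. Qed.

Lemma ray_integrableD f g : ray_integrable f -> ray_integrable g ->
  ray_integrable (fun x => f x + g x).
Proof.
move=> fi gi.
have : mu.-integrable ray ((EFin \o f) \+ (EFin \o g))%E by apply: integrableD.
by apply: eq_integrable => // x _.
Qed.

Lemma ray_integrableZ c f : ray_integrable f ->
  ray_integrable (fun x => c * f x).
Proof.
move=> fi.
have : mu.-integrable ray (fun x => c%:E * (EFin \o f) x)%E by apply: integrableZl.
by apply: eq_integrable => // x _.
Qed.

Lemma ray_integrableN f : ray_integrable f -> ray_integrable (fun x => - f x).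
Proof.
move=> fi; apply: (ray_integrable_eq _ (ray_integrableZ (-1) fi)) => x _.
by rewrite mulN1r.
Qed.

Lemma ray_integrableB f g : ray_integrable f -> ray_integrable g ->
  ray_integrable (fun x => f x - g x).
Proof. by move=> fi gi; apply: ray_integrableD => //; exact: ray_integrableN. Qed.

Lemma ray_integrable_norm f : ray_integrable f ->
  ray_integrable (fun x => `|f x|).
Proof. exact: integrable_norm. Qed.

Lemma rayint_eq f g : (forall x, 0 < x -> f x = g x) -> rayint f = rayint g.
Proof.
move=> fg; apply: eq_Rintegral => x; rewrite inE => /in_ray; exact: fg.
Qed.

Lemma rayintD f g : ray_integrable f -> ray_integrable g ->
  rayint (fun x => f x + g x) = rayint f + rayint g.
Proof. exact: RintegralD. Qed.

Lemma rayintB f g : ray_integrable f -> ray_integrable g ->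
  rayint (fun x => f x - g x) = rayint f - rayint g.
Proof. exact: RintegralB. Qed.

Lemma rayintZ c f : ray_integrable f ->
  rayint (fun x => c * f x) = c * rayint f.
Proof. by move=> fi; rewrite /rayint RintegralZl. Qed.

Lemma rayint_le f g : ray_integrable f -> ray_integrable g ->
  (forall x, 0 < x -> f x <= g x) -> rayint f <= rayint g.
Proof.
move=> fi gi fg; apply: le_Rintegral => // x /in_ray; exact: fg.
Qed.

Lemma rayint_norm_le f g : measurable_fun ray f -> ray_integrable g ->
  (forall x, 0 < x -> `|f x| <= g x) -> `|rayint f| <= rayint g.
Proof.
move=> mf gi fg; have fi := ray_integrable_le mf fg gi.
apply: (le_trans (le_normr_Rintegral _ fi)) => //.
by apply: rayint_le => //; exact: ray_integrable_norm.
Qed.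

(** A compact exhaustion of the half-line; the shift by 2 keeps the end points distinct from the
    first index on. *)
Let J n : set R := `[n.+2%:R^-1, n.+2%:R].

Let nat_gt1 n : 1 < n.+2%:R :> R.
Proof. by rewrite ltr1n. Qed.

Let J_lt n : n.+2%:R^-1 < n.+2%:R :> R.
Proof.
apply: lt_trans (nat_gt1 n); rewrite invf_lt1 ?(lt_trans ltr01)//; exact: nat_gt1.
Qed.

Let J_gt0 n x : J n x -> 0 < x.
Proof.
by rewrite /J /= in_itv/= => /andP[nx _]; apply: lt_le_trans nx; rewrite invr_gt0.
Qed.

Let J_nondec : nondecreasing_seq J.
Proof.
move=> m n mn; rewrite subsetEset => x; rewrite /J /= !in_itv/= => /andP[mx xm].
apply/andP; split.
  by apply: le_trans mx; rewrite lef_pV2 ?posrE// ler_nat !ltnS.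
by apply: (le_trans xm); rewrite ler_nat !ltnS.
Qed.

Let J_cover x : 0 < x -> exists n, J n x.
Proof.
move=> x0; have x'0 : 0 < x^-1 by rewrite invr_gt0.
pose m := (Num.truncn x); pose k := (Num.truncn x^-1).
exists (maxn m k); rewrite /J /= in_itv/=; apply/andP; split.
  rewrite invf_ple ?posrE// ltW//.
  apply: (lt_le_trans (Num.Theory.truncnS_gt _)).
  by rewrite ler_nat ltnS (leq_trans (leq_maxr m k)).
apply/ltW/(lt_le_trans (Num.Theory.truncnS_gt _)).
by rewrite ler_nat ltnS (leq_trans (leq_maxl m k)).
Qed.

Let bigcupJ : \bigcup_n J n = ray.
Proof.
apply/seteqP; split => [x [n _ /J_gt0]|x /in_ray /J_cover[n Jn]].
  exact: mem_ray.
by exists n.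
Qed.

Let FTC_J f F n : (forall x, 0 < x -> {for x, continuous f}) ->
  (forall x, 0 < x -> is_derive x (1 : R) F (f x)) ->
  (\int[mu]_(t in J n) (f t)%:E = (F n.+2%:R)%:E - (F n.+2%:R^-1)%:E)%E.
Proof.
move=> cf dF; have n0 : 0 < n.+2%:R^-1 :> R by rewrite invr_gt0.
have Fc x : 0 < x -> {for x, continuous F} by move=> x0; exact: dv_cont (dF _ x0).
apply: continuous_FTC2; first exact: J_lt.
- apply/continuous_within_itvP; first exact: J_lt.
  split.
  + move=> x; rewrite in_itv/= => /andP[nx _]; apply: cf; exact: lt_trans nx.
  + by apply: cvg_at_right_filter; apply: cf.
  + by apply: cvg_at_left_filter; apply: cf; exact: lt_trans (J_lt n).
- split.
  + move=> x; rewrite in_itv/= => /andP[nx _].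
    by have [] := dF _ (lt_trans n0 nx).
  + by apply: cvg_at_right_filter; apply: Fc.
  + by apply: cvg_at_left_filter; apply: Fc; exact: lt_trans (J_lt n).
- move=> x; rewrite in_itv/= => /andP[nx _]; rewrite derive1E.
  exact: (@derive_val _ _ _ _ _ _ _ (dF _ (lt_trans n0 nx))).
Qed.

(** Monotone convergence along [J]: each integral over [J n] is a difference of two values of [F],
    hence at most [2 M]. *)
Lemma ray_integrable_primitive f F (M : R) :
  (forall x, 0 < x -> {for x, continuous f}) ->
  (forall x, 0 < x -> is_derive x (1 : R) F (f x)) ->
  (forall x, 0 < x -> 0 <= f x) ->
  (forall x, 0 < x -> `|F x| <= M) -> ray_integrable f.
Proof.
move=> cf dF f0 FM; have mf := ray_measurable cf.
apply/integrableP; split; first exact/measurable_EFinP.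
have -> : (\int[mu]_(x in ray) `|(EFin \o f) x| =
    \int[mu]_(x in ray) (EFin \o f) x)%E.
  apply: eq_integral => x; rewrite inE => /in_ray x0 /=.
  by rewrite ger0_norm// f0.
rewrite -bigcupJ.
have mfJ n : measurable_fun (J n) (EFin \o f).
  apply/measurable_EFinP; apply: measurable_funS mf => //.
  by move=> x /J_gt0; exact: mem_ray.
have cvgJ : (\int[mu]_(x in J n) (EFin \o f) x @[n --> \oo] -->
    \int[mu]_(x in \bigcup_n J n) (EFin \o f) x)%E.
  apply: ge0_nondecreasing_set_cvg_integral => //.
    by move=> n; exact: measurable_itv.
  by move=> n x /J_gt0 x0; rewrite lee_fin f0.
rewrite -(cvg_lim _ cvgJ)//.
apply: (@le_lt_trans _ _ (M + M)%:E); last by rewrite ltry.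
apply: lime_le.
  exact: (cvgP _ cvgJ).
apply: nearW => n; rewrite FTC_J// -EFinB lee_fin.
apply: lerD; first by rewrite (le_trans (ler_norm _))// FM.
by rewrite (le_trans (ler_norm _))// normrN FM// invr_gt0.
Qed.

(** Dominated convergence along [J], with majorant [|f|]; the integrals over [J n] are differences
    of values of [F] at points going to infinity and to 0. *)
Lemma rayint_FTC f F A B :
  (forall x, 0 < x -> {for x, continuous f}) ->
  (forall x, 0 < x -> is_derive x (1 : R) F (f x)) ->
  ray_integrable f ->
  F x @[x --> 0^'+] --> A -> F x @[x --> +oo] --> B -> rayint f = B - A.
Proof.
move=> cf dF fi FA FB; have mf := ray_integrable_meas fi.
have mJ n : measurable (J n) by exact: measurable_itv.
have c1 : (\int[mu]_(t in ray) ((f \_ (J n)) t)%:E)%E @[n --> \oo] -->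
    (\int[mu]_(t in ray) (f t)%:E)%E.
  apply: (@dominated_cvg _ _ _ mu _ _ (fun n t => ((f \_ (J n)) t)%:E)
    _ (fun t => (`|f t|)%:E)) => //.
  - move=> n; apply/measurable_EFinP/measurable_funTS.
    apply/(measurable_restrictT f (mJ n)); apply: measurable_funS mf => //.
    by move=> x /J_gt0; exact: mem_ray.
  - move=> x /in_ray /J_cover[n Jn]; apply: cvg_near_cst.
    exists n => // m /= nm; rewrite patchE mem_set//.
    by have /subsetPset := J_nondec nm; apply.
  - exact: ray_integrable_norm.
  - by move=> n x _ /=; rewrite lee_fin patchE; case: ifP; rewrite ?normr0.
have c2 : (F n.+2%:R - F n.+2%:R^-1) @[n --> \oo] --> B - A.
  apply: cvgB.
    apply: (cvg_comp _ _ _ FB).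
    apply/cvgryPge => M; near=> n.
    rewrite (@le_trans _ _ n%:R)//; last by rewrite ler_nat -addn2 leq_addr.
    by near: n; exact: nbhs_infty_ger.
  move/cvg_at_rightP : FA; apply; split; first by move=> n; rewrite invr_gt0.
  (* The left end points form the harmonic sequence shifted by one. *)
  have := @cvg_harmonic R; rewrite -(cvg_shiftS (@harmonic R)) => h.
  by apply: cvg_trans h; apply: near_eq_cvg; near=> n.
have E n : (\int[mu]_(t in ray) ((f \_ (J n)) t)%:E =
    (F n.+2%:R - F n.+2%:R^-1)%:E)%E.
  rewrite EFinB -(@FTC_J f)//.
  transitivity (\int[mu]_(t in ray) ((EFin \o f) \_ (J n)) t)%E.
    by rewrite restrict_EFin.
  rewrite -integral_mkcondr; congr (integral _ _ _).
  by rewrite setIC; apply: setIidl => x /J_gt0; exact: mem_ray.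
move: c1; under eq_fun do rewrite E.
move=> c1; have := cvg_unique _ c1 (cvg_EFin _ c2).
rewrite /rayint /Rintegral => ->//.
by near=> n.
Unshelve. all: by end_near. Qed.

Lemma rayint_dv (h h' : R -> R -> R) u v c G : u < c < v ->
  (forall a, u < a < v -> ray_integrable (h a)) ->
  (forall a t, u < a < v -> 0 < t ->
     is_derive a (1 : R) (h ^~ t) (h' a t)) ->
  ray_integrable G ->
  (forall a t, u < a < v -> 0 < t -> `|h' a t| <= G t) ->
  is_derive c (1 : R) (fun a => rayint (h a)) (rayint (h' c)).
Proof.
move=> ucv hi hd Gi hG.
have Ic : `]u, v[%classic c by rewrite /= in_itv.
have cv := @cvg_differentiation_under_integral _ _ _ mu h ray (measurable_itv _)
  c u v Ic _ _ (fun t => `|G t|) (fun=> normr_ge0 _).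
have p1 a t : u < a < v -> 0 < t -> partial1of2 h a t = h' a t.
  move=> ua t0; rewrite /partial1of2 derive1E.
  exact: (@derive_val _ _ _ _ _ _ _ (hd _ _ ua t0)).
have {}cv : h0^-1 *: (rayint (h (h0 + c)) - rayint (h c)) @[h0 --> 0^'] -->
    rayint (h' c).
  rewrite (@rayint_eq (h' c) (partial1of2 h c)); last first.
    by move=> t t0; rewrite p1.
  apply: cv.
  - by move=> a; rewrite /= in_itv/=; exact: hi.
  - move=> a t; rewrite /= in_itv/= => ua /in_ray t0.
    by have [] := hd _ _ ua t0.
  - exact: ray_integrable_norm.
  - move=> a t; rewrite /= in_itv/= => ua /in_ray t0.
    by rewrite p1// (le_trans (hG _ _ ua t0))// ler_norm.
apply: DeriveDef.
  by apply/cvg_ex; exists (rayint (h' c)); under eq_fun do rewrite scaler1.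
rewrite /derive; apply: cvg_lim => //.
by under eq_fun do rewrite scaler1.
Qed.

End HalfLine.

(** * Limits from explicit rates, and domination by exponentials *)

Section Bounds.
Variable R : realType.
Implicit Types (f g : R -> R) (x t q C : R).

Lemma cvg_at0_le f l C : (forall x, 0 < x < 1 -> `|f x - l| <= C * Num.sqrt x) ->
  f x @[x --> 0^'+] --> l.
Proof.
move=> H; apply/cvgrPdist_le => e e0.
pose D := `|C| + 1; have D0 : 0 < D by rewrite ltr_pwDr.
near=> x.
have x01 : 0 < x < 1 by apply/andP; split; near: x; [exact: nbhs_right_gt|exact: nbhs_right_lt].
rewrite distrC (le_trans (H _ x01))//.
have xe : x < (e / D) ^+ 2 by near: x; apply: nbhs_right_lt; rewrite exprn_gt0// divr_gt0.
have se : Num.sqrt x <= e / D.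
  rewrite (@le_trans _ _ (Num.sqrt ((e / D) ^+ 2)))//.
    by apply: ler_wsqrtr; exact: ltW.
  by rewrite sqrtr_sqr ger0_norm// ltW// divr_gt0.
apply: (@le_trans _ _ (D * Num.sqrt x)).
  rewrite ler_wpM2r ?sqrtr_ge0//.
  by rewrite (le_trans (ler_norm C))// lerDl.
by rewrite mulrC -ler_pdivlMr.
Unshelve. all: by end_near. Qed.

Lemma cvg_at0_lin f l C : (forall x, 0 < x < 1 -> `|f x - l| <= C * x) ->
  f x @[x --> 0^'+] --> l.
Proof.
move=> H; apply: (@cvg_at0_le _ _ `|C|) => x /andP[x0 x1].
rewrite (le_trans (H _ _)) ?x0//.
apply: (@le_trans _ _ (`|C| * x)); first by rewrite ler_wpM2r ?ler_norm// ltW.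
rewrite ler_wpM2l// (@le_trans _ _ (Num.sqrt (x ^+ 2)))//.
  by rewrite sqrtr_sqr ler_norm.
by apply: ler_wsqrtr; rewrite expr2 ler_piMl// ltW.
Qed.

Lemma cvg_aty_le f l C : (forall x, 1 < x -> `|f x - l| <= C / x) ->
  f x @[x --> +oo] --> l.
Proof.
move=> H; apply/cvgrPdist_le => e e0.
pose D := `|C| + 1; have D0 : 0 < D by rewrite ltr_pwDr.
near=> x.
have x1 : 1 < x by near: x; apply: nbhs_pinfty_gt; exact: num_real.
have xe : D / e < x by near: x; apply: nbhs_pinfty_gt; exact: num_real.
rewrite distrC (le_trans (H _ x1))// ler_pdivrMr ?(lt_trans _ x1)//.
rewrite (le_trans (ler_norm C))// (@le_trans _ _ D)// ?lerDl//.
by rewrite ltr_pdivrMr// mulrC in xe; exact: ltW.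
Unshelve. all: by end_near. Qed.

(** A single term [q^k / k!] of the exponential series is at most [e^q]. *)
Lemma pow_expN_le k q : 0 <= q -> q ^+ k * expR (- q) <= k`!%:R.
Proof.
move=> q0; rewrite expRN ler_pdivrMr ?expR_gt0//.
case: k => [|k]; first by rewrite expr0 mul1r (le_trans _ (expR_ge1Dx q))// lerDl.
have := expR_ge1Dxn k q0; have k0 : 0 < k.+1`!%:R :> R by rewrite ltr0n fact_gt0.
move=> h; rewrite mulrC -ler_pdivrMr//; apply: le_trans h.
by rewrite lerDr.
Qed.

Lemma coshR_sinhR t : coshR t ^+ 2 - sinhR t ^+ 2 = 1 :> R.
Proof.
by rewrite -[RHS](expRxMexpNx_1 t) /coshR /sinhR; field.
Qed.

Lemma coshR_gt0 t : 0 < coshR t :> R.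
Proof. by rewrite /coshR divr_gt0// addr_gt0// expR_gt0. Qed.

Lemma sinhR_ge t : 0 <= t -> t <= sinhR t.
Proof.
move=> t0; rewrite /sinhR.
pose F (x : R) : R := (expR x - expR (- x)) / 2 - x.
have dF x : is_derive x (1 : R) F ((expR x + expR (- x)) / 2 - 1).
  rewrite /F; dv; ring.
have F'0 (x : R) : 0 <= (expR x + expR (- x)) / 2 - 1.
  by have := expR_ge1Dx x; have := expR_ge1Dx (- x); lra.
have : F 0 <= F t.
  by apply: (@dv_nondec _ F _ 0 t t0 (fun x _ => dF x)) => x _; exact: F'0.
by rewrite /F oppr0 subrr mul0r addr0 subr_ge0.
Qed.

Lemma sinhR_ge0 t : 0 <= t -> 0 <= sinhR t.
Proof. by move=> t0; rewrite (le_trans t0)// sinhR_ge. Qed.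

Lemma sinhR_lt_coshR t : sinhR t < coshR t.
Proof.
rewrite /sinhR /coshR; have := expR_gt0 (- t); lra.
Qed.

Lemma coshR_ge1 t : 1 <= coshR t.
Proof.
by rewrite /coshR; have := expR_ge1Dx t; have := expR_ge1Dx (- t); lra.
Qed.

Lemma coshR_expR t : (coshR t)^-1 <= 2 * expR (- t).
Proof.
rewrite -[leLHS]mul1r ler_pdivrMr ?coshR_gt0// /coshR.
have := expRxMexpNx_1 t; have := sqr_ge0 (expR (- t)); lra.
Qed.

Lemma expN_le_inv a t : 0 < a -> 0 < t -> expR (- (a * t)) <= a^-1 / t.
Proof.
move=> a0 t0; rewrite -invfM expRN lef_pV2 ?posrE ?expR_gt0 ?mulr_gt0//.
by rewrite (le_trans _ (expR_ge1Dx _))// lerDr.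
Qed.

Let exp_cont (a t : R) : {for t, continuous (fun x => expR (- (a * x)))}.
Proof.
have d : is_derive t (1 : R) (fun x => expR (- (a * x))) (- a * expR (- (a * t))).
  by dv; ring.
exact: dv_cont d.
Qed.

Let exp_dv (a x : R) : a != 0 ->
  is_derive x (1 : R) (fun x => - a^-1 * expR (- (a * x))) (expR (- (a * x))).
Proof. by move=> a0; dv; field. Qed.

Lemma ray_integrable_exp a : 0 < a -> ray_integrable (fun t => expR (- (a * t))).
Proof.
move=> a0; apply: (@ray_integrable_primitive _ _
  (fun t => - a^-1 * expR (- (a * t))) a^-1).
- by move=> x _; exact: exp_cont.
- by move=> x _; apply: exp_dv; rewrite gt_eqF.
- by move=> x _; exact: expR_ge0.
- move=> x x0; have ai : 0 <= a^-1 by rewrite invr_ge0 ltW.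
  rewrite normrM normrN (ger0_norm ai) (ger0_norm (expR_ge0 _)) ler_piMr//.
  by rewrite expR_le1 oppr_le0 ltW// mulr_gt0.
Qed.

Lemma rayint_exp a : 0 < a -> rayint (fun t => expR (- (a * t))) = a^-1.
Proof.
move=> a0; have an0 : a != 0 by rewrite gt_eqF.
rewrite (rayint_FTC (A := - a^-1) (B := 0) (fun x _ => @exp_cont a x)
  (fun x _ => @exp_dv a x an0) (ray_integrable_exp a0)).
- by rewrite sub0r opprK.
- have := dv_cont (@exp_dv a 0 an0); move=> /cvg_at_right_filter.
  by rewrite mulr0 oppr0 expR0 mulr1.
- apply: (@cvg_aty_le _ _ (a^-1 * a^-1)) => x x1.
  have ai : 0 <= a^-1 by rewrite invr_ge0 ltW.
  rewrite subr0 normrM normrN (ger0_norm ai) (ger0_norm (expR_ge0 _)).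
  rewrite -mulrA ler_pM2l ?invr_gt0//.
  by rewrite expN_le_inv// (lt_trans _ x1).
Qed.

Lemma ray_dom_integrable f D :
  (forall t, 0 < t -> {for t, continuous f}) ->
  (forall t, 0 < t -> `|f t| <= D * expR (- t)) -> ray_integrable f.
Proof.
move=> cf fD; apply: (@ray_integrable_le _ _ (fun t => D * expR (- (1 * t)))).
- exact: ray_measurable.
- by move=> x x0; rewrite mul1r fD.
- by apply: ray_integrableZ; exact: ray_integrable_exp.
Qed.

Lemma ray_dom_norm f D :
  (forall t, 0 < t -> {for t, continuous f}) ->
  (forall t, 0 < t -> `|f t| <= D * expR (- t)) -> `|rayint f| <= D.
Proof.
move=> cf fD.
rewrite (le_trans (@rayint_norm_le _ _ (fun t => D * expR (- (1 * t))) _ _ _))//.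
- exact: ray_measurable.
- by apply: ray_integrableZ; exact: ray_integrable_exp.
- by move=> x x0; rewrite mul1r fD.
- by rewrite rayintZ ?rayint_exp ?invr1 ?mulr1//; exact: ray_integrable_exp.
Qed.

End Bounds.

(** * Integrals of [f (z cosh t) cos (tau t)] *)

Section CoshTransform.
Variable R : realType.
Implicit Types (f g : R -> R) (z t q C tau : R).

Definition poscont f := forall q, 0 < q -> {for q, continuous f}.

(** The orders start at 1: one factor [1 / (z cosh t)] makes the integrand of [Nint] smaller than a
    multiple of [e^-t], and the further ones turn into decay in [z]. *)
Definition rapid f :=
  forall k, exists C, forall q, 0 < q -> q ^+ k.+1 * `|f q| <= C.

(** For [f q = e^-q] this is [K_(i tau) (z)]. With [tau = 0], the choices [e^-q cos q] and
    [- e^-q sin q] give the real and imaginary parts of [K_0 ((1 + i) z)]. *)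
Definition Nint f tau z := rayint (fun t => f (z * coshR t) * cos (tau * t)).

Lemma poscont_mulX f : poscont f -> poscont (fun q => q * f q).
Proof. by move=> cf q q0; apply: continuousM; [exact: cvg_id | exact: cf]. Qed.

Lemma rapid_mulX f : rapid f -> rapid (fun q => q * f q).
Proof.
move=> rf k; have [C fC] := rf k.+1; exists C => q q0.
by rewrite normrM gtr0_norm// mulrA -exprSr fC.
Qed.

Lemma rapidD f g : rapid f -> rapid g -> rapid (fun q => f q + g q).
Proof.
move=> rf rg k; have [C fC] := rf k; have [D gD] := rg k.
exists (C + D) => q q0; apply: (le_trans _ (lerD (fC q q0) (gD q q0))).
rewrite -mulrDr ler_wpM2l ?exprn_ge0 ?ler_normD//; exact: ltW.
Qed.

Lemma rapid_exp f C : (forall q, 0 < q -> `|f q| <= C * expR (- q)) -> rapid f.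
Proof.
move=> fC k; exists (C * (k.+1`!)%:R) => q q0.
have C0 : 0 <= C.
  have := le_trans (normr_ge0 _) (fC _ q0).
  by rewrite pmulr_lge0 ?expR_gt0.
rewrite (@le_trans _ _ (C * (q ^+ k.+1 * expR (- q))))//.
  by rewrite mulrCA ler_wpM2l ?fC// exprn_ge0// ltW.
by rewrite ler_wpM2l// pow_expN_le// ltW.
Qed.

Lemma kernel_cont f tau z t : poscont f -> 0 < z ->
  {for t, continuous (fun t => f (z * coshR t) * cos (tau * t))}.
Proof.
move=> cf z0; apply: continuousM.
  apply: (@continuous_comp _ _ _ (fun t => z * coshR t) f).
    have d : is_derive t (1 : R) (fun t => z * coshR t) (z * sinhR t) by dv; ring.
    exact: dv_cont d.
  by apply: cf; rewrite mulr_gt0// coshR_gt0.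
have d : is_derive t (1 : R) (fun t => cos (tau * t)) (- tau * sin (tau * t)).
  by dv; ring.
exact: dv_cont d.
Qed.

(** Of the factors [1 / cosh t] one is bounded by [2 e^-t] and the others by 1. *)
Lemma kernel_le f C k tau z t : 0 < z ->
  (forall q, 0 < q -> q ^+ k.+1 * `|f q| <= C) ->
  `|f (z * coshR t) * cos (tau * t)| <= 2 * C / z ^+ k.+1 * expR (- t).
Proof.
move=> z0 fC; have c0 := coshR_gt0 t; have q0 : 0 < z * coshR t by rewrite mulr_gt0.
have C0 : 0 <= C.
  by apply: (le_trans _ (fC _ q0)); rewrite mulr_ge0// exprn_ge0// ltW.
rewrite normrM (@le_trans _ _ (`|f (z * coshR t)|))//.
  by rewrite ler_piMr// ler_norml cos_geN1 cos_le1.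
rewrite (@le_trans _ _ (C / (z * coshR t) ^+ k.+1))//.
  by rewrite ler_pdivlMr ?exprn_gt0// mulrC fC.
have ch : (coshR t ^+ k.+1)^-1 <= 2 * expR (- t).
  apply: (le_trans _ (coshR_expR t)).
  rewrite lef_pV2 ?posrE ?exprn_gt0// -[leLHS]expr1 ler_weXn2l//.
  exact: coshR_ge1.
have -> : 2 * C / z ^+ k.+1 * expR (- t) = C / z ^+ k.+1 * (2 * expR (- t)).
  by rewrite [2 * C]mulrC -!mulrA [2 * (_ * _)]mulrCA.
rewrite exprMn invfM [leLHS]mulrA; apply: ler_wpM2l => //.
by rewrite mulr_ge0// invr_ge0 exprn_ge0// ltW.
Qed.

Lemma Nint_integrable f tau z : poscont f -> rapid f -> 0 < z ->
  ray_integrable (fun t => f (z * coshR t) * cos (tau * t)).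
Proof.
move=> cf rf z0; have [C fC] := rf 0%N.
apply: (@ray_dom_integrable _ _ (2 * C / z ^+ 1)).
  by move=> t _; exact: kernel_cont.
by move=> t _; exact: kernel_le.
Qed.

Lemma Nint_le f C k tau z : poscont f -> 0 < z ->
  (forall q, 0 < q -> q ^+ k.+1 * `|f q| <= C) ->
  `|Nint f tau z| <= 2 * C / z ^+ k.+1.
Proof.
move=> cf z0 fC; apply: ray_dom_norm.
  by move=> t _; exact: kernel_cont.
by move=> t _; exact: kernel_le.
Qed.

(** Differentiating under the integral brings out [cosh t = (z cosh t) / z], so the result is again
    a [Nint], of the image of [f] under [q d/dq]. *)
Lemma Nint_dv f f1 tau z : (forall q, 0 < q -> is_derive q (1 : R) f (f1 q)) ->
  poscont f1 -> rapid f -> rapid f1 -> 0 < z ->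
  is_derive z (1 : R) (Nint f tau) (Nint (fun q => q * f1 q) tau z / z).
Proof.
move=> df cf1 rf rf1 z0.
have cf : poscont f by move=> q q0; exact: dv_cont (df q q0).
have cf1' : poscont (fun q => q * f1 q).
  exact: poscont_mulX.
have rf1' := rapid_mulX rf1.
have z2 : 0 < z / 2 by rewrite divr_gt0.
have [C fC] := rf1' 0%N.
pose h' z t := coshR t * f1 (z * coshR t) * cos (tau * t).
have -> : Nint (fun q => q * f1 q) tau z / z = rayint (h' z).
  rewrite /Nint mulrC -rayintZ; last exact: (@Nint_integrable (fun q => q * f1 q)).
  by apply: rayint_eq => t _; rewrite /h' -!mulrA mulKf// gt_eqF.
(* Staying above [z / 2] keeps the negative powers of the parameter bounded in the majorant. *)
apply: (@rayint_dv _ (fun z t => f (z * coshR t) * cos (tau * t)) h' (z / 2) (z + 1) z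
  (fun t => (z / 2)^-1 * (2 * C / (z / 2) ^+ 1) * expR (- (1 * t)))).
- by apply/andP; split; lra.
- by move=> a /andP[za _]; apply: Nint_integrable => //; exact: lt_trans za.
- move=> a t /andP[za _] t0.
  have a0 : 0 < a * coshR t by rewrite mulr_gt0 ?coshR_gt0// (lt_trans _ za).
  by rewrite /h'; dv; ring.
- by apply: ray_integrableZ; exact: ray_integrable_exp.
- move=> a t /andP[za _] t0.
  have a0 : 0 < a by exact: lt_trans za.
  have -> : h' a t = a^-1 * ((a * coshR t) * f1 (a * coshR t) * cos (tau * t)).
    by rewrite /h' -!mulrA mulKf// gt_eqF.
  have C0 : 0 <= C by apply: le_trans (fC 1 ltr01); rewrite mulr_ge0.
  rewrite mul1r normrM -[leRHS]mulrA ler_pM//.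
    have ai : 0 < a^-1 by rewrite invr_gt0.
    by rewrite (gtr0_norm ai) lef_pV2 ?posrE//; exact: ltW.
  apply: (le_trans (kernel_le tau t a0 fC)).
  rewrite ler_wpM2r ?expR_ge0// ler_wpM2l ?mulr_ge0// !expr1.
  by rewrite lef_pV2 ?posrE//; exact: ltW.
Qed.

Variables (f f1 f2 : R -> R).
Hypothesis df : forall q, 0 < q -> is_derive q (1 : R) f (f1 q).
Hypothesis df1 : forall q, 0 < q -> is_derive q (1 : R) f1 (f2 q).
Hypothesis cf2 : poscont f2.
Hypothesis rf : rapid f.
Hypothesis rf1 : rapid f1.
Hypothesis rf2 : rapid f2.

Let cf : poscont f. Proof. by move=> q q0; exact: dv_cont (df q0). Qed.
Let cf1 : poscont f1. Proof. by move=> q q0; exact: dv_cont (df1 q0). Qed.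

(* The derivative in [t] of [f1 (z cosh t) z sinh t cos (tau t) + tau f (z cosh t)
   sin (tau t)] integrates to 0. *)
Lemma Nint_bessel tau z : 0 < z ->
  Nint (fun q => q * (f1 q + q * f2 q)) tau z =
  z ^+ 2 * Nint f2 tau z - tau ^+ 2 * Nint f tau z.
Proof.
move=> z0.
pose g q := q * (f1 q + q * f2 q).
have cg : poscont g.
  apply: poscont_mulX => q q0; apply: continuousD; first exact: cf1.
  by apply: poscont_mulX.
have rg : rapid g.
  by apply/rapid_mulX/rapidD => //; exact: rapid_mulX.
have i1 := Nint_integrable tau cg rg z0.
have i2 := Nint_integrable tau cf2 rf2 z0.
have i3 := Nint_integrable tau cf rf z0.
pose T t := f1 (z * coshR t) * (z * sinhR t) * cos (tau * t) +
  tau * (f (z * coshR t) * sin (tau * t)).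
pose T' t := g (z * coshR t) * cos (tau * t) -
  z ^+ 2 * (f2 (z * coshR t) * cos (tau * t)) +
  tau ^+ 2 * (f (z * coshR t) * cos (tau * t)).
have dT t : is_derive t (1 : R) T (T' t).
  have q0 : 0 < z * coshR t by rewrite mulr_gt0// coshR_gt0.
  rewrite /T; dv; rewrite /T' /g.
  have := coshR_sinhR t => cs.
  (* Inserting [cosh^2 - sinh^2 = 1] here turns the claim into a polynomial identity. *)
  have -> : z ^+ 2 = z ^+ 2 * (coshR t ^+ 2 - sinhR t ^+ 2) by rewrite cs mulr1.
  ring.
have cT' t : {for t, continuous T'}.
  apply: continuousD.
    apply: continuousB; first exact: kernel_cont.
    by apply: (continuousM (cvg_cst _)); exact: kernel_cont.
  by apply: (continuousM (cvg_cst _)); exact: kernel_cont.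
have [C1 f1C] := rapid_mulX rf1 0; have [C0 fC] := rf 0.
have Tle t : 0 < t -> `|T t| <=
    (2 * C1 / z ^+ 1 + `|tau| * (2 * C0 / z ^+ 1)) / t.
  move=> t0; have c0 := coshR_gt0 t.
  have e : expR (- t) <= t^-1.
    by have := @expN_le_inv R 1 t ltr01 t0; rewrite mul1r invr1 mul1r.
  have C1p : 0 <= C1 by apply: le_trans (f1C 1 ltr01); rewrite mulr_ge0.
  have C0p : 0 <= C0 by apply: le_trans (fC 1 ltr01); rewrite mulr_ge0.
  have k1 := kernel_le 0 t z0 f1C; have k0 := kernel_le 0 t z0 fC.
  rewrite mul0r cos0 mulr1 in k1; rewrite mul0r cos0 mulr1 in k0.
  rewrite /T (le_trans (ler_normD _ _))// mulrDl lerD//.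
    rewrite normrM (@le_trans _ _ (`|z * coshR t * f1 (z * coshR t)|))//.
      rewrite (@le_trans _ _ (`|f1 (z * coshR t) * (z * sinhR t)|))//.
        by rewrite ler_piMr// ler_norml cos_geN1 cos_le1.
      have s0 : 0 <= sinhR t by rewrite sinhR_ge0// ltW.
      rewrite [f1 _ * _]mulrC normrM [leRHS]normrM ler_wpM2r//.
      rewrite normrM [leRHS]normrM ler_wpM2l// (ger0_norm s0) (gtr0_norm c0).
      by rewrite ltW// sinhR_lt_coshR.
    rewrite (le_trans k1)// ler_wpM2l// mulr_ge0 ?invr_ge0 ?exprn_ge0 ?mulr_ge0//.
    exact: ltW.
  rewrite normrM -[leRHS]mulrA ler_wpM2l//.
  rewrite normrM (@le_trans _ _ (`|f (z * coshR t)|))//.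
    by rewrite ler_piMr// ler_norml sin_geN1 sin_le1.
  rewrite (le_trans k0)// ler_wpM2l// mulr_ge0 ?invr_ge0 ?exprn_ge0 ?mulr_ge0//.
  exact: ltW.
have iT' : ray_integrable T'.
  apply: ray_integrableD; last exact: ray_integrableZ.
  by apply: ray_integrableB => //; exact: ray_integrableZ.
have := @rayint_FTC R T' T 0 0 (fun t _ => cT' t) (fun t _ => dT t) iT' _ _.
rewrite subrr => I0.
have : rayint T' = 0.
  apply: I0.
    have := dv_cont (dT 0); move/cvg_at_right_filter.
    have -> // : T 0 = 0.
    by rewrite /T /sinhR oppr0 subrr mul0r !mulr0 mul0r sin0 !mulr0 addr0.
  apply: (@cvg_aty_le _ _ _ (2 * C1 / z ^+ 1 + `|tau| * (2 * C0 / z ^+ 1))) => x x1.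
  by rewrite subr0 Tle// (lt_trans _ x1).
rewrite rayintD//; [|by apply: ray_integrableB => //; exact: ray_integrableZ|
  exact: ray_integrableZ].
rewrite rayintB//; last exact: ray_integrableZ.
rewrite !rayintZ// -/(Nint g tau z) -/(Nint f2 tau z) -/(Nint f tau z) => h.
by move/eqP: h; rewrite -addrA addr_eq0 => /eqP ->; rewrite opprD opprK.
Qed.

(** [Nint_dv] for [q f1] produces the image of [f] under the square of [q d/dq]; [Nint_bessel]
    trades it for the terms of the modified Bessel equation of order [i tau]. *)
Lemma Nint_dv1 tau z : 0 < z -> is_derive z (1 : R)
  (Nint (fun q => q * f1 q) tau)
  ((z ^+ 2 * Nint f2 tau z - tau ^+ 2 * Nint f tau z) / z).
Proof.
move=> z0; rewrite -Nint_bessel//.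
apply: (@Nint_dv (fun q => q * f1 q) (fun q => f1 q + q * f2 q)) => //.
- by move=> q q0; dv; ring.
- by move=> q q0; apply: continuousD; [exact: cf1|exact: poscont_mulX].
- exact: rapid_mulX.
- by apply: rapidD => //; exact: rapid_mulX.
Qed.

End CoshTransform.

(** * Behaviour at 0 of the integrals of order 0 *)

Section NearZero.
Variable R : realType.
Implicit Types (f g : R -> R) (y z t q C tau : R).

(* Compare [y cosh t f1 (y cosh t)] with [y cosh t f1 (y sinh t)], which is the
   derivative of [f (y sinh t)]. *)
Lemma Nint_near0 f f1 f2 C y :
  (forall q, is_derive q (1 : R) f (f1 q)) ->
  (forall q, is_derive q (1 : R) f1 (f2 q)) ->
  rapid f -> rapid f1 -> (forall q, 0 < q -> `|f2 q| <= C * expR (- q)) ->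
  0 < y -> `|Nint (fun q => q * f1 q) 0 y + f 0| <= C * y.
Proof.
move=> df df1 rf rf1 f2C y0.
have C0 : 0 <= C.
  have := le_trans (normr_ge0 _) (f2C 1 ltr01); by rewrite pmulr_lge0 ?expR_gt0.
pose G t := f (y * sinhR t).
pose G' t := y * coshR t * f1 (y * sinhR t).
pose H t := y * coshR t * f1 (y * coshR t) * cos (0 * t).
have dG t : is_derive t (1 : R) G (G' t).
  by rewrite /G; dv; rewrite /G'; ring.
have cG' t : {for t, continuous G'}.
  have d : is_derive t (1 : R) G' (y * sinhR t * f1 (y * sinhR t) +
      y * coshR t * (f2 (y * sinhR t) * (y * coshR t))).
    by rewrite /G'; dv; ring.
  exact: dv_cont d.
have cf1 : poscont f1 by move=> q _; exact: dv_cont (df1 q).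
have cH t : {for t, continuous H}.
  by apply: (@kernel_cont _ (fun q => q * f1 q)) => //; exact: poscont_mulX.
have iH : ray_integrable H.
  apply: (@Nint_integrable _ (fun q => q * f1 q)) => //; first exact: poscont_mulX.
  exact: rapid_mulX.
have HG' t : 0 < t -> `|H t - G' t| <= y ^+ 2 * C * expR (- (y * t)).
  move=> t0; rewrite /H /G' mul0r cos0 mulr1 -mulrBr normrM.
  have c0 := coshR_gt0 t; have s0 : 0 < sinhR t by rewrite (lt_le_trans t0) ?sinhR_ge ?ltW.
  rewrite (gtr0_norm (mulr_gt0 y0 c0)).
  have sc : y * sinhR t <= y * coshR t by rewrite ler_pM2l// ltW// sinhR_lt_coshR.
  have mv : `|f1 (y * coshR t) - f1 (y * sinhR t)| <=
      C * expR (- (y * sinhR t)) * (y * coshR t - y * sinhR t).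
    apply: (@dv_le _ f1 f2) => // x /andP[sx _].
    have x0 : 0 < x by rewrite (lt_le_trans _ sx)// mulr_gt0.
    by rewrite (le_trans (f2C _ x0))// ler_wpM2l// ler_expR lerN2.
  apply: (le_trans (ler_wpM2l (ltW (mulr_gt0 y0 c0)) mv)).
  (* The growth of [cosh t] is cancelled by the gap [cosh t - sinh t = e^-t]. What remains is
     [y^2 C e^(- y t)], whose integral is [C y]. *)
  have ec : coshR t * (coshR t - sinhR t) <= 1.
    have -> : coshR t - sinhR t = expR (- t) by rewrite /coshR /sinhR; field.
    rewrite /coshR mulrC mulrA mulrDr [_ * expR t]mulrC expRxMexpNx_1.
    have := expR_ge0 (- t); have : expR (- t) <= 1 by rewrite expR_le1 oppr_le0 ltW.
    nra.
  have es : expR (- (y * sinhR t)) <= expR (- (y * t)).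
    by rewrite ler_expR lerN2 ler_pM2l// sinhR_ge// ltW.
  have -> : y * coshR t * (C * expR (- (y * sinhR t)) * (y * coshR t - y * sinhR t))
    = y ^+ 2 * C * expR (- (y * sinhR t)) * (coshR t * (coshR t - sinhR t)) by ring.
  rewrite (@le_trans _ _ (y ^+ 2 * C * expR (- (y * sinhR t))))//.
    by rewrite ler_piMr// !mulr_ge0 ?exprn_ge0 ?expR_ge0// ltW.
  by rewrite ler_wpM2l// mulr_ge0// exprn_ge0// ltW.
have mD : measurable_fun (`]0, +oo[%classic : set R) (fun t => H t - G' t).
  by apply: ray_measurable => t _; apply: continuousB; [exact: cH|exact: cG'].
have iE : ray_integrable (fun t => y ^+ 2 * C * expR (- (y * t))).
  by apply: ray_integrableZ; exact: ray_integrable_exp.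
have iD : ray_integrable (fun t => H t - G' t) by exact: ray_integrable_le HG' iE.
have iG' : ray_integrable G'.
  apply: (ray_integrable_eq _ (ray_integrableB iH iD)) => t _ /=; ring.
have IG : rayint G' = 0 - f 0.
  apply: (rayint_FTC (fun t _ => cG' t) (fun t _ => dG t) iG').
    have := dv_cont (dG 0); move=> /cvg_at_right_filter.
    by have -> // : G 0 = f 0; rewrite /G /sinhR oppr0 subrr mul0r mulr0.
  have [D fD] := rf 0%N.
  have D0 : 0 <= D by apply: le_trans (fD 1 ltr01); rewrite mulr_ge0.
  apply: (@cvg_aty_le _ _ _ (D / y)) => t t1; rewrite subr0 /G.
  have t0 : 0 < t by exact: lt_trans t1.
  have s0 : 0 < sinhR t by rewrite (lt_le_trans t0) ?sinhR_ge ?ltW.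
  rewrite (@le_trans _ _ (D / (y * sinhR t)))//.
    have ys := mulr_gt0 y0 s0.
    by rewrite (ler_pdivlMr _ _ ys) mulrC -[X in X * _]expr1 fD.
  have Dy : 0 <= D / y by rewrite divr_ge0// ltW.
  rewrite invfM mulrA ler_wpM2l// lef_pV2 ?posrE//.
  by rewrite sinhR_ge// ltW.
have -> : Nint (fun q => q * f1 q) 0 y + f 0 = rayint (fun t => H t - G' t).
  by rewrite rayintB// IG; rewrite /Nint -/H; ring.
apply: (le_trans (rayint_norm_le mD iE HG')).
rewrite rayintZ; last exact: ray_integrable_exp.
rewrite rayint_exp// expr2 -[y * y * C]mulrA mulrAC mulfV ?gt_eqF// mul1r.
by rewrite mulrC.
Qed.

Lemma expsin_bound lam : rapid (fun q : R => expR (- q) * sin (lam * q)).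
Proof.
apply: (@rapid_exp _ _ 1) => q q0.
rewrite mul1r normrM ger0_norm ?expR_ge0// ler_piMr ?expR_ge0//.
by rewrite ler_norml sin_geN1 sin_le1.
Qed.

Lemma expcos_bound lam : rapid (fun q : R => expR (- q) * cos (lam * q)).
Proof.
apply: (@rapid_exp _ _ 1) => q q0.
rewrite mul1r normrM ger0_norm ?expR_ge0// ler_piMr ?expR_ge0//.
by rewrite ler_norml cos_geN1 cos_le1.
Qed.

Lemma cos_sin_le2 (lam a b : R) : 0 <= lam <= 1 -> `|a| <= 1 -> `|b| <= 1 ->
  `|lam * a + b| <= 2.
Proof.
move=> /andP[l0 l1] a1 b1; rewrite (le_trans (ler_normD _ _))//.
rewrite -[2]/(1 + 1) lerD// normrM (ger0_norm l0).
by rewrite (le_trans (ler_wpM2r _ l1))// mul1r.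
Qed.

Lemma norm_sin_le1 (x : R) : `|sin x| <= 1.
Proof. by rewrite ler_norml sin_geN1 sin_le1. Qed.

Lemma norm_cos_le1 (x : R) : `|cos x| <= 1.
Proof. by rewrite ler_norml cos_geN1 cos_le1. Qed.

(* Differentiate in [lam] and compare with [atan lam]. *)
Lemma Nint_expsin_near0 y : 0 < y ->
  `|Nint (fun q => expR (- q) * sin q) 0 y - pi / 4| <= 2 * y.
Proof.
move=> y0.
pose E lam := Nint (fun q : R => expR (- q) * sin (lam * q)) 0 y.
pose E' lam := Nint (fun q : R => q * (expR (- q) * cos (lam * q))) 0 y.
have cs lam : poscont (fun q : R => expR (- q) * sin (lam * q)).
  move=> q _; have d : is_derive q (1 : R) (fun q => expR (- q) * sin (lam * q))
    (expR (- q) * (lam * cos (lam * q) - sin (lam * q))) by dv; ring.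
  exact: dv_cont d.
have [C eC] := @rapid_mulX R _ (expcos_bound 0) 0%N.
have dE lam : is_derive lam (1 : R) E (E' lam).
  rewrite /E /E' /Nint.
  apply: (@rayint_dv _ (fun lam t => expR (- (y * coshR t)) *
    sin (lam * (y * coshR t)) * cos (0 * t)) (fun lam t => y * coshR t * (expR (- (y * coshR t)) *
    cos (lam * (y * coshR t))) * cos (0 * t)) (lam - 1) (lam + 1) lam
    (fun t => 2 * C / y ^+ 1 * expR (- (1 * t)))).
  - by apply/andP; split; lra.
  - move=> a _; apply: (@Nint_integrable _ (fun q => expR (- q) * sin (a * q))) => //.
    exact: expsin_bound.
  - by move=> a t _ t0; dv; ring.
  - by apply: ray_integrableZ; exact: ray_integrable_exp.
  - move=> a t _ t0; have := @kernel_le R _ C 0 0 y t y0 eC.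
    rewrite mul1r; apply: le_trans.
    rewrite !mul0r cos0 !mulr1 mulrA normrM ler_piMr//.
    by rewrite ler_norml cos_geN1 cos_le1.
have D'le lam : 0 <= lam <= 1 -> `|E' lam - (1 + lam ^+ 2)^-1| <= 2 * y.
  move=> /andP[l0 l1].
  have l2 : 1 + lam ^+ 2 != 0 by rewrite gt_eqF// ltr_pwDl// sqr_ge0.
  (* A primitive of [e^-q cos (lam q)]. Its value at 0 is minus the derivative of [atan] at [lam],
     so [Nint_near0] compares [E'] with that derivative. *)
  pose g q := expR (- q) * (lam * sin (lam * q) - cos (lam * q)) * (1 + lam ^+ 2)^-1.
  have g0 : g 0 = - (1 + lam ^+ 2)^-1.
    by rewrite /g oppr0 expR0 mulr0 sin0 cos0 mulr0 sub0r mul1r mulN1r.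
  rewrite -g0; apply: (@Nint_near0 g (fun q => expR (- q) * cos (lam * q))
    (fun q => - (expR (- q) * (cos (lam * q) + lam * sin (lam * q))))) => //.
  - by move=> q; rewrite /g; dv; field.
  - by move=> q; dv; ring.
  - apply: (@rapid_exp _ _ (2 * (1 + lam ^+ 2)^-1)) => q _.
    have i0 : 0 <= (1 + lam ^+ 2)^-1 by rewrite invr_ge0 addr_ge0 ?sqr_ge0.
    rewrite /g normrM (ger0_norm i0) mulrAC ler_wpM2r// normrM.
    rewrite (ger0_norm (expR_ge0 _)) mulrC ler_wpM2r ?expR_ge0//.
    apply: cos_sin_le2; rewrite ?l0 ?normrN ?norm_sin_le1 ?norm_cos_le1//.
  - exact: expcos_bound.
  - move=> q _; rewrite normrN normrM (ger0_norm (expR_ge0 _)) mulrC.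
    rewrite ler_wpM2r ?expR_ge0// addrC.
    by apply: cos_sin_le2; rewrite ?l0 ?norm_sin_le1 ?norm_cos_le1.
have := @dv_le R (fun l => E l - atan l) (fun l => E' l - (1 + l ^+ 2)^-1) 0 1 (2 * y)
  ler01 _ D'le.
have -> : E 0 - atan 0 = 0.
  rewrite atan0 subr0 /E /Nint -[RHS](mulr0 (rayint (fun=> 0))) mulrC.
  rewrite -rayintZ.
    by apply: rayint_eq => t _; rewrite mul0r sin0 mulr0 !mul0r.
  by apply: ray_integrable_eq (ray_integrableZ 0 (ray_integrable_exp ltr01)) => t _; rewrite mul0r.
rewrite !subr0 mulr1 atan1 => h.
have -> : Nint (fun q => expR (- q) * sin q) 0 y = E 1.
  by apply: rayint_eq => t _; rewrite mul1r.
by apply: h => l _; dv; ring.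
Qed.

End NearZero.

(** * [K_0] on the ray of argument [pi / 4], in the variable [x] *)

Section SquareRootScale.
Variable R : realType.
Implicit Types (f g : R -> R) (x z t q C tau : R).

(* [2 sqrt (2 x) = sqrt (8 x)] and [4 e^(i pi / 4) sqrt x = (1 + i) sqrt (8 x)], so one
   scale serves both Bessel arguments. *)
Definition NX f tau x := Nint f tau (Num.sqrt (8 * x)).

Lemma sqrt8_gt0 x : 0 < x -> 0 < Num.sqrt (8 * x).
Proof. by move=> x0; rewrite sqrtr_gt0 mulr_gt0. Qed.

Lemma sqrt8_sqr x : 0 < x -> Num.sqrt (8 * x) ^+ 2 = 8 * x.
Proof. by move=> x0; rewrite sqr_sqrtr// mulr_ge0// ltW. Qed.

Lemma sqrt8_ge x : 0 < x -> Num.sqrt x <= Num.sqrt (8 * x).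
Proof. by move=> x0; apply: ler_wsqrtr; lra. Qed.

Lemma sqrt8_le x : 0 < x -> Num.sqrt (8 * x) <= 3 * Num.sqrt x.
Proof.
move=> x0; have -> : 3 * Num.sqrt x = Num.sqrt (9 * x).
  rewrite sqrtrM// (_ : 9 = 3 ^+ 2); last by ring.
  by rewrite sqrtr_sqr ger0_norm.
by apply: ler_wsqrtr; lra.
Qed.

(** Since [z = sqrt (8 x)], the operator [z d/dz] is [2 x d/dx], whence the factor [1 / 2]. A second
    application, with [z^2 = 8 x], yields the coefficients [2] and [tau^2 / 4] of [NX_dv1]. *)
Lemma NX_dv f f1 tau x : (forall q, is_derive q (1 : R) f (f1 q)) ->
  poscont f1 -> rapid f -> rapid f1 -> 0 < x ->
  is_derive x (1 : R) (NX f tau) (NX (fun q => q * f1 q) tau x / 2 / x).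
Proof.
move=> df cf1 rf rf1 x0; have z0 := sqrt8_gt0 x0.
have x80 : 0 < 8 * x by rewrite mulr_gt0.
have dN := @Nint_dv _ f f1 tau _ (fun q _ => df q) cf1 rf rf1 z0.
apply: dv_eq (@dv_comp _ (Nint f tau) (fun x => Num.sqrt (8 * x)) _ _ _ dN _) _.
  by dv.
have zn : Num.sqrt (8 * x) != 0 by rewrite gt_eqF.
rewrite -/(NX _ tau x); set N := NX _ _ _; set z := Num.sqrt _ in zn *.
have z2 : x = z ^+ 2 / 8 by rewrite sqrt8_sqr// mulrC mulKf.
by rewrite [in RHS]z2; field.
Qed.

Lemma NX_dv1 f f1 f2 tau x : (forall q, is_derive q (1 : R) f (f1 q)) ->
  (forall q, is_derive q (1 : R) f1 (f2 q)) ->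
  poscont f2 -> rapid f -> rapid f1 -> rapid f2 -> 0 < x ->
  is_derive x (1 : R) (fun x => NX (fun q => q * f1 q) tau x / 2)
    (2 * NX f2 tau x - tau ^+ 2 / 4 * NX f tau x / x).
Proof.
move=> df df1 cf2 rf rf1 rf2 x0; have z0 := sqrt8_gt0 x0.
have x80 : 0 < 8 * x by rewrite mulr_gt0.
have dN := Nint_dv1 (fun q _ => df q) (fun q _ => df1 q) cf2 rf rf1 rf2 tau z0.
have d : is_derive x (1 : R) (NX (fun q => q * f1 q) tau)
    ((Num.sqrt (8 * x) ^+ 2 * NX f2 tau x - tau ^+ 2 * NX f tau x) /
      Num.sqrt (8 * x) * ((2 * Num.sqrt (8 * x))^-1 * 8)).
  apply: dv_eq (@dv_comp _ (Nint _ tau) (fun x => Num.sqrt (8 * x)) _ _ _ dN _) _.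
    by dv.
  by rewrite /NX; ring.
apply: dv_eq (dvM d (dvC 2^-1 x)) _.
have zn : Num.sqrt (8 * x) != 0 by rewrite gt_eqF.
set N := NX f _ _; set N2 := NX _ _ _; set z := Num.sqrt _ in zn *.
have z2 : x = z ^+ 2 / 8 by rewrite sqrt8_sqr// mulrC mulKf.
by rewrite [in RHS]z2; field.
Qed.

(** With [s = sqrt x], the weight [s (1 + s^2)^3] is a combination of [s], [s^3], [s^5] and [s^7],
    each controlled by one order of [rapid]. The third power leaves a spare [1 + x] to absorb the
    growth of [x J']. The constant is uniform in [tau] because the cosine is only bounded by 1. *)
Lemma NX_le f : poscont f -> rapid f ->
  exists2 C : R, 0 <= C & forall tau x, 0 < x ->
    `|NX f tau x| * (Num.sqrt x * (1 + x) ^+ 3) <= C.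
Proof.
move=> cf rf; have [C0 f0] := rf 0%N; have [C2 f2] := rf 2%N; have [C4 f4] := rf 4%N; have [C6 f6] := rf 6%N.
have C0p : 0 <= C0 by apply: le_trans (f0 1 ltr01); rewrite mulr_ge0// expr1n.
have C2p : 0 <= C2 by apply: le_trans (f2 1 ltr01); rewrite mulr_ge0// expr1n.
have C4p : 0 <= C4 by apply: le_trans (f4 1 ltr01); rewrite mulr_ge0// expr1n.
have C6p : 0 <= C6 by apply: le_trans (f6 1 ltr01); rewrite mulr_ge0// expr1n.
exists (2 * C0 + 3 * (2 * C2) + 3 * (2 * C4) + 2 * C6); first by rewrite !addr_ge0 ?mulr_ge0.
move=> tau x x0; set s := Num.sqrt x.
have s0 : 0 < s by rewrite sqrtr_gt0.
have sz : s <= Num.sqrt (8 * x) by exact: sqrt8_ge.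
have z0 := sqrt8_gt0 x0.
have b k C : 0 <= C -> (forall q, 0 < q -> q ^+ k.+1 * `|f q| <= C) ->
    `|NX f tau x| * s ^+ k.+1 <= 2 * C.
  move=> Cp fC; have := Nint_le tau cf z0 fC; rewrite -/(NX f tau x).
  rewrite ler_pdivlMr ?exprn_gt0//; apply: le_trans.
  by rewrite ler_wpM2l// lerXn2r// nnegrE ltW.
have -> : x = s ^+ 2 by rewrite sqr_sqrtr// ltW.
have -> : `|NX f tau (s ^+ 2)| * (s * (1 + s ^+ 2) ^+ 3) =
    `|NX f tau (s ^+ 2)| * s ^+ 1 + 3 * (`|NX f tau (s ^+ 2)| * s ^+ 3) +
    3 * (`|NX f tau (s ^+ 2)| * s ^+ 5) + `|NX f tau (s ^+ 2)| * s ^+ 7 by ring.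
rewrite (sqr_sqrtr (ltW x0)).
apply: lerD; last exact: b.
by apply: lerD; [apply: lerD; [exact: b|]|]; rewrite ?ler_pM2l//; exact: b.
Qed.

(* [ker x] and [kei x] are the real and imaginary parts of [K_0 (4 e^(i pi / 4) sqrt x)].
   Throughout, the suffix [1] marks the image under [x d/dx]. *)
Definition kei x := - NX (fun q => expR (- q) * sin q) 0 x.
Definition ker x := NX (fun q => expR (- q) * cos q) 0 x.
Definition kei1 x :=
  - (NX (fun q => q * (expR (- q) * cos q - expR (- q) * sin q)) 0 x / 2).
Definition ker1 x :=
  NX (fun q => q * (- (expR (- q) * cos q) - expR (- q) * sin q)) 0 x / 2.

Let fs q := expR (- q) * sin q.
Let fc q := expR (- q) * cos q.

Let dfs q : is_derive q (1 : R) fs (fc q - fs q).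
Proof. by rewrite /fs /fc; dv; ring. Qed.
Let dfc q : is_derive q (1 : R) fc (- fc q - fs q).
Proof. by rewrite /fs /fc; dv; ring. Qed.
(** Two derivatives exchange [fs] and [fc] up to a factor [2] or [-2]; this is what couples [ker]
    and [kei] into one closed system. *)
Let dfs1 q : is_derive q (1 : R) (fun q => fc q - fs q) (- 2 * fc q).
Proof. by have ds := dfs; have dc := dfc; dv; ring. Qed.
Let dfc1 q : is_derive q (1 : R) (fun q => - fc q - fs q) (2 * fs q).
Proof. by have ds := dfs; have dc := dfc; dv; ring. Qed.

Let fs_le q : `|fs q| <= expR (- q).
Proof. by rewrite /fs normrM ger0_norm ?expR_ge0// ler_piMr ?expR_ge0 ?norm_sin_le1. Qed.
Let fc_le q : `|fc q| <= expR (- q).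
Proof. by rewrite /fc normrM ger0_norm ?expR_ge0// ler_piMr ?expR_ge0 ?norm_cos_le1. Qed.

Let rlin a b : rapid (fun q => a * fc q + b * fs q).
Proof.
apply: (@rapid_exp _ _ (`|a| + `|b|)) => q _.
rewrite (le_trans (ler_normD _ _))// mulrDl lerD// normrM ler_wpM2l//.
Qed.

Let rfs : rapid fs.
Proof. by have := rlin 0 1; under eq_fun do rewrite mul0r mul1r add0r. Qed.
Let rfc : rapid fc.
Proof. by have := rlin 1 0; under eq_fun do rewrite mul0r mul1r addr0. Qed.
Let rfs1 : rapid (fun q => fc q - fs q).
Proof. by have := rlin 1 (-1); under eq_fun do rewrite mulN1r mul1r. Qed.
Let rfc1 : rapid (fun q => - fc q - fs q).
Proof. by have := rlin (-1) (-1); under eq_fun do rewrite !mulN1r. Qed.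
Let rfs2 : rapid (fun q => - 2 * fc q).
Proof. by have := rlin (-2) 0; under eq_fun do rewrite mul0r addr0. Qed.
Let rfc2 : rapid (fun q => 2 * fs q).
Proof. by have := rlin 0 2; under eq_fun do rewrite mul0r add0r. Qed.

Let cfs : poscont fs. Proof. by move=> q _; exact: dv_cont (dfs q). Qed.
Let cfc : poscont fc. Proof. by move=> q _; exact: dv_cont (dfc q). Qed.
Let cfs1 : poscont (fun q => fc q - fs q).
Proof. by move=> q _; exact: dv_cont (dfs1 q). Qed.
Let cfc1 : poscont (fun q => - fc q - fs q).
Proof. by move=> q _; exact: dv_cont (dfc1 q). Qed.
Let cfs2 : poscont (fun q => - 2 * fc q).
Proof. by move=> q q0; apply: continuousM; [exact: cvg_cst|exact: cfc]. Qed.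
Let cfc2 : poscont (fun q => 2 * fs q).
Proof. by move=> q q0; apply: continuousM; [exact: cvg_cst|exact: cfs]. Qed.

Let NXZ a f x : poscont f -> rapid f -> 0 < x ->
  NX (fun q => a * f q) 0 x = a * NX f 0 x.
Proof.
move=> cf rf x0; rewrite /NX /Nint -rayintZ.
  by apply: rayint_eq => t _; rewrite mulrA.
by apply: Nint_integrable => //; exact: sqrt8_gt0.
Qed.

Lemma kei_dv x : 0 < x -> is_derive x (1 : R) kei (kei1 x / x).
Proof.
move=> x0; have d := NX_dv 0 dfs cfs1 rfs rfs1 x0.
by rewrite /kei; apply: dv_eq (dvN d) _; rewrite /kei1 mulNr.
Qed.

Lemma ker_dv x : 0 < x -> is_derive x (1 : R) ker (ker1 x / x).
Proof. by move=> x0; exact: (NX_dv 0 dfc cfc1 rfc rfc1 x0). Qed.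

Lemma kei1_dv x : 0 < x -> is_derive x (1 : R) kei1 (4 * ker x).
Proof.
move=> x0; have d := NX_dv1 0 dfs dfs1 cfs2 rfs rfs1 rfs2 x0.
rewrite /kei1; apply: dv_eq (dvN d) _.
by rewrite (NXZ _ cfc rfc x0) /ker -/fc; ring.
Qed.

Lemma ker1_dv x : 0 < x -> is_derive x (1 : R) ker1 (- 4 * kei x).
Proof.
move=> x0; have d := NX_dv1 0 dfc dfc1 cfc2 rfc rfc1 rfc2 x0.
rewrite /ker1; apply: dv_eq d _.
by rewrite (NXZ _ cfs rfs x0) /kei -/fs; ring.
Qed.

(** For [kei], [kei1] and [ker1], large [x] is covered by [NX_le] and small [x] by the limits
    [- pi / 4], [0] and [- 1 / 2] at 0, with error of order [sqrt x]. For [ker] the bounds on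
    [sqrt x ker x] and [x ker x] are taken from [NX_le]. The bounds with a factor [sqrt x] make
    boundary terms vanish at 0. *)
Lemma kei_ker_bounds : exists2 M : R, 0 <= M & forall x, 0 < x ->
  [/\ `|kei x| <= M /\ `|kei x + pi / 4| <= M * Num.sqrt x,
      `|kei1 x| <= M /\ `|kei1 x| <= M * Num.sqrt x,
      `|x * ker x| <= M /\ `|x * ker x| <= M * Num.sqrt x &
      `|ker1 x| <= M].
Proof.
have [Cs Cs0 bs] := NX_le cfs rfs.
have [Cc Cc0 bc] := NX_le cfc rfc.
have [Cs1 Cs10 bs1] := NX_le (poscont_mulX cfs1) (rapid_mulX rfs1).
have [Cc1 Cc10 bc1] := NX_le (poscont_mulX cfc1) (rapid_mulX rfc1).
have pi2 : pi / 4 <= 1 :> R by have := @pihalf_lt2 R; lra.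
have pi0 : 0 <= pi / 4 :> R by have := @pi_ge0 R; lra.
(* The summand 20 is slack for the numerical constants 6 and 7 of the estimates near 0. *)
exists (Cs + Cc + Cs1 + Cc1 + 20); first by lra.
move=> x x0; set s := Num.sqrt x.
have s0 : 0 < s by rewrite sqrtr_gt0.
have xs : x = s ^+ 2 by rewrite sqr_sqrtr// ltW.
have z3 : Num.sqrt (8 * x) <= 3 * s by exact: sqrt8_le.
have z0 := sqrt8_gt0 x0.
have low f C : 0 <= C ->
    (forall tau x, 0 < x -> `|NX f tau x| * (Num.sqrt x * (1 + x) ^+ 3) <= C) ->
    `|NX f 0 x| * s <= C.
  move=> Cp b; apply: (le_trans _ (b 0 x x0)); rewrite ler_wpM2l//.
  by rewrite ler_peMr// ?expr_ge1//; lra.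
have hi f C : 0 <= C ->
    (forall tau x, 0 < x -> `|NX f tau x| * (Num.sqrt x * (1 + x) ^+ 3) <= C) ->
    `|NX f 0 x| * s ^+ 2 <= C.
  move=> Cp b; apply: (le_trans _ (b 0 x x0)); rewrite ler_wpM2l//.
  rewrite [X in 1 + X]xs -/s expr2 ler_pM2l//.
  have s1 : s <= 1 + s ^+ 2 by have := sqr_ge0 (s - 1); nra.
  by rewrite (le_trans s1)// ler_eXnr// lerDl sqr_ge0.
have e0 : `|kei x + pi / 4| <= 6 * s.
  rewrite /kei addrC -normrN opprD opprK addrC.
  by rewrite (le_trans (Nint_expsin_near0 z0))//; lra.
have e1 : `|kei1 x| <= 3 * s.
  have := @Nint_near0 R fs _ _ 2 _ dfs dfs1 rfs rfs1 _ z0.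
  rewrite {2}/fs sin0 mulr0 addr0 => h.
  rewrite /kei1 normrN normrM [`|2^-1|]ger0_norm// ler_pdivrMr//.
  apply: (le_trans (h _)); last by lra.
  by move=> q _; rewrite normrM normrN [`|2|]ger0_norm// ler_pM2l// fc_le.
have r1 : `|ker1 x + 1 / 2| <= 3 * s.
  have := @Nint_near0 R fc _ _ 2 _ dfc dfc1 rfc rfc1 _ z0.
  rewrite {2}/fc cos0 mulr1 oppr0 expR0 => h.
  rewrite /ker1 -mulrDl normrM [`|2^-1|]ger0_norm// ler_pdivrMr//.
  apply: (le_trans (h _)); last by lra.
  by move=> q _; rewrite normrM [`|2|]ger0_norm// ler_pM2l// fs_le.
have els : `|kei x| * s <= Cs by rewrite /kei normrN low.
have els1 : `|kei1 x| * s <= Cs1.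
  rewrite /kei1 normrN normrM [`|2^-1|]ger0_norm//.
  have := low _ _ Cs10 bs1; have := normr_ge0 (NX (fun q => q * (fc q - fs q)) 0 x).
  by rewrite -/(fc _) -/(fs _); nra.
have rls1 : `|ker1 x| * s <= Cc1.
  rewrite /ker1 normrM [`|2^-1|]ger0_norm//.
  have := low _ _ Cc10 bc1; have := normr_ge0 (NX (fun q => q * (- fc q - fs q)) 0 x).
  by nra.
have rl : `|ker x| * s <= Cc by rewrite low.
have rh : `|ker x| * s ^+ 2 <= Cc by rewrite hi.
have big (a C : R) : 0 <= C -> `|a| * s <= C -> 1 < s -> `|a| <= C.
  by move=> Cp aC s1; have := normr_ge0 a; nra.
have bnd (a c C : R) : 0 <= C -> 0 <= c <= 1 -> `|a + c| <= 6 * s ->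
    `|a| * s <= C -> `|a| <= C + 7.
  move=> Cp /andP[c0 c1] ac aC; have [s1|s1] := leP s 1; last first.
    by rewrite (le_trans (big _ _ Cp aC s1))//; lra.
  have -> : a = a + c - c by ring.
  by rewrite (le_trans (ler_normB _ _))// (ger0_norm c0); lra.
split; [split|split|split|].
- by rewrite (le_trans (bnd _ (pi / 4) _ Cs0 _ e0 els)) ?pi0 ?pi2//; lra.
- by rewrite (le_trans e0)// ler_wpM2r ?(ltW s0)//; lra.
- rewrite (le_trans (bnd _ 0 _ Cs10 _ _ els1)) ?lexx ?ler01// ?addr0; lra.
- by rewrite (le_trans e1)// ler_wpM2r ?(ltW s0)//; lra.
- by rewrite normrM (gtr0_norm x0) mulrC {2}xs (le_trans rh)//; lra.
- rewrite normrM (gtr0_norm x0) mulrC {2}xs expr2 mulrA ler_wpM2r ?(ltW s0)//.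
  by rewrite (le_trans rl)//; lra.
- by rewrite (le_trans (bnd _ (1 / 2) _ Cc10 _ _ rls1))//; lra.
Qed.

End SquareRootScale.

(** * The product integral *)

Section LegendreEquation.
Variable R : realType.
Variables (tau F0 D : R) (F G1 G2 : R -> R).
Hypothesis tau0 : 0 < tau.
Hypothesis dF : forall c : R, 0 < c -> is_derive c (1 : R) F (G1 c / c).
Hypothesis dG1 : forall c : R, 0 < c -> is_derive c (1 : R) G1 (G2 c / c).
Hypothesis ode : forall c : R, 0 < c ->
  G2 c - G1 c = c ^+ 2 * (G2 c + 2 * G1 c + (1 + tau ^+ 2) * F c).
Hypothesis F_near0 : forall c : R, 0 < c -> `|F c - F0| <= D * Num.sqrt c.

Lemma sin2E (x : R) : sin x ^+ 2 = 1 - cos x ^+ 2.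
Proof. by rewrite -(cos2Dsin2 x); ring. Qed.

Lemma sinh2E (x : R) : sinhR x ^+ 2 = coshR x ^+ 2 - 1.
Proof. by rewrite -(coshR_sinhR x); ring. Qed.

Let c0 (t : R) : 0 <= t < pi / 2 -> 0 < cos t.
Proof.
move=> /andP[t0 t1]; apply: cos_gt0_pihalf; apply/andP; split => //.
by have := @pihalf_ge1 R; lra.
Qed.

(** The substitution [c = cos t] on [0 < c <= 1]: [v] is the derivative of [w], and [w] satisfies an
    equation with constant coefficients. *)
Let w t := sin t * F (cos t).
Let v t := cos t * F (cos t) - sin t ^+ 2 * (G1 (cos t) / cos t).

Let dw t : 0 <= t < pi / 2 -> is_derive t (1 : R) w (v t).
Proof.
move=> t1; have ct := c0 t1; rewrite /w; dv; rewrite /v.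
have cn : cos t != 0 by rewrite gt_eqF.
by field.
Qed.

Let dvv t : 0 <= t < pi / 2 -> is_derive t (1 : R) v (tau ^+ 2 * w t).
Proof.
move=> t1; have ct := c0 t1; have cn : cos t != 0 by rewrite gt_eqF.
rewrite /v; dv.
(* [ode] says that [G2 - G1] is [c^2 X]. Expressing [G2] and then [G1] through [X] and [F] involves
   no division by [1 - c^2], so the computation includes [t = 0]. *)
pose X := G2 (cos t) + 2 * G1 (cos t) + (1 + tau ^+ 2) * F (cos t).
have g2 : G2 (cos t) = G1 (cos t) + cos t ^+ 2 * X by rewrite -(ode ct); ring.
have g1 : G1 (cos t) = (sin t ^+ 2 * X - (1 + tau ^+ 2) * F (cos t)) / 3.
  have : 3 * G1 (cos t) = X - cos t ^+ 2 * X - (1 + tau ^+ 2) * F (cos t).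
    by rewrite -(ode ct) /X; ring.
  rewrite sin2E => h; apply: (mulfI (x := 3)); first by [].
  by rewrite h; field.
transitivity (- sin t * F (cos t) - 3 * sin t * G1 (cos t) + sin t ^+ 3 * X).
  by rewrite g2; field.
by rewrite g1 /w; field.
Qed.

Let e0 (t : R) : 0 <= t -> 0 < coshR t.
Proof. by move=> _; exact: coshR_gt0. Qed.

(** The counterpart for [c >= 1], with [c = cosh t]. *)
Let u t := sinhR t * F (coshR t).
Let y t := coshR t * F (coshR t) + sinhR t ^+ 2 * (G1 (coshR t) / coshR t).

Let du t : is_derive t (1 : R) u (y t).
Proof.
have ct := coshR_gt0 t; rewrite /u; dv; rewrite /y.
have cn : coshR t != 0 by rewrite gt_eqF.
by field.
Qed.

Let dy t : is_derive t (1 : R) y (- tau ^+ 2 * u t).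
Proof.
have ct := coshR_gt0 t; have cn : coshR t != 0 by rewrite gt_eqF.
rewrite /y; dv.
pose X := G2 (coshR t) + 2 * G1 (coshR t) + (1 + tau ^+ 2) * F (coshR t).
have g2 : G2 (coshR t) = G1 (coshR t) + coshR t ^+ 2 * X by rewrite -(ode ct); ring.
have g1 : G1 (coshR t) = (- sinhR t ^+ 2 * X - (1 + tau ^+ 2) * F (coshR t)) / 3.
  have : 3 * G1 (coshR t) = X - coshR t ^+ 2 * X - (1 + tau ^+ 2) * F (coshR t).
    by rewrite -(ode ct) /X; ring.
  rewrite sinh2E => h; apply: (mulfI (x := 3)); first by [].
  by rewrite h; field.
transitivity (sinhR t * F (coshR t) + 3 * sinhR t * G1 (coshR t) + sinhR t ^+ 3 * X).
  by rewrite g2; field.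
by rewrite g1 /u; field.
Qed.

(** The quantities [(v + tau w) e^(- tau t)] and [(v - tau w) e^(tau t)] are constant, and
    [w 0 = 0], [v 0 = F 1]; half the difference of the two resulting formulas is the claim. *)
Let w_val t : 0 <= t < pi / 2 ->
  tau * w t = F 1 * sinhR (tau * t).
Proof.
move=> /andP[t0 t1].
have tx x : 0 <= x <= t -> 0 <= x < pi / 2.
  by move=> /andP[-> xt] /=; exact: le_lt_trans t1.
have v0 : v 0 = F 1 by rewrite /v sin0 cos0 expr2 !mul0r subr0 mul1r.
have w0 : w 0 = 0 by rewrite /w sin0 mul0r.
have h1 : (v 0 + tau * w 0) * expR (- (tau * 0)) = (v t + tau * w t) * expR (- (tau * t)).
  apply: (@dv_const _ (fun t => (v t + tau * w t) * expR (- (tau * t)))) => // x /tx xt.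
  by have := dw xt; have := dvv xt => ? ?; dv; ring.
have h2 : (v 0 - tau * w 0) * expR (tau * 0) = (v t - tau * w t) * expR (tau * t).
  apply: (@dv_const _ (fun t => (v t - tau * w t) * expR (tau * t))) => // x /tx xt.
  by have := dw xt; have := dvv xt => ? ?; dv; ring.
rewrite w0 v0 !mulr0 oppr0 expR0 addr0 !mulr1 in h1.
rewrite w0 v0 !mulr0 subr0 expR0 !mulr1 in h2.
have e := expRxMexpNx_1 (tau * t); rewrite /sinhR.
have {h1}h1 : v t + tau * w t = F 1 * expR (tau * t).
  by rewrite h1 -mulrA [expR (- _) * _]mulrC e mulr1.
have {h2}h2 : v t - tau * w t = F 1 * expR (- (tau * t)).
  by rewrite h2 -mulrA e mulr1.
have -> : tau * w t = ((v t + tau * w t) - (v t - tau * w t)) / 2 by field.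
by rewrite h1 h2; field.
Qed.

(** The point [t = pi / 2] corresponds to [c = 0], where [F] is known only through its limit.
    [A t <= 0] holds before that point, and [A] is continuous up to it. *)
Let F1_val : F 1 * sinhR (tau * (pi / 2)) = tau * F0.
Proof.
pose A (t : R) := `|F 1 * sinhR (tau * t) - tau * sin t * F0| - tau * (`|D| * Num.sqrt (cos t)).
have A0 t : 0 <= t < pi / 2 -> A t <= 0.
  move=> t1; have ct := c0 t1; rewrite /A.
  have -> : F 1 * sinhR (tau * t) - tau * sin t * F0 = tau * (sin t * (F (cos t) - F0)).
    by rewrite -w_val// /w; ring.
  rewrite normrM (gtr0_norm tau0) subr_le0 ler_pM2l// normrM.
  rewrite (@le_trans _ _ (`|F (cos t) - F0|))//.
    by rewrite ler_piMl// norm_sin_le1.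
  by rewrite (le_trans (F_near0 ct))// ler_wpM2r ?sqrtr_ge0// ler_norm.
have cA : A t @[t --> (pi / 2)^'-] --> A (pi / 2).
  have cs : {for (pi / 2 : R), continuous (fun t : R => F 1 * sinhR (tau * t) - tau * sin t * F0)}.
    have d : is_derive (pi / 2 : R) (1 : R) (fun t : R => F 1 * sinhR (tau * t) - tau * sin t * F0)
      (F 1 * tau * coshR (tau * (pi / 2)) - tau * cos (pi / 2) * F0) by dv; ring.
    exact: dv_cont d.
  apply: cvg_at_left_filter; apply: cvgB; first by apply: cvg_norm; exact: cs.
  apply: cvgMr; apply: cvgMr.
  apply: continuous_comp; [exact: continuous_cos | exact: sqrt_continuous].
have : A (pi / 2) <= 0.
  have p2 : 0 < pi / 2 :> R by have := @pihalf_ge1 R; lra.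
  apply: (cvgr_to_le cA).
  near=> t; apply: A0; apply/andP; split; last by near: t; exact: nbhs_left_lt.
  by near: t; apply: nbhs_left_ge.
rewrite /A cos_pihalf sqrtr0 !mulr0 subr0 sin_pihalf mulr1 normr_le0 subr_eq0.
by move=> /eqP.
Unshelve. all: by end_near. Qed.

(** The vector [(y, tau u)] rotates at speed [tau], starting from [(F 1, 0)]; its two first
    integrals give [tau u], and [F1_val] replaces [F 1] by [F0]. *)
Lemma legendre_cosh t : 0 <= t ->
  F (coshR t) * sinhR t * sinhR (tau * (pi / 2)) = F0 * sin (tau * t).
Proof.
move=> t0; have c1 : coshR 0 = 1 :> R by rewrite /coshR oppr0 expR0; field.
have s1 : sinhR 0 = 0 :> R by rewrite /sinhR oppr0 subrr mul0r.
have y0 : y 0 = F 1 by rewrite /y s1 c1 expr2 !mul0r addr0 mul1r.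
have u0 : u 0 = 0 by rewrite /u s1 mul0r.
have h1 : y 0 * cos (tau * 0) + tau * u 0 * sin (tau * 0) =
    y t * cos (tau * t) + tau * u t * sin (tau * t).
  apply: (@dv_const _ (fun t => y t * cos (tau * t) + tau * u t * sin (tau * t))) => // x _.
  by dv; ring.
have h2 : y 0 * sin (tau * 0) - tau * u 0 * cos (tau * 0) =
    y t * sin (tau * t) - tau * u t * cos (tau * t).
  apply: (@dv_const _ (fun t => y t * sin (tau * t) - tau * u t * cos (tau * t))) => // x _.
  by dv; ring.
rewrite y0 u0 !mulr0 cos0 sin0 !mul0r mulr1 addr0 in h1.
rewrite y0 u0 !mulr0 cos0 sin0 !mulr0 mul0r subr0 in h2.
have h3 : tau * u t = F 1 * sin (tau * t).
  transitivity ((y t * cos (tau * t) + tau * u t * sin (tau * t)) * sin (tau * t) -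
    (y t * sin (tau * t) - tau * u t * cos (tau * t)) * cos (tau * t)).
    transitivity (tau * u t * (cos (tau * t) ^+ 2 + sin (tau * t) ^+ 2)).
      by rewrite cos2Dsin2 mulr1.
    by ring.
  by rewrite -h1 -h2 mul0r subr0.
apply: (mulfI (lt0r_neq0 tau0)).
transitivity (tau * u t * sinhR (tau * (pi / 2))); first by rewrite /u; ring.
by rewrite h3 mulrAC F1_val; ring.
Qed.

End LegendreEquation.

(** * The integral of [kei (c x)] against the product of [J] and [K] *)

Section ProductIntegral.
Variable R : realType.
Implicit Types x c : R.

Lemma eq_le_r (a b : R) : a = b -> a <= b.
Proof. by move->. Qed.

(** The common majorant: of order [x^(-1/2)] at 0 and [x^(-5/2)] at infinity. Hence [x decay x]
    vanishes at both ends, as boundary terms require, and [sqrt x decay x] is still integrable. *)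
Definition decay (x : R) : R := (Num.sqrt x * (1 + x) ^+ 2)^-1.

Lemma decay_gt0 x : 0 < x -> 0 < decay x.
Proof.
by move=> x0; rewrite invr_gt0 mulr_gt0 ?sqrtr_gt0 ?exprn_gt0// addr_gt0.
Qed.

Let sqrtK (x : R) : 0 < x -> Num.sqrt x ^+ 2 = x.
Proof. by move=> x0; rewrite sqr_sqrtr// ltW. Qed.

Lemma decayM x : 0 < x -> x * decay x = Num.sqrt x / (1 + x) ^+ 2.
Proof.
move=> x0; have s0 : Num.sqrt x != 0 by rewrite gt_eqF// sqrtr_gt0.
have x1 : 1 + x != 0 by rewrite gt_eqF// addr_gt0.
by rewrite /decay -{1}(sqrtK x0); field; rewrite s0 x1.
Qed.

Lemma decay_at0 x : 0 < x -> x * decay x <= Num.sqrt x.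
Proof.
move=> x0; rewrite decayM// ler_piMr ?sqrtr_ge0// invf_le1 ?exprn_gt0 ?addr_gt0//.
by rewrite expr_ge1//; lra.
Qed.

Lemma decay_aty x : 1 < x -> x * decay x <= 1 / x.
Proof.
move=> x1; have x0 : 0 < x by exact: lt_trans x1.
rewrite decayM// ler_pdivrMr ?exprn_gt0 ?addr_gt0// mul1r.
have s1 : Num.sqrt x <= x.
  have : Num.sqrt x <= Num.sqrt (x ^+ 2) by apply: ler_wsqrtr; rewrite expr2; nra.
  by rewrite sqrtr_sqr gtr0_norm.
rewrite (le_trans s1)// ler_pdivlMl// -expr2.
nra.
Qed.

Lemma decay_le_inv x : 1 < x -> decay x <= 1 / x.
Proof.
move=> x1; apply: (le_trans _ (decay_aty x1)).
have x0 : 0 < x by exact: lt_trans x1.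
by rewrite ler_peMl// ltW// decay_gt0.
Qed.

Lemma decay_cont x : 0 < x -> {for x, continuous decay}.
Proof.
move=> x0.
have sx : Num.sqrt x * (1 + x) ^+ 2 != 0 by have := decay_gt0 x0; rewrite invr_gt0 => /lt0r_neq0.
have d : is_derive x (1 : R) decay (- (Num.sqrt x * (1 + x) ^+ 2) ^- 2 *
  ((2 * Num.sqrt x)^-1 * (1 + x) ^+ 2 + Num.sqrt x * (2 * (1 + x)))).
  by rewrite /decay; dv; ring.
exact: dv_cont d.
Qed.

(** Comparison with [1 / (sqrt x (1 + x))], which has the bounded primitive [2 atan (sqrt x)]. *)
Lemma ray_integrable_decay : ray_integrable decay.
Proof.
pose g (x : R) := (Num.sqrt x * (1 + x))^-1.
have ig : ray_integrable g.
  have gn (x : R) : 0 < x -> Num.sqrt x * (1 + x) != 0.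
    by move=> x0; rewrite gt_eqF// mulr_gt0 ?sqrtr_gt0 ?addr_gt0.
  apply: (@ray_integrable_primitive _ _ (fun x => 2 * atan (Num.sqrt x)) (2 * (pi / 2))).
  - move=> x x0; have gx := gn _ x0.
    have d : is_derive x (1 : R) g (- (Num.sqrt x * (1 + x)) ^- 2 *
      ((2 * Num.sqrt x)^-1 * (1 + x) + Num.sqrt x)).
      by rewrite /g; dv; ring.
    exact: dv_cont d.
  - move=> x x0; dv; rewrite sqrtK// /g.
    have s0 : Num.sqrt x != 0 by rewrite gt_eqF// sqrtr_gt0.
    have x1 : 1 + x != 0 by rewrite gt_eqF// addr_gt0.
    by field; rewrite s0 x1.
  - by move=> x x0; rewrite invr_ge0 mulr_ge0 ?sqrtr_ge0// addr_ge0// ltW.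
  - move=> x x0; rewrite normrM [`|2|]ger0_norm// ler_pM2l// ler_norml.
    by rewrite (ltW (atan_gtNpi2 _)) (ltW (atan_ltpi2 _)).
apply: (ray_integrable_le _ _ ig).
  by apply: ray_measurable; exact: decay_cont.
move=> x x0; rewrite gtr0_norm ?decay_gt0// /decay /g.
have s0 : 0 < Num.sqrt x by rewrite sqrtr_gt0.
have x1 : 0 < 1 + x by rewrite addr_gt0.
rewrite lef_pV2 ?posrE ?mulr_gt0 ?exprn_gt0// ler_pM2l//.
by rewrite ler_eXnr//; lra.
Qed.

Lemma ray_integrable_sqrt_decay : ray_integrable (fun x => Num.sqrt x * decay x).
Proof.
have xn (x : R) : 0 < x -> 1 + x != 0 by move=> x0; rewrite gt_eqF// addr_gt0.
have E x : 0 < x -> ((1 + x) ^+ 2)^-1 = Num.sqrt x * decay x.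
  move=> x0; have s0 : Num.sqrt x != 0 by rewrite gt_eqF// sqrtr_gt0.
  have x1 := xn _ x0.
  by rewrite /decay; field; rewrite s0 x1.
apply: (ray_integrable_eq E).
apply: (@ray_integrable_primitive _ _ (fun x => - (1 + x)^-1) 1).
- move=> x x0; have x1 := xn _ x0; have x2 : (1 + x) ^+ 2 != 0 by rewrite expf_neq0.
  have d : is_derive x (1 : R) (fun x : R => ((1 + x) ^+ 2)^-1)
    (- (((1 + x) ^+ 2) ^- 2) * (2 * (1 + x))).
    by dv; ring.
  exact: dv_cont d.
- by move=> x x0; have x1 := xn _ x0; dv; ring.
- by move=> x x0; rewrite invr_ge0 exprn_ge0// addr_ge0// ltW.
- move=> x x0; rewrite normrN gtr0_norm ?invr_gt0 ?addr_gt0//.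
  by rewrite invf_le1 ?addr_gt0//; lra.
Qed.

Variables (tau B C : R) (J J1 K K1 : R -> R).
Hypothesis tau0 : 0 < tau.
Hypothesis B0 : 0 <= B.
Hypothesis C0 : 0 <= C.
Hypothesis dJ : forall x : R, 0 < x -> is_derive x (1 : R) J (J1 x / x).
Hypothesis dJ1 : forall x : R, 0 < x ->
  is_derive x (1 : R) J1 (- (tau ^+ 2 / 4 + 2 * x) * J x / x).
Hypothesis dK : forall x : R, 0 < x -> is_derive x (1 : R) K (K1 x / x).
Hypothesis dK1 : forall x : R, 0 < x ->
  is_derive x (1 : R) K1 ((2 * x - tau ^+ 2 / 4) * K x / x).
Hypothesis J_le : forall x, 0 < x -> `|J x| <= B.
Hypothesis J1_le : forall x, 0 < x -> `|J1 x| <= B * (1 + x).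
Hypothesis K_le : forall x, 0 < x ->
  `|K x| * (Num.sqrt x * (1 + x) ^+ 3) <= C.
Hypothesis K1_le : forall x, 0 < x ->
  `|K1 x| * (Num.sqrt x * (1 + x) ^+ 3) <= C.

(** These four functions span the products of [J], [J1] with [K], [K1] and form a closed system:
    [x P' = P1], [x P1' = S - tau^2 P], [S' = 4 W], [W' = - 4 P]. *)
Let P x := J x * K x.
Let P1 x := J1 x * K x + J x * K1 x.
Let W x := J1 x * K x - J x * K1 x.
Let S x := tau ^+ 2 / 2 * (J x * K x) + 2 * (J1 x * K1 x).

Hypothesis W_at0 : W x @[x --> 0^'+] --> (2^-1 : R).
Hypothesis S_at0 : S x @[x --> 0^'+] --> (0 : R).

Let D_of (k : R -> R) x : 0 < x -> `|k x| * (Num.sqrt x * (1 + x) ^+ 3) <= C ->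
  `|k x| * (1 + x) <= C * decay x.
Proof.
move=> x0 h; have s0 : 0 < Num.sqrt x by rewrite sqrtr_gt0.
have x1 : 0 < 1 + x by rewrite addr_gt0.
rewrite ler_pdivlMr ?mulr_gt0 ?exprn_gt0//; apply: le_trans h.
by rewrite -mulrA ler_wpM2l// mulrCA -exprS.
Qed.

Let JK_le (j k : R) x : 0 < x -> `|j| <= B * (1 + x) ->
  `|k| * (1 + x) <= C * decay x -> `|j * k| <= B * C * decay x.
Proof.
move=> x0 jB kC; rewrite normrM (le_trans (ler_wpM2r (normr_ge0 _) jB))//.
have -> : B * (1 + x) * `|k| = B * (`|k| * (1 + x)) by ring.
by rewrite -[leRHS]mulrA ler_wpM2l.
Qed.

Let J_le' x : 0 < x -> `|J x| <= B * (1 + x).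
Proof. by move=> x0; rewrite (le_trans (J_le x0))// ler_peMr//; lra. Qed.

Let Kd x (x0 : 0 < x) := D_of x0 (K_le x0).
Let K1d x (x0 : 0 < x) := D_of x0 (K1_le x0).

Let P_le x : 0 < x -> `|P x| <= B * C * decay x.
Proof. by move=> x0; apply: JK_le => //; [exact: J_le'|exact: Kd]. Qed.

Let P1_le x : 0 < x -> `|P1 x| <= 2 * (B * C) * decay x.
Proof.
move=> x0; rewrite (le_trans (ler_normD _ _))// -[leRHS]mulrA mulr_natl mulr2n lerD//.
  by apply: JK_le => //; [exact: J1_le|exact: Kd].
by apply: JK_le => //; [exact: J_le'|exact: K1d].
Qed.

Let W_le x : 0 < x -> `|W x| <= 2 * (B * C) * decay x.
Proof.
move=> x0; rewrite (le_trans (ler_normB _ _))// -[leRHS]mulrA mulr_natl mulr2n lerD//.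
  by apply: JK_le => //; [exact: J1_le|exact: Kd].
by apply: JK_le => //; [exact: J_le'|exact: K1d].
Qed.

Let S_le x : 0 < x -> `|S x| <= (tau ^+ 2 / 2 + 2) * (B * C) * decay x.
Proof.
move=> x0; rewrite (le_trans (ler_normD _ _))// -[leRHS]mulrA [leRHS]mulrDl.
have t2 : 0 <= tau ^+ 2 / 2 by rewrite divr_ge0// sqr_ge0.
apply: lerD; rewrite normrM ?[`|tau ^+ 2 / 2|]ger0_norm// ?[`|2|]ger0_norm// ler_wpM2l//.
  exact: P_le.
by apply: JK_le => //; [exact: J1_le|exact: K1d].
Qed.

Let dP x : 0 < x -> is_derive x (1 : R) P (P1 x / x).
Proof. by move=> x0; rewrite /P; dv; rewrite /P1; ring. Qed.

Let dP1 x : 0 < x -> is_derive x (1 : R) P1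
  ((2 * (J1 x * K1 x) - tau ^+ 2 / 2 * P x) / x).
Proof. by move=> x0; rewrite /P1; dv; rewrite /P; field; rewrite gt_eqF. Qed.

Let dW x : 0 < x -> is_derive x (1 : R) W (- 4 * P x).
Proof. move=> x0; rewrite /W; dv; rewrite /P; by field; rewrite gt_eqF. Qed.

Let dS x : 0 < x -> is_derive x (1 : R) S (4 * W x).
Proof. by move=> x0; rewrite /S; dv; rewrite /W /P1 ?/P; field; rewrite gt_eqF. Qed.

Let cP x : 0 < x -> {for x, continuous P}.
Proof. by move=> x0; exact: dv_cont (dP x0). Qed.

Let iBC : ray_integrable (fun x => B * C * decay x).
Proof. by apply: ray_integrableZ; exact: ray_integrable_decay. Qed.

Let iP : ray_integrable P.
Proof. by apply: (ray_integrable_le _ P_le iBC); exact: ray_measurable. Qed.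

(** [- W / 4] is a primitive of [P]; it goes from [- 1 / 8] at 0 to 0 at infinity. *)
Lemma rayint_product : rayint (fun x => J x * K x) = 8^-1.
Proof.
have dW4 x : 0 < x -> is_derive x (1 : R) (fun x => - 4^-1 * W x) (P x).
  by move=> x0; apply: dv_eq (dvM (dvC _ x) (dW x0)) _; field.
have -> : 8^-1 = 0 - (- 4^-1 * 2^-1) :> R by field.
apply: (rayint_FTC cP dW4 iP); first by apply: cvgMr; exact: W_at0.
have -> : 0 = - 4^-1 * 0 :> R by rewrite mulr0.
apply: cvgMr; apply: (@cvg_aty_le _ _ _ (2 * (B * C))) => x x1.
have x0 : 0 < x by exact: lt_trans x1.
rewrite subr0 (le_trans (W_le x0))// ler_wpM2l ?mulr_ge0//.
by have := decay_le_inv x1; rewrite div1r.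
Qed.

Let bounded_integrable (k : R -> R) M : (forall x, 0 < x -> {for x, continuous k}) ->
  (forall x, 0 < x -> `|k x| <= M) -> ray_integrable (fun x => k x * P x).
Proof.
move=> ck kM; apply: (@ray_integrable_le _ _ (fun x => M * (B * C * decay x))).
- by apply: ray_measurable => x x0; apply: continuousM; [exact: ck|exact: cP].
- move=> x x0; rewrite normrM ler_pM// ?kM//; exact: P_le.
- exact: ray_integrableZ.
Qed.

(** [G1] and [G2] are the images of [F] under [c d/dc] and its square, because [kei1 x] and
    [4 x ker x] are those of [kei] under [x d/dx]. *)
Let F c := rayint (fun x => kei (x * c) * P x).
Let G1 c := rayint (fun x => kei1 (x * c) * P x).
Let G2 c := rayint (fun x => 4 * (x * c * ker (x * c)) * P x).

Let dk c x : 0 < c -> 0 < x ->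
  is_derive x (1 : R) (fun x => kei (x * c)) (kei1 (x * c) / x).
Proof.
move=> c0 x0; have xc := mulr_gt0 x0 c0; have h := @kei_dv R.
by dv; field; rewrite !gt_eqF.
Qed.

Let dk1 c x : 0 < c -> 0 < x ->
  is_derive x (1 : R) (fun x => kei1 (x * c)) (4 * c * ker (x * c)).
Proof. by move=> c0 x0; have xc := mulr_gt0 x0 c0; have h := @kei1_dv R; dv; ring. Qed.

Let dr c x : 0 < c -> 0 < x ->
  is_derive x (1 : R) (fun x => ker (x * c)) (ker1 (x * c) / x).
Proof.
move=> c0 x0; have xc := mulr_gt0 x0 c0; have h := @ker_dv R.
by dv; field; rewrite !gt_eqF.
Qed.

Let dr1 c x : 0 < c -> 0 < x ->
  is_derive x (1 : R) (fun x => ker1 (x * c)) (- 4 * c * kei (x * c)).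
Proof. by move=> c0 x0; have xc := mulr_gt0 x0 c0; have h := @ker1_dv R; dv; ring. Qed.

Let dxr c x : 0 < c -> 0 < x -> is_derive x (1 : R)
  (fun x => 4 * (x * c * ker (x * c))) (4 * c * (ker (x * c) + ker1 (x * c))).
Proof.
move=> c0 x0; have xc := mulr_gt0 x0 c0; have h := dr c0 x0.
by dv; field; rewrite gt_eqF.
Qed.

Let iF c : 0 < c -> ray_integrable (fun x => kei (x * c) * P x).
Proof.
move=> c0; have [M M0 HM] := @kei_ker_bounds R.
apply: (@bounded_integrable _ M) => x x0; first exact: dv_cont (dk c0 x0).
by have [[]] := HM _ (mulr_gt0 x0 c0).
Qed.

Let iG1 c : 0 < c -> ray_integrable (fun x => kei1 (x * c) * P x).
Proof.
move=> c0; have [M M0 HM] := @kei_ker_bounds R.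
apply: (@bounded_integrable _ M) => x x0; first exact: dv_cont (dk1 c0 x0).
by have [_ []] := HM _ (mulr_gt0 x0 c0).
Qed.

Let iG2 c : 0 < c -> ray_integrable (fun x => 4 * (x * c * ker (x * c)) * P x).
Proof.
move=> c0; have [M M0 HM] := @kei_ker_bounds R.
apply: (@bounded_integrable _ (4 * M)) => x x0; first exact: dv_cont (dxr c0 x0).
have [_ _ [xM _] _] := HM _ (mulr_gt0 x0 c0).
by rewrite normrM [`|4|]ger0_norm// ler_pM2l.
Qed.

Let dF c : 0 < c -> is_derive c (1 : R) F (G1 c / c).
Proof.
move=> c0; have [M M0 HM] := @kei_ker_bounds R.
have c20 : 0 < c / 2 by rewrite divr_gt0.
pose h' a x := a^-1 * (kei1 (x * a) * P x).
have -> : G1 c / c = rayint (h' c) by rewrite mulrC -rayintZ//; exact: iG1.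
apply: (@rayint_dv _ (fun a x => kei (x * a) * P x) h' (c / 2) (c + 1) c
  (fun x => (c / 2)^-1 * M * (B * C * decay x))).
- by apply/andP; split; lra.
- by move=> a /andP[ca _]; apply: iF; exact: lt_trans ca.
- move=> a x /andP[ca _] x0; have a0 : 0 < a by exact: lt_trans ca.
  have xa := mulr_gt0 x0 a0; have h := @kei_dv R.
  by rewrite /h'; dv; field; rewrite !gt_eqF.
- exact: ray_integrableZ.
- move=> a x /andP[ca _] x0; have a0 : 0 < a by exact: lt_trans ca.
  have [_ [kM _] _ _] := HM _ (mulr_gt0 x0 a0).
  have ai : `|a^-1| <= (c / 2)^-1.
    by rewrite gtr0_norm ?invr_gt0// lef_pV2 ?posrE// ltW.
  rewrite /h' normrM -[leRHS]mulrA ler_pM// normrM ler_pM//; exact: P_le.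
Qed.

Let dG1 c : 0 < c -> is_derive c (1 : R) G1 (G2 c / c).
Proof.
move=> c0; have [M M0 HM] := @kei_ker_bounds R.
have c20 : 0 < c / 2 by rewrite divr_gt0.
pose h' a x := a^-1 * (4 * (x * a * ker (x * a)) * P x).
have -> : G2 c / c = rayint (h' c) by rewrite mulrC -rayintZ//; exact: iG2.
apply: (@rayint_dv _ (fun a x => kei1 (x * a) * P x) h' (c / 2) (c + 1) c
  (fun x => (c / 2)^-1 * (4 * M) * (B * C * decay x))).
- by apply/andP; split; lra.
- by move=> a /andP[ca _]; apply: iG1; exact: lt_trans ca.
- move=> a x /andP[ca _] x0; have a0 : 0 < a by exact: lt_trans ca.
  have xa := mulr_gt0 x0 a0; have h := @kei1_dv R.
  by rewrite /h'; dv; field; rewrite !gt_eqF.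
- exact: ray_integrableZ.
- move=> a x /andP[ca _] x0; have a0 : 0 < a by exact: lt_trans ca.
  have [_ _ [kM _] _] := HM _ (mulr_gt0 x0 a0).
  have ai : `|a^-1| <= (c / 2)^-1.
    by rewrite gtr0_norm ?invr_gt0// lef_pV2 ?posrE// ltW.
  rewrite /h' normrM -[leRHS]mulrA ler_pM// normrM ler_pM//; last exact: P_le.
  by rewrite normrM [`|4|]ger0_norm// ler_pM2l.
Qed.

(* The integrand of the difference of both sides is the derivative of [Bf],
   obtained by integrating by parts with [W' = -4 P] and [S' = 4 W]. *)
Let Bf c x := - 4^-1 * (4 * (x * c * ker (x * c)) - kei1 (x * c)) * W x
  + c / 4 * ker1 (x * c) * S x
  + c ^+ 2 * (x * kei (x * c) * P1 x - x * (kei (x * c) + kei1 (x * c)) * P x).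

Let Bf' c x := (4 * (x * c * ker (x * c)) * P x - kei1 (x * c) * P x) -
  c ^+ 2 * (4 * (x * c * ker (x * c)) * P x + 2 * (kei1 (x * c) * P x) +
    (1 + tau ^+ 2) * (kei (x * c) * P x)).

Let dBf c x : 0 < c -> 0 < x -> is_derive x (1 : R) (Bf c) (Bf' c x).
Proof.
move=> c0 x0; have h1 := dk c0 x0; have h2 := dk1 c0 x0; have h3 := dr1 c0 x0.
have h4 := dxr c0 x0; have h5 := dW x0; have h6 := dS x0.
have h7 := dP x0; have h8 := dP1 x0; have h9 := dr c0 x0.
rewrite /Bf; dv; rewrite /Bf' /P1 /W /S /P; field; by rewrite gt_eqF.
Qed.

Let cBf' c x : 0 < c -> 0 < x -> {for x, continuous (Bf' c)}.
Proof.
move=> c0 x0; have c1 := dv_cont (dk c0 x0); have c2 := dv_cont (dk1 c0 x0).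
have c3 := dv_cont (dxr c0 x0); have c4 := cP x0.
apply: continuousB.
  by apply: continuousB; apply: continuousM.
apply: continuousM; first exact: cvg_cst.
apply: continuousD; last first.
  by apply: continuousM; [exact: cvg_cst|apply: continuousM].
apply: continuousD; first by apply: continuousM.
by apply: continuousM; [exact: cvg_cst|apply: continuousM].
Qed.

Let iBf' c : 0 < c -> ray_integrable (Bf' c).
Proof.
move=> c0; apply: ray_integrableB.
  by apply: ray_integrableB; [exact: iG2|exact: iG1].
apply/ray_integrableZ/ray_integrableD; last by apply: ray_integrableZ; exact: iF.
by apply: ray_integrableD; [exact: iG2|apply: ray_integrableZ; exact: iG1].
Qed.

Let sqrtMr c x : 0 < c -> 0 < x -> Num.sqrt (x * c) = Num.sqrt c * Num.sqrt x.
Proof. by move=> c0 x0; rewrite mulrC sqrtrM// ltW. Qed.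

(** Each of the three terms vanishes for its own reason: [W] has a limit and its factor tends to 0;
    [ker1] is merely bounded but [S] tends to 0; the last term is of order [x decay x]. *)
Let Bf_at0 c : 0 < c -> Bf c x @[x --> 0^'+] --> (0 : R).
Proof.
move=> c0; have [M M0 HM] := @kei_ker_bounds R.
have E : - 4^-1 * 0 * 2^-1 + c / 4 * 0 + c ^+ 2 * 0 = 0 :> R by ring.
rewrite -[X in _ --> X]E.
apply: cvgD; first apply: cvgD.
- apply: cvgM; last exact: W_at0.
  apply: cvgMr; apply: (@cvg_at0_le _ _ _ (5 * M * Num.sqrt c)) => x /andP[x0 _].
  have [_ [_ k1] [_ k2] _] := HM _ (mulr_gt0 x0 c0).
  rewrite subr0 (le_trans (ler_normB _ _))// normrM [`|4|]ger0_norm//.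
  rewrite -[leRHS]mulrA -(sqrtMr c0 x0); lra.
- have h : c / 4 * (M * `|S x|) @[x --> 0^'+] --> c / 4 * (M * `|0 : R|).
    by apply: cvgMr; apply: cvgMr; apply: cvg_norm; exact: S_at0.
  rewrite normr0 mulr0 in h; rewrite mulr0 in h *.
  apply/norm_cvg0P; apply: (squeeze_cvgr _ (cvg_cst _) h).
  near=> x; have x0 : 0 < x by near: x; exact: nbhs_right_gt.
  have [_ _ _ k3] := HM _ (mulr_gt0 x0 c0).
  have c4 : 0 <= c / 4 by rewrite divr_ge0// ltW.
  by rewrite normr_ge0 /= -mulrA normrM (ger0_norm c4) ler_wpM2l// normrM ler_wpM2r.
- apply: cvgMr; apply: (@cvg_at0_le _ _ _ (4 * M * (B * C))) => x /andP[x0 _].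
  have [[k0 _] [k1 _] _ _] := HM _ (mulr_gt0 x0 c0).
  have dx := decay_at0 x0; have BC : 0 <= B * C by exact: mulr_ge0.
  rewrite subr0 (le_trans (ler_normB _ _))//.
  have e1 : `|x * kei (x * c) * P1 x| <= M * (2 * (B * C)) * (x * decay x).
    rewrite normrM [`|x * _|]normrM (gtr0_norm x0).
    have h := ler_pM (normr_ge0 _) (normr_ge0 _) k0 (P1_le x0).
    rewrite -[leLHS]mulrA (le_trans (ler_wpM2l (ltW x0) h))//.
    by apply: eq_le_r; ring.
  have e2 : `|x * (kei (x * c) + kei1 (x * c)) * P x| <= 2 * M * (B * C) * (x * decay x).
    have kk : `|kei (x * c) + kei1 (x * c)| <= 2 * M.
      by rewrite (le_trans (ler_normD _ _))//; lra.
    rewrite normrM [`|x * _|]normrM (gtr0_norm x0).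
    have h := ler_pM (normr_ge0 _) (normr_ge0 _) kk (P_le x0).
    rewrite -[leLHS]mulrA (le_trans (ler_wpM2l (ltW x0) h))//.
    by apply: eq_le_r; ring.
  have MBC : 0 <= M * (B * C) by exact: mulr_ge0.
  by nra.
Unshelve. all: by end_near. Qed.

Let Bf_aty c : 0 < c -> Bf c x @[x --> +oo] --> (0 : R).
Proof.
move=> c0; have [M M0 HM] := @kei_ker_bounds R.
have BC : 0 <= B * C by exact: mulr_ge0.
pose T := tau ^+ 2 / 2 + 2.
have T0 : 0 <= T by rewrite /T addr_ge0// divr_ge0// sqr_ge0.
apply: (@cvg_aty_le _ _ _ (4^-1 * (5 * M) * (2 * (B * C)) + c / 4 * M * (T * (B * C))
   + c ^+ 2 * (4 * M * (B * C)))) => x x1.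
have x0 : 0 < x by exact: lt_trans x1.
have [[k0 _] [k1 _] [k2 _] k3] := HM _ (mulr_gt0 x0 c0).
have d1 := decay_le_inv x1; have d2 := decay_aty x1; have d0 := decay_gt0 x0.
rewrite div1r in d1; rewrite div1r in d2.
have c4 : 0 <= c / 4 by rewrite divr_ge0// ltW.
rewrite subr0 /Bf (le_trans (ler_normD _ _))// [leRHS]mulrDl lerD//.
  rewrite (le_trans (ler_normD _ _))// [leRHS]mulrDl lerD//.
    have kk : `|- 4^-1 * (4 * (x * c * ker (x * c)) - kei1 (x * c))| <= 4^-1 * (5 * M).
      rewrite normrM normrN [`|4^-1|]ger0_norm// ler_pM2l//.
      by rewrite (le_trans (ler_normB _ _))// normrM [`|4|]ger0_norm//; lra.
    rewrite normrM -[leRHS]mulrA ler_pM// (le_trans (W_le x0))//.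
    by rewrite ler_wpM2l// mulr_ge0.
  have kk : `|c / 4 * ker1 (x * c)| <= c / 4 * M.
    by rewrite normrM (ger0_norm c4) ler_wpM2l.
  rewrite normrM -[leRHS]mulrA ler_pM// (le_trans (S_le x0))//.
  by rewrite ler_wpM2l// mulr_ge0.
rewrite normrM [`|c ^+ 2|]ger0_norm ?sqr_ge0// -[leRHS]mulrA ler_wpM2l ?sqr_ge0//.
rewrite (le_trans (ler_normB _ _))//.
have e1 : `|x * kei (x * c) * P1 x| <= M * (2 * (B * C)) * (x * decay x).
  rewrite normrM [`|x * _|]normrM (gtr0_norm x0).
  have h := ler_pM (normr_ge0 _) (normr_ge0 _) k0 (P1_le x0).
  rewrite -[leLHS]mulrA (le_trans (ler_wpM2l (ltW x0) h))//.
  by apply: eq_le_r; ring.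
have e2 : `|x * (kei (x * c) + kei1 (x * c)) * P x| <= 2 * M * (B * C) * (x * decay x).
  have kk : `|kei (x * c) + kei1 (x * c)| <= 2 * M.
    by rewrite (le_trans (ler_normD _ _))//; lra.
  rewrite normrM [`|x * _|]normrM (gtr0_norm x0).
  have h := ler_pM (normr_ge0 _) (normr_ge0 _) kk (P_le x0).
  rewrite -[leLHS]mulrA (le_trans (ler_wpM2l (ltW x0) h))//.
  by apply: eq_le_r; ring.
have MBC : 0 <= M * (B * C) by exact: mulr_ge0.
by nra.
Qed.

Let F_ode c : 0 < c ->
  G2 c - G1 c = c ^+ 2 * (G2 c + 2 * G1 c + (1 + tau ^+ 2) * F c).
Proof.
move=> c0.
have := rayint_FTC (fun x => @cBf' c x c0) (fun x => @dBf c x c0) (iBf' c0)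
  (Bf_at0 c0) (Bf_aty c0).
have iA := ray_integrableB (iG2 c0) (iG1 c0).
have i1 := ray_integrableZ 2 (iG1 c0).
have i0 := ray_integrableZ (1 + tau ^+ 2) (iF c0).
have i2 := ray_integrableD (iG2 c0) i1.
have iB := ray_integrableD i2 i0.
rewrite subrr /Bf' (rayintB iA (ray_integrableZ _ iB)) (rayintB (iG2 c0) (iG1 c0)).
rewrite (rayintZ _ iB) (rayintD i2 i0) (rayintD (iG2 c0) i1).
rewrite (rayintZ _ (iG1 c0)) (rayintZ _ (iF c0)).
by move/subr0_eq.
Qed.

(** [kei (x c) + pi / 4] is of order [sqrt (x c)], so [F c] differs from [- (pi / 4) (1 / 8)] by a
    multiple of [sqrt c] times the integral of [sqrt x decay x]. *)
Let F_near0 : exists D, forall c, 0 < c -> `|F c - (- (pi / 32))| <= D * Num.sqrt c.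
Proof.
have [M M0 HM] := @kei_ker_bounds R.
pose I := rayint (fun x => Num.sqrt x * decay x).
exists (M * (B * C) * I) => c c0.
have -> : F c - (- (pi / 32)) = rayint (fun x => kei (x * c) * P x + pi / 4 * P x).
  rewrite rayintD; [|exact: iF|exact: ray_integrableZ].
  by rewrite rayintZ// -/(F c) /P rayint_product; field.
have E x : 0 < x -> `|kei (x * c) * P x + pi / 4 * P x| <=
    M * (B * C) * Num.sqrt c * (Num.sqrt x * decay x).
  move=> x0; have [[_ k0] _ _ _] := HM _ (mulr_gt0 x0 c0).
  rewrite (sqrtMr c0 x0) in k0; rewrite -mulrDl normrM.
  have := ler_pM (normr_ge0 _) (normr_ge0 _) k0 (P_le x0).
  by move=> h; apply: (le_trans h); apply: eq_le_r; ring.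
apply: (le_trans (rayint_norm_le _ _ E)).
- apply: ray_measurable => x x0; have ck := dv_cont (dk c0 x0).
  apply: continuousD; first by apply: continuousM => //; exact: cP.
  by apply: continuousM; [exact: cvg_cst|exact: cP].
- by apply: ray_integrableZ; exact: ray_integrable_sqrt_decay.
- rewrite rayintZ; last exact: ray_integrable_sqrt_decay.
  by rewrite -/I mulrAC.
Qed.

Lemma rayint_kei_product t : 0 <= t ->
  rayint (fun x => kei (x * coshR t) * (J x * K x)) * sinhR t * sinhR (tau * (pi / 2)) =
  - (pi / 32) * sin (tau * t).
Proof.
move=> t0; have [D HD] := F_near0.
exact: (legendre_cosh tau0 dF dG1 F_ode HD t0).
Qed.

End ProductIntegral.

(** * The Gamma function at [1 + i tau] *)

Section GammaOneIm.
Variable R : realType.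
Implicit Types (t x s : R) (k N : nat).

(** Half of the exponential absorbs the power. *)
Lemma expX_le k t : 0 < t -> t ^+ k * expR (- t) <=
  (2 ^ k)%:R * k`!%:R * expR (- (2^-1 * t)).
Proof.
move=> t0; have -> : t ^+ k * expR (- t) =
    2 ^+ k * ((2^-1 * t) ^+ k * expR (- (2^-1 * t))) * expR (- (2^-1 * t)).
  rewrite exprMn exprVn !mulrA mulfV ?expf_neq0// mul1r -mulrA -expRD.
  by congr (_ * expR _); field.
rewrite ler_wpM2r ?expR_ge0// natrX ler_wpM2l ?exprn_ge0//.
by rewrite pow_expN_le// mulr_ge0// ltW.
Qed.

Lemma gamma_integrable (g : R -> R) k : poscont g -> (forall x, 0 < x -> `|g x| <= 1) ->
  ray_integrable (fun t => t ^+ k * expR (- t) * g t).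
Proof.
move=> cg g1.
apply: (@ray_integrable_le _ _ (fun t => (2 ^ k)%:R * k`!%:R * expR (- (2^-1 * t)))).
- apply: ray_measurable => x x0; apply: continuousM; last exact: cg.
  have d : is_derive x (1 : R) (fun t => t ^+ k * expR (- t))
     (k%:R * x ^+ k.-1 * expR (- x) - x ^+ k * expR (- x)) by dv; ring.
  exact: dv_cont d.
- move=> x x0; rewrite normrM.
  rewrite ger0_norm ?mulr_ge0 ?expR_ge0 ?exprn_ge0 ?(ltW x0)//.
  apply: (le_trans _ (expX_le k x0)).
  by rewrite ler_piMr ?g1// mulr_ge0 ?expR_ge0// exprn_ge0// ltW.
- by apply: ray_integrableZ; exact: ray_integrable_exp.
Qed.

Let pow_at0 k (g : R -> R) : (forall x, 0 < x -> `|g x| <= 1) ->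
  t ^+ k.+1 * expR (- t) * g t @[t --> 0^'+] --> (0 : R).
Proof.
move=> g1; apply: (@cvg_at0_lin _ _ _ 1) => x /andP[x0 x1].
rewrite subr0 mul1r normrM (le_trans (ler_wpM2l (normr_ge0 _) (g1 _ x0)))// mulr1.
rewrite ger0_norm ?mulr_ge0 ?expR_ge0 ?exprn_ge0 ?(ltW x0)//.
rewrite exprS -mulrA ler_piMr ?(ltW x0)// mulr_ile1 ?expR_ge0 ?exprn_ge0 ?(ltW x0)//.
  by rewrite exprn_ile1// ltW.
by rewrite expR_le1 oppr_le0 ltW.
Qed.

Let pow_aty k (g : R -> R) : (forall x, 0 < x -> `|g x| <= 1) ->
  t ^+ k * expR (- t) * g t @[t --> +oo] --> (0 : R).
Proof.
move=> g1; apply: (@cvg_aty_le _ _ _ k.+1`!%:R) => x x1.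
have x0 : 0 < x by exact: lt_trans x1.
rewrite subr0 normrM (le_trans (ler_wpM2l (normr_ge0 _) (g1 _ x0)))// mulr1.
rewrite ger0_norm ?mulr_ge0 ?expR_ge0 ?exprn_ge0 ?(ltW x0)//.
by rewrite ler_pdivlMr// mulrAC -exprSr pow_expN_le// ltW.
Qed.

(* Real and imaginary part of [Gamma (k + 1 + i tau)]. *)
Definition gamC tau k := rayint (fun t => t ^+ k * expR (- t) * cos (tau * ln t)).
Definition gamS tau k := rayint (fun t => t ^+ k * expR (- t) * sin (tau * ln t)).

Let ccos tau : poscont (fun t : R => cos (tau * ln t)).
Proof.
move=> x x0; have d : is_derive x (1 : R) (fun t => cos (tau * ln t))
  (- sin (tau * ln x) * (tau * x^-1)) by dv; ring.
exact: dv_cont d.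
Qed.

Let csin tau : poscont (fun t : R => sin (tau * ln t)).
Proof.
move=> x x0; have d : is_derive x (1 : R) (fun t => sin (tau * ln t))
  (cos (tau * ln x) * (tau * x^-1)) by dv; ring.
exact: dv_cont d.
Qed.

Let ncos tau x : 0 < x -> `|cos (tau * ln x) : R| <= 1.
Proof. by move=> _; exact: norm_cos_le1. Qed.
Let nsin tau x : 0 < x -> `|sin (tau * ln x) : R| <= 1.
Proof. by move=> _; exact: norm_sin_le1. Qed.

Lemma gamC_integrable tau k : ray_integrable (fun t => t ^+ k * expR (- t) * cos (tau * ln t)).
Proof. exact: (gamma_integrable k (@ccos tau) (@ncos tau)). Qed.

Lemma gamS_integrable tau k : ray_integrable (fun t => t ^+ k * expR (- t) * sin (tau * ln t)).
Proof. exact: (gamma_integrable k (@csin tau) (@nsin tau)). Qed.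

(** With [gamS_rec] this is [Gamma (z + 1) = z Gamma z] at [z = k + 1 + i tau], from the vanishing
    boundary values of [t^(k+1) e^-t cos (tau ln t)]. *)
Lemma gamC_rec tau k : gamC tau k.+1 = k.+1%:R * gamC tau k - tau * gamS tau k.
Proof.
pose f t := k.+1%:R * (t ^+ k * expR (- t) * cos (tau * ln t)) -
  tau * (t ^+ k * expR (- t) * sin (tau * ln t)) -
  t ^+ k.+1 * expR (- t) * cos (tau * ln t).
have i1 := ray_integrableZ k.+1%:R (gamC_integrable tau k).
have i2 := ray_integrableZ tau (gamS_integrable tau k).
have i12 := ray_integrableB i1 i2.
have ifn : ray_integrable f by apply: ray_integrableB => //; exact: gamC_integrable.
have dF x : 0 < x -> is_derive x (1 : R)
    (fun t => t ^+ k.+1 * expR (- t) * cos (tau * ln t)) (f x).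
  by move=> x0; dv; rewrite /f exprS; field; rewrite gt_eqF.
have cf x : 0 < x -> {for x, continuous f}.
  move=> x0; rewrite /f.
  have c := @ccos tau x x0; have s := @csin tau x x0.
  have cp j : {for x, continuous (fun t : R => t ^+ j * expR (- t))}.
    have d : is_derive x (1 : R) (fun t => t ^+ j * expR (- t))
      (j%:R * x ^+ j.-1 * expR (- x) - x ^+ j * expR (- x)) by dv; ring.
    exact: dv_cont d.
  apply: continuousB; last by apply: continuousM.
  by apply: continuousB; apply: continuousM; try exact: cvg_cst; apply: continuousM.
have := rayint_FTC cf dF ifn (pow_at0 _ (ncos tau)) (pow_aty _ (ncos tau)).
rewrite subrr (rayintB i12 (gamC_integrable tau k.+1)).
by rewrite (rayintB i1 i2) (rayintZ _ (gamC_integrable tau k)) (rayintZ _ (gamS_integrable tau k)) => /subr0_eq/esym.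
Qed.

Lemma gamS_rec tau k : gamS tau k.+1 = k.+1%:R * gamS tau k + tau * gamC tau k.
Proof.
pose f t := k.+1%:R * (t ^+ k * expR (- t) * sin (tau * ln t)) +
  tau * (t ^+ k * expR (- t) * cos (tau * ln t)) -
  t ^+ k.+1 * expR (- t) * sin (tau * ln t).
have i1 := ray_integrableZ k.+1%:R (gamS_integrable tau k).
have i2 := ray_integrableZ tau (gamC_integrable tau k).
have i12 := ray_integrableD i1 i2.
have ifn : ray_integrable f by apply: ray_integrableB => //; exact: gamS_integrable.
have dF x : 0 < x -> is_derive x (1 : R)
    (fun t => t ^+ k.+1 * expR (- t) * sin (tau * ln t)) (f x).
  by move=> x0; dv; rewrite /f exprS; field; rewrite gt_eqF.
have cf x : 0 < x -> {for x, continuous f}.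
  move=> x0; rewrite /f.
  have c := @ccos tau x x0; have s := @csin tau x x0.
  have cp j : {for x, continuous (fun t : R => t ^+ j * expR (- t))}.
    have d : is_derive x (1 : R) (fun t => t ^+ j * expR (- t))
      (j%:R * x ^+ j.-1 * expR (- x) - x ^+ j * expR (- x)) by dv; ring.
    exact: dv_cont d.
  apply: continuousB; last by apply: continuousM.
  by apply: continuousD; apply: continuousM; try exact: cvg_cst; apply: continuousM.
have := rayint_FTC cf dF ifn (pow_at0 _ (nsin tau)) (pow_aty _ (nsin tau)).
rewrite subrr (rayintB i12 (gamS_integrable tau k.+1)).
by rewrite (rayintD i1 i2) (rayintZ _ (gamS_integrable tau k)) (rayintZ _ (gamC_integrable tau k)) => /subr0_eq/esym.
Qed.

Lemma gamC0 k : gamC 0 k = k`!%:R.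
Proof.
elim: k => [|k IH]; last by rewrite gamC_rec IH mul0r subr0 factS natrM.
rewrite /gamC fact0 -[RHS]invr1 -(rayint_exp ltr01).
by apply: rayint_eq => t _; rewrite expr0 !mul1r mul0r cos0 mulr1.
Qed.

Definition gam_sqr tau k := gamC tau k ^+ 2 + gamS tau k ^+ 2.

Lemma gam_sqr_rec tau k :
  gam_sqr tau k.+1 = (k.+1%:R ^+ 2 + tau ^+ 2) * gam_sqr tau k.
Proof. by rewrite /gam_sqr gamC_rec gamS_rec; ring. Qed.

Lemma norm_sin_le x : `|sin x| <= `|x|.
Proof.
wlog x0 : x / 0 <= x => [H|].
  have [x0|x0] := leP 0 x; first exact: H.
  by rewrite -normrN -sinN -[leRHS]normrN H// oppr_ge0 ltW.
have := @dv_le R sin cos 0 x 1 x0 (fun y _ => is_derive_sin y)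
  (fun y _ => norm_cos_le1 y).
by rewrite sin0 !subr0 mul1r (ger0_norm x0).
Qed.

Lemma cos_ge x : 1 - x ^+ 2 / 2 <= cos x.
Proof.
have -> : cos x = 1 - 2 * sin (x / 2) ^+ 2.
  have -> : cos x = cos (x / 2 + x / 2) by congr cos; field.
  by rewrite cosD -!expr2 cos2sin2; ring.
have := norm_sin_le (x / 2); rewrite -ler_sqr ?nnegrE// !real_normK ?num_real//.
by lra.
Qed.

(** With [l = ln x], the right-hand side is [4 sinh^2 (l / 2)]. *)
Lemma sqr_ln_le x : 0 < x -> ln x ^+ 2 <= x + x^-1 - 2.
Proof.
move=> x0; set l := ln x; have -> : x = expR l by rewrite lnK.
rewrite -expRN.
have E (y : R) : expR y + expR (- y) - 2 = 4 * sinhR (y / 2) ^+ 2.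
  have -> : expR y = expR (y / 2) ^+ 2 by rewrite -expRM_natr; congr expR; field.
  have -> : expR (- y) = expR (- (y / 2)) ^+ 2.
    by rewrite -expRM_natr; congr expR; field.
  have e := expRxMexpNx_1 (y / 2).
  rewrite /sinhR.
  transitivity (expR (y / 2) ^+ 2 + expR (- (y / 2)) ^+ 2 -
    2 * (expR (y / 2) * expR (- (y / 2)))); first by rewrite e mulr1.
  by field.
wlog l0 : l / 0 <= l => [H|].
  have [l0|l0] := leP 0 l; first exact: H.
  by have := H (- l); rewrite opprK sqrrN addrAC [_ - 2 + _]addrC addrA; apply; rewrite oppr_ge0 ltW.
have l2 : 0 <= l / 2 by rewrite divr_ge0.
have h : (l / 2) ^+ 2 <= sinhR (l / 2) ^+ 2.
  by rewrite ler_sqr ?nnegrE ?sinhR_ge// sinhR_ge0.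
by rewrite E; move: h; rewrite expr_div_n; lra.
Qed.

(* The density [t ^ N e^-t / N!] concentrates near [t = N]. *)
Lemma gam_sqr_ge tau N : (0 < N)%N ->
  N`!%:R * (1 - tau ^+ 2 / (2 * N%:R)) <=
  gamC tau N * cos (tau * ln N%:R) + gamS tau N * sin (tau * ln N%:R).
Proof.
move=> N0; have n0 : 0 < N%:R :> R by rewrite ltr0n.
have nn : N%:R != 0 :> R by rewrite gt_eqF.
set c := cos (tau * ln N%:R); set s := sin (tau * ln N%:R).
have E : gamC tau N * c + gamS tau N * s =
    rayint (fun t => c * (t ^+ N * expR (- t) * cos (tau * ln t)) +
       s * (t ^+ N * expR (- t) * sin (tau * ln t))).
  rewrite (rayintD (ray_integrableZ c (gamC_integrable tau N)) (ray_integrableZ s (gamS_integrable tau N))).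
  by rewrite (rayintZ _ (gamC_integrable tau N)) (rayintZ _ (gamS_integrable tau N)) mulrC [s * _]mulrC.
have i1 k : ray_integrable (fun t => t ^+ k * expR (- t) * cos (0 * ln t)) by exact: gamC_integrable.
have i1N := i1 N; have i1S := i1 N.+1; have i1P := i1 N.-1.
(* The minorant of the integrand given by [cos (tau l) >= 1 - tau^2 l^2 / 2] and [sqr_ln_le] for
   [l = ln (t / N)]. Against [t^N e^-t / N!] the means of [t / N] and [N / t] are [1 + 1 / N] and
   [1], which leaves [tau^2 / (2 N)]. The factor [cos (0 ln t)] is 1 and lets [gamC0] evaluate the
   integrals. *)
pose h t := (1 + tau ^+ 2) * (t ^+ N * expR (- t) * cos (0 * ln t)) +
  ((- (tau ^+ 2 / (2 * N%:R))) * (t ^+ N.+1 * expR (- t) * cos (0 * ln t)) +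
   (- (tau ^+ 2 * N%:R / 2)) * (t ^+ N.-1 * expR (- t) * cos (0 * ln t))).
have ih : ray_integrable h.
  apply: ray_integrableD; first exact: ray_integrableZ.
  by apply: ray_integrableD; exact: ray_integrableZ.
have -> : N`!%:R * (1 - tau ^+ 2 / (2 * N%:R)) = rayint h.
  rewrite rayintD; [|exact: ray_integrableZ|by apply: ray_integrableD; exact: ray_integrableZ].
  rewrite rayintD; [|exact: ray_integrableZ|exact: ray_integrableZ].
  rewrite !rayintZ// -!/(gamC 0 _) !gamC0 factS.
  case: N N0 nn {n0 c s E i1 i1N i1S i1P h ih} => // N _ nn.
  by rewrite /= !factS !natrM -[N.+2%:R]natr1; field.
rewrite E; apply: rayint_le => //.
  by apply: ray_integrableD; apply: ray_integrableZ; [exact: gamC_integrable|exact: gamS_integrable].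
move=> t t0; have tn : t != 0 by rewrite gt_eqF.
have -> : c * (t ^+ N * expR (- t) * cos (tau * ln t)) +
   s * (t ^+ N * expR (- t) * sin (tau * ln t)) =
   t ^+ N * expR (- t) * cos (tau * ln (t / N%:R)).
  by rewrite ln_div ?posrE// mulrBr cosB /c /s; ring.
have -> : h t = t ^+ N * expR (- t) *
    (1 - tau ^+ 2 / 2 * (t / N%:R + (t / N%:R)^-1 - 2)).
  rewrite /h mul0r cos0 !mulr1.
  case: N N0 nn {n0 c s E i1 i1N i1S i1P h ih} => // N _ nn.
  by rewrite /= !exprS; field; rewrite tn nat1r nn.
rewrite ler_wpM2l ?mulr_ge0 ?expR_ge0 ?exprn_ge0 ?(ltW t0)//.
apply: (le_trans _ (cos_ge _)).
have := @sqr_ln_le (t / N%:R); rewrite divr_gt0// => /(_ isT) hl.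
by rewrite exprMn lerD2l lerN2 mulrAC ler_wpM2l// divr_ge0// sqr_ge0.
Qed.

(** A primitive in [s] of the decreasing function [ln (1 + tau^2 / s^2)]; its increments dominate
    the logarithms of the factors [1 + tau^2 / k^2]. *)
Let Phi tau (s : R) := s * ln (1 + tau ^+ 2 / s ^+ 2) + 2 * tau * atan (s / tau).

Let Phi_step tau k : 0 < tau -> (0 < k)%N ->
  ln (1 + tau ^+ 2 / k.+1%:R ^+ 2) <= Phi tau k.+1%:R - Phi tau k%:R.
Proof.
move=> tau0 k0; have k1 : 0 < k%:R :> R by rewrite ltr0n.
set l := ln _.
have -> : l = l * (k.+1%:R - k%:R) by rewrite -natr1 addrAC subrr add0r mulr1.
rewrite mulrBr.
have kk : k%:R <= k.+1%:R :> R by rewrite ler_nat.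
have h := @dv_nondec R (fun s => Phi tau s - l * s)
  (fun s => ln (1 + tau ^+ 2 / s ^+ 2) - l) _ _ kk.
suff : Phi tau k%:R - l * k%:R <= Phi tau k.+1%:R - l * k.+1%:R by lra.
apply: h => s /andP[ks sk]; have s0 : 0 < s by exact: lt_le_trans ks.
  have sn : s != 0 by rewrite gt_eqF.
  have s2 : s ^+ 2 != 0 by rewrite expf_neq0.
  have tn : tau != 0 by rewrite gt_eqF.
  have p0 : 0 < 1 + tau ^+ 2 / s ^+ 2 by rewrite addr_gt0// divr_gt0 ?exprn_gt0.
  have q0 : s ^+ 2 + tau ^+ 2 != 0 by rewrite gt_eqF// addr_gt0 ?exprn_gt0.
  by rewrite /Phi; dv; field; rewrite sn tn [tau ^+ 2 + _]addrC q0.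
have p0 (r : R) : 0 < r -> 1 + tau ^+ 2 / r ^+ 2 \is Num.pos.
  by move=> r0; rewrite posrE addr_gt0// divr_gt0 ?exprn_gt0.
rewrite subr_ge0 ler_ln ?p0// lerD2l ler_wpM2l ?sqr_ge0//.
by rewrite lef_pV2 ?posrE ?exprn_gt0// lerXn2r// nnegrE ltW.
Qed.

Let Phi_le tau k : 0 < tau -> (0 < k)%N -> Phi tau k%:R <= pi * tau + tau ^+ 2 / k%:R.
Proof.
move=> tau0 k0; have k1 : 0 < k%:R :> R by rewrite ltr0n.
have kn : k%:R != 0 :> R by rewrite gt_eqF.
rewrite /Phi addrC lerD//.
  have t2 : 0 <= 2 * tau by rewrite mulr_ge0// ltW.
  have := ler_wpM2l t2 (ltW (atan_ltpi2 (k%:R / tau))); lra.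
have -> : tau ^+ 2 / k%:R = k%:R * (tau ^+ 2 / k%:R ^+ 2) by field.
rewrite ler_wpM2l ?(ltW k1)// le_ln1Dx// (lt_le_trans (ltrN10 _))//.
by rewrite divr_ge0// sqr_ge0.
Qed.

(** Iterating [gam_sqr_rec] gives [N!^2] times the product of the [1 + tau^2 / j^2]. The factors
    with [j >= 2] telescope by [Phi_step]; the one with [j = 1] is at most [e^(Phi tau 1)], since
    [atan] is nonnegative there. *)
Let gam_sqr_le tau N : 0 < tau -> (0 < N)%N ->
  gam_sqr tau N <= N`!%:R ^+ 2 * expR (Phi tau N%:R) * gam_sqr tau 0.
Proof.
move=> tau0; have g0 k : 0 <= gam_sqr tau k by rewrite addr_ge0// sqr_ge0.
have p0 (r : R) : 0 < r -> 1 + tau ^+ 2 / r ^+ 2 \is Num.pos.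
  by move=> r0; rewrite posrE addr_gt0// divr_gt0 ?exprn_gt0.
elim: N => // -[_ _|N IH _].
  rewrite gam_sqr_rec ler_wpM2r// (_ : 1`! = 1%N)// !expr1n mul1r /Phi !mul1r expr1n divr1.
  rewrite expRD lnK; last by have := p0 _ ltr01; rewrite expr1n divr1.
  rewrite ler_peMr ?addr_ge0 ?sqr_ge0// -expR0 ler_expR.
  rewrite mulr_ge0 ?mulr_ge0 ?(ltW tau0)// -atan0.
  by apply: le_atan; rewrite invr_ge0 ltW.
rewrite gam_sqr_rec.
have step := Phi_step tau0 (ltn0Sn N).
have e : 1 + tau ^+ 2 / N.+2%:R ^+ 2 <= expR (Phi tau N.+2%:R - Phi tau N.+1%:R).
  by rewrite -[leLHS]lnK ?p0// ler_expR.
have -> : N.+2%:R ^+ 2 + tau ^+ 2 = N.+2%:R ^+ 2 * (1 + tau ^+ 2 / N.+2%:R ^+ 2).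
  by field; rewrite gt_eqF.
apply: (@le_trans _ _ (N.+2%:R ^+ 2 * expR (Phi tau N.+2%:R - Phi tau N.+1%:R) *
    (N.+1`!%:R ^+ 2 * expR (Phi tau N.+1%:R) * gam_sqr tau 0))).
  apply: ler_pM => //; last exact: IH.
    by rewrite mulr_ge0 ?sqr_ge0// ltW// -posrE p0.
  by rewrite ler_wpM2l// sqr_ge0.
rewrite [N.+2`!]factS natrM exprMn le_eqVlt; apply/orP; left; apply/eqP.
rewrite expRB; field; by rewrite gt_eqF// expR_gt0.
Qed.

(** For [n > 0], compare at [N = n^2]: the concentration bound makes [|Gamma (N + 1 + i n)|] at
    least [N! / 2], while the product of the factors met in descending to [Gamma (1 + i n)] costs at
    most [N!^2 e^(pi n + 1)] for the square. *)
Lemma gam_sqr_lower n : expR (- (pi * n%:R + 1)) / 4 <= gam_sqr n%:R 0 :> R.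
Proof.
case: n => [|n].
  rewrite /gam_sqr gamC0 fact0 expr1n mulr0 add0r.
  have : expR (- 1) <= 1 :> R by rewrite expR_le1 oppr_le0.
  have := sqr_ge0 (@gamS 0 0); lra.
pose N := (n.+1 ^ 2)%N; have N0 : (0 < N)%N by rewrite expn_gt0.
have nN : N%:R = n.+1%:R ^+ 2 :> R by rewrite natrX.
have n0 : 0 < n.+1%:R :> R by [].
have lo := gam_sqr_ge n.+1%:R N0.
have hi := gam_sqr_le n0 N0.
have ph := Phi_le n0 N0.
rewrite nN in lo hi ph.
have -> : expR (- (pi * n.+1%:R + 1)) / 4 = N`!%:R ^+ 2 / 4 / (N`!%:R ^+ 2 * expR (pi * n.+1%:R + 1)) :> R.
  by rewrite expRN; field; rewrite gt_eqF ?expR_gt0// gt_eqF.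
rewrite ler_pdivrMr ?mulr_gt0 ?exprn_gt0 ?expR_gt0// [leRHS]mulrC.
have e1 : n.+1%:R ^+ 2 / n.+1%:R ^+ 2 = 1 :> R by rewrite mulfV// expf_neq0.
rewrite e1 in ph.
apply: (@le_trans _ _ (gam_sqr n.+1%:R N)); last first.
  apply: (le_trans hi); rewrite ler_wpM2r ?addr_ge0 ?sqr_ge0//.
  by rewrite ler_wpM2l ?sqr_ge0// ler_expR.
have e2 : N`!%:R * (1 - n.+1%:R ^+ 2 / (2 * n.+1%:R ^+ 2)) = N`!%:R / 2 :> R by field.
rewrite e2 in lo.
set c := cos _ in lo; set s := sin _ in lo.
have cs : c ^+ 2 + s ^+ 2 = 1 by exact: cos2Dsin2.
(* Cauchy-Schwarz: the bound concerned the projection of the Gamma value on a unit vector. *)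
have h : (gamC n.+1%:R N * c + gamS n.+1%:R N * s) ^+ 2 <= gam_sqr n.+1%:R N.
  rewrite /gam_sqr -[leRHS]mulr1 -cs -subr_ge0.
  set a := gamC _ _; set b := gamS _ _.
  have -> : (a ^+ 2 + b ^+ 2) * (c ^+ 2 + s ^+ 2) - (a * c + b * s) ^+ 2 =
    (a * s - b * c) ^+ 2 by ring.
  exact: sqr_ge0.
apply: (le_trans _ h).
have -> : N`!%:R ^+ 2 / 4 = (N`!%:R / 2) ^+ 2 :> R by field.
by rewrite ler_sqr ?nnegrE ?divr_ge0// (le_trans _ lo)// divr_ge0.
Qed.

End GammaOneIm.

(** * Recovering [Gamma (1 + i tau)] from [K_(i tau)] near 0 *)

Section GammaLimit.
Variable R : realType.
Local Notation mu := (@lebesgue_measure R).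
Local Notation ray := (`]0, +oo[%classic : set R).
Implicit Types (t s r x y : R).

Section Primitive.
Variables (tau : R) (g : R -> R).
Hypothesis cg : continuous g.
Hypothesis g1 : forall x, `|g x| <= 1.

(** For [g = cos] and [g = sin] its integral is the real and the imaginary part of
    [Gamma (1 + i tau)]. *)
Let f r := expR (- r) * g (tau * ln r).

Let cf r : 0 < r -> {for r, continuous f}.
Proof.
move=> r0; apply: continuousM.
  have d : is_derive r (1 : R) (fun r => expR (- r)) (- expR (- r)) by dv; ring.
  exact: dv_cont d.
apply: (@continuous_comp _ _ _ (fun r => tau * ln r) g); last exact: cg.
have d : is_derive r (1 : R) (fun r => tau * ln r) (tau / r) by dv; ring.
exact: dv_cont d.
Qed.

Let f_le r : `|f r| <= expR (- r).
Proof. by rewrite /f normrM ger0_norm ?expR_ge0// ler_piMr ?expR_ge0. Qed.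

Let if_ : ray_integrable f.
Proof.
apply: (@ray_integrable_le _ _ (fun r => expR (- (1 * r)))).
- by apply: ray_measurable; exact: cf.
- by move=> x _; rewrite mul1r.
- exact: ray_integrable_exp.
Qed.

Let L y := \int[mu]_(r in `]0, y]) f r.

Let sub_ray (i : interval R) : [set` i] `<=` ray ->
  \int[mu]_(r in [set` i]) f r = rayint (f \_ [set` i]).
Proof. by move=> h; rewrite /rayint -Rintegral_mkcondr setIidr. Qed.

Let mpatch (i : interval R) : [set` i] `<=` ray -> measurable_fun ray (f \_ [set` i]).
Proof.
move=> h; apply/measurable_restrict => //.
by apply: measurable_funS (ray_integrable_meas if_) => // x [].
Qed.

Let L_sub y : [set` `]0, y]] `<=` ray.
Proof. by move=> x; rewrite /= !in_itv/= andbT => /andP[]. Qed.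

Let T_sub y : 0 < y -> [set` `]y, +oo[] `<=` ray.
Proof. by move=> y0 x; rewrite /= !in_itv/= !andbT; exact: lt_trans. Qed.

(** On []0, u]] the integrand is at most [e^(1 - r / u)], whose integral over the half-line is
    [e u]. *)
Let L_le u : 0 < u -> `|L u| <= expR 1 * u.
Proof.
move=> u0; rewrite /L sub_ray; last exact: L_sub.
have u'0 : 0 < u^-1 by rewrite invr_gt0.
have -> : expR 1 * u = rayint (fun r => expR 1 * expR (- (u^-1 * r))).
  by rewrite rayintZ ?rayint_exp ?invrK//; exact: ray_integrable_exp.
apply: rayint_norm_le.
- by apply: mpatch; exact: L_sub.
- by apply: ray_integrableZ; exact: ray_integrable_exp.
- move=> x x0; rewrite patchE; case: ifPn => [|_]; last first.
    by rewrite normr0 mulr_ge0 ?expR_ge0.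
  rewrite inE /= in_itv/= => /andP[_ xu].
  rewrite (le_trans (f_le _))// -expRD ler_expR.
  have : u^-1 * x <= 1 by rewrite ler_pdivrMl// mulr1.
  by lra.
Qed.

(** Beyond [s] one has [1 <= r / s], and [r e^-r] has integral 1. *)
Let L_tail s : 0 < s -> `|L s - rayint f| <= 1 / s.
Proof.
move=> s0; rewrite distrC /L /rayint Rintegral_itvB//; last first.
  by rewrite bnd_simp// ltW.
rewrite sub_ray; last exact: T_sub.
have -> : 1 / s = rayint (fun r => s^-1 * (r ^+ 1 * expR (- r) * cos (0 * ln r))).
  by rewrite (rayintZ _ (gamC_integrable 0 1)) -/(gamC 0 1) gamC0 mulrC.
apply: rayint_norm_le.
- by apply: mpatch; exact: T_sub.
- by apply: ray_integrableZ; exact: gamC_integrable.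
- move=> x x0; rewrite mul0r cos0 mulr1 expr1 patchE; case: ifPn => [|_]; last first.
    by rewrite normr0 !mulr_ge0 ?expR_ge0 ?invr_ge0// ltW.
  rewrite inE /= in_itv/= andbT => sx.
  rewrite (le_trans (f_le _))// mulrA ler_peMl ?expR_ge0//.
  by rewrite ler_pdivlMl// mulr1 ltW.
Qed.

Let dL y : 0 < y -> is_derive y (1 : R) L (f y).
Proof.
move=> y0.
have i1 : mu.-integrable [set` Interval (BRight 0) (BRight (y + 1))] (EFin \o f).
  by apply: integrableS if_ => //; exact: L_sub.
have y1 : y < y + 1 by rewrite ltrDl.
have y00 : (BRight 0 < BRight y)%O by rewrite bnd_simp.
have [d1 d2] := @continuous_FTC1 R f (BRight 0) y (y + 1) y1 i1 y00 (cf y0).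
by apply: DeriveDef; [exact: d1 | rewrite -derive1E; exact: d2].
Qed.

Variables (a u : R).
Hypothesis u0 : 0 < u.
Hypothesis a_u : a = tau * ln u.

Let z := 2 * u.

(* [s e^-s g(tau ln s)] with [s = u e^t], the derivative of [L (u e^t)]. *)
Let A t := u * expR t * expR (- (u * expR t)) * g (a + tau * t).
(** The integrand met on the Bessel side. As [z cosh t = u e^t + u e^-t], it differs from [A] by a
    factor [e^(- u e^-t)] close to 1 and by a term of size [u e^-t]. *)
Let Q t := u * expR (- (z * coshR t)) *
  (expR t * g (a + tau * t) + expR (- t) * g (a - tau * t)).

Let z_cosh t : z * coshR t = u * expR t + u * expR (- t).
Proof. by rewrite /z /coshR; field. Qed.

Let gcomp b t : {for t, continuous (fun t => g (a + b * t))}.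
Proof.
apply: (@continuous_comp _ _ _ (fun t => a + b * t) g); last exact: cg.
have d : is_derive t (1 : R) (fun t => a + b * t) b by dv; ring.
exact: dv_cont d.
Qed.

Let cA t : {for t, continuous A}.
Proof.
apply: continuousM; last exact: gcomp.
have d : is_derive t (1 : R) (fun t => u * expR t * expR (- (u * expR t)))
  (u * expR t * expR (- (u * expR t)) * (1 - u * expR t)) by dv; ring.
exact: dv_cont d.
Qed.

Let cQ t : {for t, continuous Q}.
Proof.
apply: continuousM.
  have d : is_derive t (1 : R) (fun t => u * expR (- (z * coshR t)))
    (- (u * z * sinhR t * expR (- (z * coshR t)))) by dv; ring.
  exact: dv_cont d.
have de : is_derive t (1 : R) (fun t => expR t) (expR t) by dv; ring.
have deN : is_derive t (1 : R) (fun t => expR (- t)) (- expR (- t)) by dv; ring.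
apply: continuousD; apply: continuousM; try exact: dv_cont de; try exact: dv_cont deN.
  exact: gcomp.
apply: (@continuous_comp _ _ _ (fun t => a - tau * t) g); last exact: cg.
have d : is_derive t (1 : R) (fun t => a - tau * t) (- tau) by dv; ring.
exact: dv_cont d.
Qed.

Let A_le t : `|A t| <= 2 / u * expR (- t).
Proof.
have s0 : 0 < u * expR t by rewrite mulr_gt0// expR_gt0.
rewrite /A normrM (@le_trans _ _ (u * expR t * expR (- (u * expR t))))//.
  rewrite ger0_norm ?ler_piMr// ?mulr_ge0 ?expR_ge0// ltW//.
have := @pow_expN_le R 2 _ (ltW s0); rewrite -[leRHS]/(2%:R) => h.
have -> : 2 / u * expR (- t) = 2 / (u * expR t) by rewrite expRN invfM mulrA.
by rewrite ler_pdivlMr// mulrAC -expr2.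
Qed.

Let iA : ray_integrable A.
Proof. by apply: (@ray_dom_integrable _ _ (2 / u)) => t _; [exact: cA|exact: A_le]. Qed.

Let dA t : is_derive t (1 : R) (fun t => L (u * expR t)) (A t).
Proof.
have s0 : 0 < u * expR t by rewrite mulr_gt0// expR_gt0.
have h := dL; dv; rewrite /A /f.
have -> : tau * ln (u * expR t) = a + tau * t.
  by rewrite lnM ?posrE ?expR_gt0// expRK mulrDr -a_u.
ring.
Qed.

Let rayint_A : rayint A = rayint f - L u.
Proof.
apply: (@rayint_FTC R A (fun t => L (u * expR t)) (L u) (rayint f)
  (fun t _ => @cA t) (fun t _ => @dA t) iA).
  have := dv_cont (dA 0); move=> /cvg_at_right_filter.
  by rewrite /= expR0 mulr1.
apply: (@cvg_aty_le _ _ _ (1 / u)) => t t1.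
have t0 : 0 < t by exact: lt_trans t1.
have s0 : 0 < u * expR t by rewrite mulr_gt0// expR_gt0.
apply: (le_trans (L_tail s0)).
rewrite invfM mulrA ler_wpM2l ?divr_ge0 ?(ltW u0)//.
rewrite lef_pV2 ?posrE ?expR_gt0//.
by rewrite (le_trans _ (expR_ge1Dx t))// lerDr.
Qed.

Let QA_le t : 0 < t -> `|Q t - A t| <= 2 * u * expR (- t).
Proof.
move=> t0; set s := u * expR t; set r := u * expR (- t).
have s0 : 0 < s by rewrite mulr_gt0// expR_gt0.
have r0 : 0 < r by rewrite mulr_gt0// expR_gt0.
have -> : Q t - A t = (s * expR (- s)) * (expR (- r) - 1) * g (a + tau * t) +
    r * (expR (- (s + r)) * g (a - tau * t)).
  by rewrite /Q /A z_cosh -/s -/r opprD expRD /s /r; ring.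
have -> : 2 * u * expR (- t) = r + r by rewrite /r; ring.
apply: (le_trans (ler_normD _ _)); apply: lerD.
  rewrite normrM (le_trans (ler_wpM2l (normr_ge0 _) (g1 _)))// mulr1 normrM.
  have s1 : `|s * expR (- s)| <= 1.
    have sp : 0 <= s * expR (- s) by apply: mulr_ge0; [exact: ltW|exact: expR_ge0].
    rewrite (ger0_norm sp).
    by have := @pow_expN_le R 1 _ (ltW s0); rewrite expr1.
  have e1 : `|expR (- r) - 1| <= r.
    have := expR_ge1Dx (- r); have : expR (- r) <= 1 by rewrite expR_le1 oppr_le0 ltW.
    by move=> h1 h2; rewrite ler_norml; apply/andP; split; lra.
  by rewrite (le_trans (ler_pM (normr_ge0 _) (normr_ge0 _) s1 e1))// mul1r.
rewrite normrM (gtr0_norm r0) ler_piMr ?(ltW r0)// normrM mulr_ile1//.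
rewrite ger0_norm ?expR_ge0// expR_le1 oppr_le0 addr_ge0// ltW//.
Qed.

(** The error has two sources: [2 u] from [Q - A], and [e u] from the piece []0, u]] of the Gamma
    integral that [s = u e^t] with [t > 0] does not reach. *)
Lemma gamma_approx : `|rayint Q - rayint f| <= (2 + expR 1) * u.
Proof.
have cD t : 0 < t -> {for t, continuous (fun t => Q t - A t)}.
  by move=> _; apply: continuousB; [exact: cQ|exact: cA].
have iD := ray_dom_integrable cD QA_le.
have iQ : ray_integrable Q.
  by apply: (ray_integrable_eq _ (ray_integrableD iD iA)) => t _; rewrite subrK.
have -> : rayint Q - rayint f = rayint (fun t => Q t - A t) - L u.
  by rewrite rayintB// rayint_A; ring.
rewrite mulrDl (le_trans (ler_normB _ _))// lerD//; last exact: L_le.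
exact: ray_dom_norm.
Qed.

End Primitive.

(* [K_(i tau) (2 sqrt (2 x))] and its image under [x d/dx]. *)
Definition besK tau x := NX (fun q => expR (- q)) tau x.
Definition besK1 tau x := NX (fun q => q * - expR (- q)) tau x / 2.

Lemma rapid_expN : rapid (fun q : R => expR (- q)).
Proof. by apply: (@rapid_exp _ _ 1) => q _; rewrite mul1r ger0_norm// expR_ge0. Qed.

Lemma rapid_NexpN : rapid (fun q : R => - expR (- q)).
Proof. by apply: (@rapid_exp _ _ 1) => q _; rewrite mul1r normrN ger0_norm// expR_ge0. Qed.

Lemma expN_dv (q : R) : is_derive q (1 : R) (fun q => expR (- q)) (- expR (- q)).
Proof. by dv; ring. Qed.

Lemma NexpN_dv (q : R) : is_derive q (1 : R) (fun q => - expR (- q)) (expR (- q)).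
Proof. by dv; ring. Qed.

Lemma poscont_expN : poscont (fun q : R => expR (- q)).
Proof. by move=> q _; exact: dv_cont (expN_dv q). Qed.

Lemma poscont_NexpN : poscont (fun q : R => - expR (- q)).
Proof. by move=> q _; exact: dv_cont (NexpN_dv q). Qed.

Lemma besK_dv tau x : 0 < x -> is_derive x (1 : R) (besK tau) (besK1 tau x / x).
Proof.
by move=> x0; exact: (NX_dv tau expN_dv poscont_NexpN rapid_expN rapid_NexpN x0).
Qed.

Lemma besK1_dv tau x : 0 < x ->
  is_derive x (1 : R) (besK1 tau) ((2 * x - tau ^+ 2 / 4) * besK tau x / x).
Proof.
move=> x0; have d := NX_dv1 tau expN_dv NexpN_dv poscont_expN rapid_expN
  rapid_NexpN rapid_expN x0.
by rewrite /besK1; apply: dv_eq d _; rewrite /besK; field; rewrite gt_eqF.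
Qed.

Lemma besK_le : exists2 C : R, 0 <= C & forall tau x, 0 < x ->
  `|besK tau x| * (Num.sqrt x * (1 + x) ^+ 3) <= C /\
  `|besK1 tau x| * (Num.sqrt x * (1 + x) ^+ 3) <= C.
Proof.
have [C C0 HC] := NX_le poscont_expN rapid_expN.
have [D D0 HD] := NX_le (poscont_mulX poscont_NexpN) (rapid_mulX rapid_NexpN).
exists (C + D); first by rewrite addr_ge0.
move=> tau x x0; split; first by rewrite (le_trans (HC tau x x0))// lerDl.
apply: (@le_trans _ _ D); last by rewrite lerDr.
apply: (le_trans _ (HD tau x x0)); rewrite /besK1 normrM [`|2^-1|]ger0_norm//.
rewrite ler_wpM2r ?mulr_ge0 ?sqrtr_ge0 ?exprn_ge0 ?addr_ge0 ?(ltW x0)//.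
by rewrite ler_piMr// invf_le1//; lra.
Qed.

Lemma sinh_kernel_integrable tau z : 0 < z ->
  ray_integrable (fun t => z * sinhR t * expR (- (z * coshR t)) * sin (tau * t)).
Proof.
move=> z0; have [C HC] := rapid_mulX rapid_expN 0%N.
apply: (@ray_dom_integrable _ _ (2 * C / z ^+ 1)) => t t0.
  have d : is_derive t (1 : R)
    (fun t => z * sinhR t * expR (- (z * coshR t)) * sin (tau * t))
    (z * coshR t * expR (- (z * coshR t)) * sin (tau * t)
    - (z * sinhR t) ^+ 2 * expR (- (z * coshR t)) * sin (tau * t)
    + z * sinhR t * expR (- (z * coshR t)) * (tau * cos (tau * t))) by dv; ring.
  exact: dv_cont d.
apply: (le_trans _ (@kernel_le _ _ _ 0 0 z t z0 HC)).
have s0 : 0 <= sinhR t by rewrite sinhR_ge0// ltW.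
have sc := ltW (sinhR_lt_coshR t); have c0 := coshR_gt0 t.
rewrite mul0r cos0 mulr1 normrM.
rewrite (le_trans (ler_wpM2l (normr_ge0 _) (norm_sin_le1 _)))// mulr1.
have n1 := mulr_ge0 (mulr_ge0 (ltW z0) s0) (expR_ge0 (- (z * coshR t))).
have n2 := mulr_ge0 (mulr_ge0 (ltW z0) (ltW c0)) (expR_ge0 (- (z * coshR t))).
rewrite (ger0_norm n1) (ger0_norm n2).
by rewrite ler_wpM2r ?expR_ge0// ler_wpM2l// ltW.
Qed.

(** Integration by parts produces the [sinh] companion of the [cosh] integral for [besK1]; together
    the two can form [e^t] and [e^-t]. *)
Lemma besK_parts tau x : 0 < x -> tau * besK tau x =
  rayint (fun t => Num.sqrt (8 * x) * sinhR t *
    expR (- (Num.sqrt (8 * x) * coshR t)) * sin (tau * t)).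
Proof.
move=> x0; have z0 := sqrt8_gt0 x0; rewrite /besK /NX.
set z := Num.sqrt _ in z0 *.
pose p t := z * sinhR t * expR (- (z * coshR t)) * sin (tau * t).
pose k t := expR (- (z * coshR t)) * cos (tau * t).
have ik : ray_integrable k := Nint_integrable tau poscont_expN rapid_expN z0.
have ip : ray_integrable p := sinh_kernel_integrable tau z0.
pose T t := expR (- (z * coshR t)) * sin (tau * t).
pose T' t := tau * k t - p t.
have dT t : is_derive t (1 : R) T (T' t) by rewrite /T /T' /k /p; dv; ring.
have itk := ray_integrableZ tau ik.
have cT' t : 0 < t -> {for t, continuous T'}.
  move=> _; have d : is_derive t (1 : R) T' (- tau ^+ 2 * T t -
      z * sinhR t * expR (- (z * coshR t)) * tau * cos (tau * t) -
      (z * coshR t * expR (- (z * coshR t)) * sin (tau * t)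
       - (z * sinhR t) ^+ 2 * expR (- (z * coshR t)) * sin (tau * t)
       + z * sinhR t * expR (- (z * coshR t)) * (tau * cos (tau * t)))).
    by rewrite /T' /T /k /p; dv; ring.
  exact: dv_cont d.
have h0 : T t @[t --> 0^'+] --> (0 : R).
  have := dv_cont (dT 0); move=> /cvg_at_right_filter.
  by have -> // : T 0 = 0; rewrite /T mulr0 sin0 mulr0.
have hy : T t @[t --> +oo] --> (0 : R).
  apply: (@cvg_aty_le _ _ _ z^-1) => t t1.
  have t0 : 0 < t by exact: lt_trans t1.
  rewrite subr0 /T normrM (le_trans (ler_wpM2l (normr_ge0 _) (norm_sin_le1 _)))// mulr1.
  rewrite ger0_norm ?expR_ge0// (le_trans _ (expN_le_inv z0 t0))// ler_expR lerN2.
  rewrite ler_wpM2l ?(ltW z0)// (le_trans (sinhR_ge (ltW t0)))//.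
  exact: ltW (sinhR_lt_coshR t).
have := rayint_FTC cT' (fun t _ => dT t) (ray_integrableB itk ip) h0 hy.
by rewrite subrr (rayintB itk ip) (rayintZ _ ik) => /subr0_eq.
Qed.

Let main_approx tau x (g : R -> R) : 0 < x -> continuous g -> (forall x, `|g x| <= 1) ->
  `|rayint (fun t => Num.sqrt (2 * x) * expR (- (Num.sqrt (8 * x) * coshR t)) *
     (expR t * g (tau / 2 * ln (2 * x) + tau * t) +
      expR (- t) * g (tau / 2 * ln (2 * x) - tau * t))) -
   rayint (fun r => expR (- r) * g (tau * ln r))| <= (2 + expR 1) * (2 * Num.sqrt x).
Proof.
move=> x0 cg g1.
have x2 : 0 < 2 * x by rewrite mulr_gt0.
have u0 : 0 < Num.sqrt (2 * x) by rewrite sqrtr_gt0.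
have a_u : tau / 2 * ln (2 * x) = tau * ln (Num.sqrt (2 * x)).
  have {1}-> : 2 * x = Num.sqrt (2 * x) ^+ 2 by rewrite sqr_sqrtr// ltW.
  by rewrite lnXn// -mulr_natl; field.
have z2 : Num.sqrt (8 * x) = 2 * Num.sqrt (2 * x).
  have -> : 8 * x = 2 ^+ 2 * (2 * x) by ring.
  by rewrite sqrtrM ?sqr_ge0// sqrtr_sqr ger0_norm.
rewrite z2; apply: (le_trans (gamma_approx cg g1 u0 a_u)).
rewrite ler_wpM2l// sqrtrM// ler_wpM2r ?sqrtr_ge0//.
have : Num.sqrt 2 <= Num.sqrt (2 ^+ 2) :> R by apply: ler_wsqrtr; rewrite expr2; lra.
by rewrite sqrtr_sqr ger0_norm.
Qed.

Let two_sqrt x : 0 < x -> Num.sqrt (8 * x) = 2 * Num.sqrt (2 * x).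
Proof.
move=> x0; have -> : 8 * x = 2 ^+ 2 * (2 * x) by ring.
by rewrite sqrtrM ?sqr_ge0// sqrtr_sqr ger0_norm.
Qed.

Let besK1_rayint tau x : 0 < x -> - (2 * besK1 tau x) =
  rayint (fun t => Num.sqrt (8 * x) * coshR t * expR (- (Num.sqrt (8 * x) * coshR t)) *
    cos (tau * t)).
Proof.
move=> x0; have z0 := sqrt8_gt0 x0.
have ik := Nint_integrable tau (poscont_mulX poscont_NexpN) (rapid_mulX rapid_NexpN) z0.
have -> : - (2 * besK1 tau x) = - 1 * NX (fun q => q * - expR (- q)) tau x.
  by rewrite /besK1; field.
by rewrite /NX /Nint -(rayintZ _ ik); apply: rayint_eq => t _; ring.
Qed.

Let icosh tau x : 0 < x -> ray_integrable (fun t => Num.sqrt (8 * x) * coshR t *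
  expR (- (Num.sqrt (8 * x) * coshR t)) * cos (tau * t)).
Proof.
move=> x0; exact: (Nint_integrable tau (poscont_mulX poscont_expN)
  (rapid_mulX rapid_expN) (sqrt8_gt0 x0)).
Qed.

(** With [a = (tau / 2) ln (2 x)], the integrands combine by [2 cosh t cos a cos (tau t) - 2 sinh t
    sin a sin (tau t) = e^t cos (a + tau t) + e^-t cos (a - tau t)], the form of [Q]. [besK_gammaS]
    is the same with [sin]. *)
Lemma besK_gammaC tau x : 0 < x ->
  `|cos (tau / 2 * ln (2 * x)) * - (2 * besK1 tau x) -
    sin (tau / 2 * ln (2 * x)) * (tau * besK tau x) - gamC tau 0| <=
  (2 + expR 1) * (2 * Num.sqrt x).
Proof.
move=> x0; have := @main_approx tau x cos x0 (@continuous_cos R) (@norm_cos_le1 R).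
have -> : rayint (fun r => expR (- r) * cos (tau * ln r)) = gamC tau 0.
  by apply: rayint_eq => t _; rewrite expr0 mul1r.
apply: le_trans; apply: eq_le_r; congr `|_ - _|.
have ic := icosh tau x0; have is_ := sinh_kernel_integrable tau (sqrt8_gt0 x0).
rewrite (besK1_rayint tau x0) (besK_parts tau x0) -(rayintZ _ ic) -(rayintZ _ is_).
rewrite -(rayintB (ray_integrableZ _ ic) (ray_integrableZ _ is_)).
by apply: rayint_eq => t _; rewrite cosD cosB (two_sqrt x0) /coshR /sinhR; field.
Qed.

Lemma besK_gammaS tau x : 0 < x ->
  `|sin (tau / 2 * ln (2 * x)) * - (2 * besK1 tau x) +
    cos (tau / 2 * ln (2 * x)) * (tau * besK tau x) - gamS tau 0| <=
  (2 + expR 1) * (2 * Num.sqrt x).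
Proof.
move=> x0; have := @main_approx tau x sin x0 (@continuous_sin R) (@norm_sin_le1 R).
have -> : rayint (fun r => expR (- r) * sin (tau * ln r)) = gamS tau 0.
  by apply: rayint_eq => t _; rewrite expr0 mul1r.
apply: le_trans; apply: eq_le_r; congr `|_ - _|.
have ic := icosh tau x0; have is_ := sinh_kernel_integrable tau (sqrt8_gt0 x0).
rewrite (besK1_rayint tau x0) (besK_parts tau x0) -(rayintZ _ ic) -(rayintZ _ is_).
rewrite -(rayintD (ray_integrableZ _ ic) (ray_integrableZ _ is_)).
by apply: rayint_eq => t _; rewrite sinD sinB (two_sqrt x0) /coshR /sinhR; field.
Qed.

End GammaLimit.

(** * The function [J_(i tau)] *)

Section FactorialSeries.
Variable R : realType.
Implicit Types (c d : nat -> R) (w : R).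

(** A condition stable under termwise differentiation, with the exponential series as majorant at
    every point. *)
Definition fact_bounded c := forall k, `|c k| <= k`!%:R^-1.

Definition psum c w := limn (pseries c w).

Lemma psum_cvg c w : fact_bounded c -> cvgn (pseries c w).
Proof.
move=> cb; apply: normed_cvg.
apply: (@series_le_cvg _ _ (exp_coeff `|w|)).
- by move=> k; exact: normr_ge0.
- by move=> k; apply: exp_coeff_ge0.
- by move=> k; rewrite /= normrM normrX exp_coeffE ler_wpM2r ?exprn_ge0.
- exact: is_cvg_series_exp_coeff.
Qed.

Lemma fact_bounded_diffs c : fact_bounded c -> fact_bounded (pseries_diffs c).
Proof.
move=> cb k; rewrite /pseries_diffs normrM ger0_norm//.
apply: (le_trans (ler_wpM2l _ (cb k.+1))) => //.
by rewrite factS natrM invfM mulrA mulfV// mul1r.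
Qed.

Lemma psum_dv c w : fact_bounded c ->
  is_derive w (1 : R) (psum c) (psum (pseries_diffs c) w).
Proof.
move=> cb; apply: (@pseries_snd_diffs R c (`|w| + 1)); try exact: psum_cvg.
- exact/psum_cvg/fact_bounded_diffs.
- exact/psum_cvg/fact_bounded_diffs/fact_bounded_diffs.
- by rewrite [ltRHS]ger0_norm ?addr_ge0// ltrDl.
Qed.

Lemma psum_le c w : fact_bounded c -> `|psum c w| <= expR `|w|.
Proof.
move=> cb; have cv := @psum_cvg c w cb.
have h n : `|pseries c w n| <= expR `|w|.
  apply: (@le_trans _ _ (series (exp_coeff `|w|) n)).
    rewrite /pseries /series /= (le_trans (ler_norm_sum _ _ _))//.
    apply: ler_sum => k _.
    by rewrite normrM normrX exp_coeffE ler_wpM2r ?exprn_ge0.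
  rewrite /expR; apply: nondecreasing_cvgn_le; last exact: is_cvg_series_exp_coeff.
  by apply: nondecreasing_series => k _ _; apply: exp_coeff_ge0.
have cn : `|pseries c w n| @[n --> \oo] --> `|psum c w| by apply: cvg_norm.
by apply: (cvgr_to_le cn); exact: nearW.
Qed.

Lemma psum0 c : psum c 0 = c 0%N.
Proof.
rewrite /psum; apply: cvg_lim => //.
rewrite -(cvg_shiftS (pseries c 0)); apply: cvg_near_cst; apply: nearW => n.
rewrite /pseries /series /= big_nat_recl// expr0 mulr1 big1 ?addr0// => i _.
by rewrite expr0n mulr0.
Qed.

Lemma psum_shift c w : fact_bounded c -> fact_bounded (fun k => k%:R * c k) ->
  w * psum (pseries_diffs c) w = psum (fun k => k%:R * c k) w.
Proof.
move=> cb cb1; apply/esym/cvg_lim => //.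
rewrite -(cvg_shiftS (pseries _ w)).
have -> : (fun n => pseries (fun k => k%:R * c k) w n.+1) =
    (fun n => w * pseries (pseries_diffs c) w n).
  apply/funext => n; rewrite /pseries /series /= big_nat_recl// !mul0r add0r.
  rewrite mulr_sumr; apply: eq_bigr => k _.
  by rewrite /pseries_diffs exprS; ring.
apply: cvgMr; exact/psum_cvg/fact_bounded_diffs.
Qed.

Lemma psum_comb c d e p q r w : fact_bounded c -> fact_bounded d -> fact_bounded e ->
  (forall k, p * c k + q * d k + r * e k = 0) ->
  p * psum c w + q * psum d w + r * psum e w = 0.
Proof.
move=> cb db eb h.
have cv : p * pseries c w n + q * pseries d w n + r * pseries e w n @[n --> \oo] -->
    p * psum c w + q * psum d w + r * psum e w.
  by apply: cvgD; [apply: cvgD|]; apply: cvgMr; exact: psum_cvg.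
rewrite -(cvg_lim _ cv)//; apply: cvg_lim => //.
apply: cvg_near_cst; apply: nearW => n.
rewrite /pseries /series /= !mulr_sumr -!big_split /=.
by rewrite big1// => k _; rewrite !mulrA -!mulrDl h mul0r.
Qed.

End FactorialSeries.

(** * The power series of [J_(i tau)], its energy, and the boundary values at 0 *)

Section BesselJReal.
Variable R : realType.
Implicit Types (x w : R).

Section FixedOrder.
Variable tau : R.

(* Real and imaginary part of [(-1)^k / (k! (1 + i tau) ... (k + i tau))]. *)
Fixpoint jcoef (k : nat) : R * R :=
  if k is k'.+1 then
    let m := k'.+1%:R in
    let d := m * (m ^+ 2 + tau ^+ 2) in
    (- (m * (jcoef k').1 + tau * (jcoef k').2) / d,
     - (m * (jcoef k').2 - tau * (jcoef k').1) / d)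
  else (1, 0).

Definition jre k := (jcoef k).1.
Definition jim k := (jcoef k).2.

Let m2 k : k.+1%:R ^+ 2 + tau ^+ 2 != 0.
Proof. by rewrite gt_eqF// ltr_wpDr ?sqr_ge0// exprn_gt0. Qed.

Let mn k : 1 + k%:R != 0 :> R.
Proof. by rewrite nat1r. Qed.

Let m2' k : (1 + k%:R) ^+ 2 + tau ^+ 2 != 0.
Proof. by rewrite nat1r m2. Qed.

(** With [jim_rec], these are the two parts of [(k + 1 + i tau) alpha_(k+1) = - alpha_k / (k +
    1)]. *)
Lemma jre_rec k : k.+1%:R * jre k.+1 - tau * jim k.+1 = - jre k / k.+1%:R.
Proof. by rewrite /jre /jim /=; field; rewrite mn m2'. Qed.

Lemma jim_rec k : k.+1%:R * jim k.+1 + tau * jre k.+1 = - jim k / k.+1%:R.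
Proof. by rewrite /jre /jim /=; field; rewrite mn m2'. Qed.

(** The coefficients are at most [1 / k!^2] in modulus. One [1 / k!] gives [fact_bounded]; the other
    pays for the factor [k] that [w d/dw] brings. *)
Let jsqr_le k : jre k ^+ 2 + jim k ^+ 2 <= (k`!%:R^-1) ^+ 4.
Proof.
elim: k => [|k IH]; first by rewrite /jre /jim /= fact0 expr0n addr0 invr1 !expr1n.
have -> : jre k.+1 ^+ 2 + jim k.+1 ^+ 2 = (jre k ^+ 2 + jim k ^+ 2) *
    ((k.+1%:R ^+ 2 * (k.+1%:R ^+ 2 + tau ^+ 2))^-1).
  by rewrite /jre /jim /=; field; rewrite mn m2'.
rewrite factS natrM [in leRHS]invfM [leRHS]exprMn [leLHS]mulrC ler_pM ?addr_ge0 ?sqr_ge0//.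
  by rewrite invr_ge0 mulr_ge0 ?addr_ge0 ?sqr_ge0.
rewrite exprVn lef_pV2 ?posrE ?mulr_gt0 ?exprn_gt0//; last first.
  by rewrite ltr_wpDr ?sqr_ge0// exprn_gt0.
by rewrite (exprM _ 2 2) [in leLHS]expr2 ler_wpM2l ?sqr_ge0// lerDl sqr_ge0.
Qed.

Let le_fact2 (a b : R) k : a ^+ 2 + b ^+ 2 <= (k`!%:R^-1) ^+ 4 ->
  `|a| <= (k`!%:R^-1) ^+ 2 /\ `|b| <= (k`!%:R^-1) ^+ 2.
Proof.
rewrite (exprM _ 2 2) => h.
have := sqr_ge0 a; have := sqr_ge0 b => b0 a0.
split; rewrite -ler_sqr ?nnegrE// real_normK ?num_real//; lra.
Qed.

Let ifact_le1 k : k`!%:R^-1 <= 1 :> R.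
Proof. by rewrite invf_le1 ?ler1n ?ltr0n ?fact_gt0. Qed.

Let fb0 (c : nat -> R) : (forall k, `|c k| <= (k`!%:R^-1) ^+ 2) -> fact_bounded c.
Proof.
move=> h k; rewrite (le_trans (h k))// expr2 ler_piMr// invr_ge0//.
Qed.

Let fb1 (c : nat -> R) : (forall k, `|c k| <= (k`!%:R^-1) ^+ 2) ->
  fact_bounded (fun k => k%:R * c k).
Proof.
move=> h k; have f0 : 0 < k`!%:R :> R by rewrite ltr0n fact_gt0.
rewrite normrM ger0_norm// (le_trans (ler_wpM2l _ (h k)))//.
rewrite expr2 mulrA ler_piMl ?invr_ge0 ?(ltW f0)// ler_pdivrMr// mul1r ler_nat.
exact: fact_geq.
Qed.

Let bre k : `|jre k| <= (k`!%:R^-1) ^+ 2. Proof. by have [] := le_fact2 (jsqr_le k). Qed.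
Let bim k : `|jim k| <= (k`!%:R^-1) ^+ 2. Proof. by have [] := le_fact2 (jsqr_le k). Qed.

Lemma jre_bounded : fact_bounded jre. Proof. exact: fb0. Qed.
Lemma jim_bounded : fact_bounded jim. Proof. exact: fb0. Qed.

Let jre1_bounded := fb1 bre.
Let jim1_bounded := fb1 bim.

(* [jU + i jV] is the power series with coefficients [jcoef], and [jDU + i jDV] is its
   image under [w d/dw]. *)
Definition jU := psum jre.
Definition jV := psum jim.
Definition jDU := psum (fun k => k%:R * jre k).
Definition jDV := psum (fun k => k%:R * jim k).

Lemma jU_dv w : 0 < w -> is_derive w (1 : R) jU (jDU w / w).
Proof.
move=> w0; apply: dv_eq (psum_dv w jre_bounded) _.
by rewrite /jDU -(psum_shift _ jre_bounded jre1_bounded) mulrC mulKf// gt_eqF.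
Qed.

Lemma jV_dv w : 0 < w -> is_derive w (1 : R) jV (jDV w / w).
Proof.
move=> w0; apply: dv_eq (psum_dv w jim_bounded) _.
by rewrite /jDV -(psum_shift _ jim_bounded jim1_bounded) mulrC mulKf// gt_eqF.
Qed.

(** For [D = w d/dw] and [Y = jU + i jV] the recursion reads [D (D + i tau) Y = - w Y]; this is its
    real part, and [jDV_dv] its imaginary part. *)
Lemma jDU_dv w : 0 < w -> is_derive w (1 : R) jDU ((tau * jDV w - w * jU w) / w).
Proof.
move=> w0; have wn : w != 0 by rewrite gt_eqF.
apply: dv_eq (psum_dv w jre1_bounded) _.
have := @psum_comb R (pseries_diffs (fun k => k%:R * jre k)) (pseries_diffs jim) jre
  1 (- tau) 1 w (fact_bounded_diffs jre1_bounded) (fact_bounded_diffs jim_bounded)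
  jre_bounded.
rewrite /jDV -(psum_shift _ jim_bounded jim1_bounded) -/jU => h.
have -> : (tau * (w * psum (pseries_diffs jim) w) - w * jU w) / w =
  tau * psum (pseries_diffs jim) w - jU w by field.
apply/eqP; rewrite -subr_eq0; apply/eqP; rewrite -[RHS]h; first by ring.
move=> k; rewrite /pseries_diffs.
have -> : 1 * (k.+1%:R * (k.+1%:R * jre k.+1)) + - tau * (k.+1%:R * jim k.+1) + 1 * jre k
  = k.+1%:R * (k.+1%:R * jre k.+1 - tau * jim k.+1) + jre k by ring.
by rewrite jre_rec; field; rewrite mn.
Qed.

Lemma jDV_dv w : 0 < w -> is_derive w (1 : R) jDV ((- tau * jDU w - w * jV w) / w).
Proof.
move=> w0; have wn : w != 0 by rewrite gt_eqF.
apply: dv_eq (psum_dv w jim1_bounded) _.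
have := @psum_comb R (pseries_diffs (fun k => k%:R * jim k)) (pseries_diffs jre) jim
  1 tau 1 w (fact_bounded_diffs jim1_bounded) (fact_bounded_diffs jre_bounded)
  jim_bounded.
rewrite /jDU -(psum_shift _ jre_bounded jre1_bounded) -/jV => h.
have -> : (- tau * (w * psum (pseries_diffs jre) w) - w * jV w) / w =
  - (tau * psum (pseries_diffs jre) w) - jV w by field.
apply/eqP; rewrite -subr_eq0; apply/eqP.
rewrite -[RHS]h; first by ring.
move=> k; rewrite /pseries_diffs.
have -> : 1 * (k.+1%:R * (k.+1%:R * jim k.+1)) + tau * (k.+1%:R * jre k.+1) + 1 * jim k
  = k.+1%:R * (k.+1%:R * jim k.+1 + tau * jre k.+1) + jim k by ring.
by rewrite jim_rec; field; rewrite mn.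
Qed.

Let psum_near (c : nat -> R) w : fact_bounded c -> 0 <= w <= 2 ->
  `|psum c w - c 0%N| <= expR 2 * w.
Proof.
move=> cb /andP[w0 w2]; rewrite -psum0.
have := @dv_le R (psum c) (psum (pseries_diffs c)) 0 w (expR 2) w0.
rewrite subr0; apply => [x _|x /andP[x0 xw]]; first exact: psum_dv.
rewrite (le_trans (psum_le _ (fact_bounded_diffs cb)))// ler_expR ger0_norm//.
exact: le_trans w2.
Qed.

Lemma j_near0 w : 0 <= w <= 2 ->
  [/\ `|jU w - 1| <= expR 2 * w, `|jV w| <= expR 2 * w,
      `|jDU w| <= expR 2 * w & `|jDV w| <= expR 2 * w].
Proof.
move=> w2; split.
- exact: (psum_near jre_bounded).
- by have := psum_near jim_bounded w2; rewrite subr0.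
- by have := psum_near jre1_bounded w2; rewrite mul0r subr0.
- by have := psum_near jim1_bounded w2; rewrite mul0r subr0.
Qed.

End FixedOrder.

Variable tau : R.
Hypothesis tau0 : 0 <= tau.

Let G2 := gam_sqr tau 0.
Let Gc := gamC tau 0.
Let Gs := gamS tau 0.
Hypothesis G2_gt0 : 0 < G2.

Definition jR x := cos (tau / 2 * ln (2 * x)) * jU tau (2 * x)
  - sin (tau / 2 * ln (2 * x)) * jV tau (2 * x).
Definition jI x := cos (tau / 2 * ln (2 * x)) * jV tau (2 * x)
  + sin (tau / 2 * ln (2 * x)) * jU tau (2 * x).
Let eR x := cos (tau / 2 * ln (2 * x)) * jDU tau (2 * x)
  - sin (tau / 2 * ln (2 * x)) * jDV tau (2 * x).
Let eI x := cos (tau / 2 * ln (2 * x)) * jDV tau (2 * x)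
  + sin (tau / 2 * ln (2 * x)) * jDU tau (2 * x).

(* The real part of [J_(i tau) (2 sqrt w) = w^(i tau / 2) (jU w + i jV w) / Gamma (1 + i tau)]
   at [w = 2 x], where [jR + i jI = w^(i tau / 2) (jU w + i jV w)]. *)
Definition besJ x := (gamC tau 0 * jR x + gamS tau 0 * jI x) / gam_sqr tau 0.
Definition besJ1 x := (Gc * (- (tau / 2) * jI x + eR x) +
  Gs * (tau / 2 * jR x + eI x)) / G2.

Let G2n : G2 != 0. Proof. by rewrite gt_eqF. Qed.

Let djR x : 0 < x -> is_derive x (1 : R) jR ((- (tau / 2) * jI x + eR x) / x).
Proof.
move=> x0; have x2 : 0 < 2 * x by rewrite mulr_gt0.
have h1 := @jU_dv tau; have h2 := @jV_dv tau.
by rewrite /jR; dv; rewrite /jI /eR; field; rewrite gt_eqF.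
Qed.

Let djI x : 0 < x -> is_derive x (1 : R) jI ((tau / 2 * jR x + eI x) / x).
Proof.
move=> x0; have x2 : 0 < 2 * x by rewrite mulr_gt0.
have h1 := @jU_dv tau; have h2 := @jV_dv tau.
by rewrite /jI; dv; rewrite /jR /eI; field; rewrite gt_eqF.
Qed.

Let deR x : 0 < x -> is_derive x (1 : R) eR ((tau / 2 * eI x - 2 * x * jR x) / x).
Proof.
move=> x0; have x2 : 0 < 2 * x by rewrite mulr_gt0.
have h1 := @jDU_dv tau; have h2 := @jDV_dv tau.
by rewrite /eR; dv; rewrite /jR /eI; field; rewrite gt_eqF.
Qed.

Let deI x : 0 < x -> is_derive x (1 : R) eI ((- (tau / 2) * eR x - 2 * x * jI x) / x).
Proof.
move=> x0; have x2 : 0 < 2 * x by rewrite mulr_gt0.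
have h1 := @jDU_dv tau; have h2 := @jDV_dv tau.
by rewrite /eI; dv; rewrite /jI /eR; field; rewrite gt_eqF.
Qed.

Lemma besJ_dv x : 0 < x -> is_derive x (1 : R) besJ (besJ1 x / x).
Proof.
move=> x0; have h1 := djR x0; have h2 := djI x0.
by rewrite /besJ; dv; rewrite /besJ1 -/G2 -/Gc -/Gs; field; rewrite G2n gt_eqF.
Qed.

Lemma besJ1_dv x : 0 < x ->
  is_derive x (1 : R) besJ1 (- (tau ^+ 2 / 4 + 2 * x) * besJ x / x).
Proof.
move=> x0; have h1 := djR x0; have h2 := djI x0.
have h3 := deR x0; have h4 := deI x0.
by rewrite /besJ1; dv; rewrite /besJ -/G2 -/Gc -/Gs; field; rewrite G2n gt_eqF.
Qed.

Let kap := expR 2 : R.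

Let kap1 : 1 <= kap.
Proof. by rewrite /kap -expR0 ler_expR. Qed.

Let cauchy (p q : R) : (Gc * p + Gs * q) ^+ 2 / G2 ^+ 2 <= (p ^+ 2 + q ^+ 2) / G2.
Proof.
rewrite ler_pdivrMr ?exprn_gt0// expr2 mulrA divfK// -subr_ge0.
have -> : (p ^+ 2 + q ^+ 2) * G2 - (Gc * p + Gs * q) ^+ 2 = (Gc * q - Gs * p) ^+ 2.
  by rewrite /G2 /gam_sqr -/Gc -/Gs; ring.
exact: sqr_ge0.
Qed.

Let En x := besJ x ^+ 2 + besJ1 x ^+ 2 / (2 * x + tau ^+ 2 / 4).

Let den_gt0 x : 0 < x -> 0 < 2 * x + tau ^+ 2 / 4.
Proof. by move=> x0; rewrite ltr_wpDr ?divr_ge0 ?sqr_ge0// mulr_gt0. Qed.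

Let dEn x : 0 < x -> is_derive x (1 : R) (fun x => - En x)
  (2 * (besJ1 x / (2 * x + tau ^+ 2 / 4)) ^+ 2).
Proof.
move=> x0; have h1 := besJ_dv x0; have h2 := besJ1_dv x0.
have dn : 2 * x + tau ^+ 2 / 4 != 0 by rewrite gt_eqF// den_gt0.
rewrite /En; dv; field; rewrite !gt_eqF//.
by have := den_gt0 x0; lra.
Qed.

Let rot (c s u v : R) : c ^+ 2 + s ^+ 2 = 1 ->
  (c * u - s * v) ^+ 2 + (c * v + s * u) ^+ 2 = u ^+ 2 + v ^+ 2.
Proof.
by move=> h; rewrite -[RHS]mul1r -h; ring.
Qed.

(** [besJ] and [besJ1] are projections, so [cauchy] bounds them by moduli, which the rotation by
    [(tau / 2) ln (2 x)] preserves. Near 0 the right-hand side approaches [3 / G2]. *)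
Let En_le_uv x : 0 < x -> En x <=
  (3 * (jU tau (2 * x) ^+ 2 + jV tau (2 * x) ^+ 2) +
   (jDU tau (2 * x) ^+ 2 + jDV tau (2 * x) ^+ 2) / x) / G2.
Proof.
move=> x0; have d0 := den_gt0 x0.
set m := jU _ _ ^+ 2 + _; set d := jDU _ _ ^+ 2 + _.
have mE : jR x ^+ 2 + jI x ^+ 2 = m by rewrite rot ?cos2Dsin2.
have dE : eR x ^+ 2 + eI x ^+ 2 = d by rewrite rot ?cos2Dsin2.
have m0 : 0 <= m by rewrite addr_ge0 ?sqr_ge0.
have d00 : 0 <= d by rewrite addr_ge0 ?sqr_ge0.
have h1 : besJ x ^+ 2 <= m / G2.
  by rewrite /besJ -/Gc -/Gs -/G2 expr_div_n -mE; exact: cauchy.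
have h2 : besJ1 x ^+ 2 <= (2 * (tau ^+ 2 / 4 * m + d)) / G2.
  rewrite /besJ1 expr_div_n (le_trans (cauchy _ _))// ler_wpM2r ?invr_ge0 ?(ltW G2_gt0)//.
  rewrite -mE -dE -subr_ge0.
  have -> : 2 * (tau ^+ 2 / 4 * (jR x ^+ 2 + jI x ^+ 2) + (eR x ^+ 2 + eI x ^+ 2)) -
     ((- (tau / 2) * jI x + eR x) ^+ 2 + (tau / 2 * jR x + eI x) ^+ 2) =
     (tau / 2 * jI x + eR x) ^+ 2 + (tau / 2 * jR x - eI x) ^+ 2 by field.
  by rewrite addr_ge0 ?sqr_ge0.
have -> : (3 * m + d / x) / G2 = m / G2 + (2 * m + d / x) / G2 by field; rewrite G2n gt_eqF.
rewrite lerD// ler_pdivrMr// (le_trans h2)//.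
rewrite [leRHS]mulrAC ler_wpM2r ?invr_ge0 ?(ltW G2_gt0)//.
have -> : (2 * m + d / x) * (2 * x + tau ^+ 2 / 4) =
  2 * (tau ^+ 2 / 4 * m + d) + (4 * m * x + d / x * (tau ^+ 2 / 4)).
  by field; rewrite gt_eqF.
rewrite lerDl addr_ge0//; first by rewrite mulr_ge0 ?(ltW x0)// mulr_ge0.
by rewrite mulr_ge0 ?divr_ge0 ?sqr_ge0// ltW.
Qed.

Lemma besJ_energy x : 0 < x ->
  besJ x ^+ 2 + besJ1 x ^+ 2 / (2 * x + tau ^+ 2 / 4) <= 4 / gam_sqr tau 0.
Proof.
move=> x0; have k0 : 0 < kap by rewrite (lt_le_trans _ kap1).
(* The energy decreases, so it suffices to bound it at a small [y <= x]. The threshold makes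
   [kap e <= 1 / 50] for the error [e = 2 kap y] of [j_near0], which keeps the bound below 4. *)
pose y := Num.min x (100 * kap ^+ 2)^-1.
have y0 : 0 < y by rewrite lt_min x0 invr_gt0 mulr_gt0// exprn_gt0.
have yx : y <= x by rewrite ge_min lexx.
have yk : y * (100 * kap ^+ 2) <= 1.
  by rewrite -ler_pdivlMr ?mulr_gt0 ?exprn_gt0// mul1r ge_min lexx orbT.
have : En x <= En y.
  suff h : - En y <= - En x by rewrite -lerN2; exact: h.
  have dE t : y <= t <= x -> is_derive t (1 : R) (fun x => - En x)
      (2 * (besJ1 t / (2 * t + tau ^+ 2 / 4)) ^+ 2).
    by move=> /andP[yt _]; apply: dEn; exact: lt_le_trans yt.
  have pE t : y <= t <= x -> 0 <= 2 * (besJ1 t / (2 * t + tau ^+ 2 / 4)) ^+ 2.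
    by move=> _; apply: mulr_ge0 => //; exact: sqr_ge0.
  have := @dv_nondec R _ _ y x yx dE pE.
  exact.
move=> /le_trans; apply; apply: (le_trans (En_le_uv y0)).
rewrite ler_wpM2r ?invr_ge0 ?(ltW G2_gt0)//.
pose e := kap * (2 * y).
have ke : kap * e <= 1 / 50 by rewrite /e; lra.
have e0 : 0 <= e by rewrite /e !mulr_ge0// ltW.
have e1 : e <= 1 / 50 by rewrite (le_trans _ ke)// ler_peMl.
have y2 : 0 <= 2 * y <= 2.
  rewrite mulr_ge0 ?(ltW y0)//= -[leRHS]mulr1 ler_pM2l//.
  rewrite (le_trans _ yk)// ler_peMr ?(ltW y0)//.
  have k21 : 1 <= kap ^+ 2 by exact: exprn_ege1.
  by rewrite (le_trans k21)// ler_peMl ?ler1n// (le_trans ler01 k21).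
have [hU hV hDU hDV] := j_near0 tau y2; rewrite -/kap -/e in hU hV hDU hDV.
have sq (a b : R) : `|a| <= b -> a ^+ 2 <= b ^+ 2.
  by move=> ab; rewrite -[leLHS]real_normK ?num_real// lerXn2r ?nnegrE// (le_trans _ ab).
have sV := sq _ _ hV.
have sU : jU tau (2 * y) ^+ 2 <= (1 + e) ^+ 2.
  apply: sq; have -> : jU tau (2 * y) = 1 + (jU tau (2 * y) - 1) by ring.
  by rewrite (le_trans (ler_normD _ _))// normr1 lerD2l.
have sD : (jDU tau (2 * y) ^+ 2 + jDV tau (2 * y) ^+ 2) / y <= 4 * (kap * e).
  rewrite ler_pdivrMr// (le_trans (lerD (sq _ _ hDU) (sq _ _ hDV)))//.
  by apply: eq_le_r; rewrite {1 2}/e /e; ring.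
have e2 : e ^+ 2 <= 1 / 50 * e by rewrite expr2 ler_wpM2r.
lra.
Qed.

Let jR_near x : 0 < x < 1 -> `|jR x - cos (tau / 2 * ln (2 * x))| <= 4 * kap * x.
Proof.
move=> /andP[x0 x1]; have x2 : 0 <= 2 * x <= 2 by lra.
have [hU hV _ _] := j_near0 tau x2.
set c := cos (tau / 2 * ln (2 * x)); set s := sin (tau / 2 * ln (2 * x)).
have -> : jR x - c = c * (jU tau (2 * x) - 1) - s * jV tau (2 * x) by rewrite /jR -/c -/s; ring.
rewrite (le_trans (ler_normB _ _))// !normrM.
have := ler_pM (normr_ge0 _) (normr_ge0 _) (norm_cos_le1 (tau / 2 * ln (2 * x))) hU.
have := ler_pM (normr_ge0 _) (normr_ge0 _) (norm_sin_le1 (tau / 2 * ln (2 * x))) hV.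
by rewrite -/c -/s -/kap; lra.
Qed.

Let jI_near x : 0 < x < 1 -> `|jI x - sin (tau / 2 * ln (2 * x))| <= 4 * kap * x.
Proof.
move=> /andP[x0 x1]; have x2 : 0 <= 2 * x <= 2 by lra.
have [hU hV _ _] := j_near0 tau x2.
set c := cos (tau / 2 * ln (2 * x)); set s := sin (tau / 2 * ln (2 * x)).
have -> : jI x - s = c * jV tau (2 * x) + s * (jU tau (2 * x) - 1) by rewrite /jI -/c -/s; ring.
rewrite (le_trans (ler_normD _ _))// !normrM.
have := ler_pM (normr_ge0 _) (normr_ge0 _) (norm_cos_le1 (tau / 2 * ln (2 * x))) hV.
have := ler_pM (normr_ge0 _) (normr_ge0 _) (norm_sin_le1 (tau / 2 * ln (2 * x))) hU.
by rewrite -/c -/s -/kap; lra.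
Qed.

Let eR_near x : 0 < x < 1 -> `|eR x| <= 4 * kap * x.
Proof.
move=> /andP[x0 x1]; have x2 : 0 <= 2 * x <= 2 by lra.
have [_ _ hU hV] := j_near0 tau x2.
rewrite /eR (le_trans (ler_normB _ _))// !normrM.
have := ler_pM (normr_ge0 _) (normr_ge0 _) (norm_cos_le1 (tau / 2 * ln (2 * x))) hU.
have := ler_pM (normr_ge0 _) (normr_ge0 _) (norm_sin_le1 (tau / 2 * ln (2 * x))) hV.
by rewrite -/kap; lra.
Qed.

Let eI_near x : 0 < x < 1 -> `|eI x| <= 4 * kap * x.
Proof.
move=> /andP[x0 x1]; have x2 : 0 <= 2 * x <= 2 by lra.
have [_ _ hU hV] := j_near0 tau x2.
rewrite /eI (le_trans (ler_normD _ _))// !normrM.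
have := ler_pM (normr_ge0 _) (normr_ge0 _) (norm_cos_le1 (tau / 2 * ln (2 * x))) hV.
have := ler_pM (normr_ge0 _) (normr_ge0 _) (norm_sin_le1 (tau / 2 * ln (2 * x))) hU.
by rewrite -/kap; lra.
Qed.

(** The remainders of [J] are [O(x)] and the factors built from [K] are [O(x^(-1/2))]. *)
Let prod_at0 (p q : R -> R) (a b : R) : (forall x, 0 < x < 1 -> `|p x| <= a * x) ->
  (forall x, 0 < x -> `|q x| * Num.sqrt x <= b) -> p x * q x @[x --> 0^'+] --> (0 : R).
Proof.
move=> pa qb; apply: (@cvg_at0_le _ _ _ (a * b)) => x x01; have /andP[x0 _] := x01.
have xs : Num.sqrt x ^+ 2 = x by rewrite sqr_sqrtr// ltW.
have a0 : 0 <= a by have := le_trans (normr_ge0 _) (pa _ x01); rewrite pmulr_lge0.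
rewrite subr0 normrM (le_trans (ler_wpM2r (normr_ge0 _) (pa _ x01)))//.
have -> : a * x * `|q x| = a * (`|q x| * Num.sqrt x) * Num.sqrt x by rewrite -{1}xs; ring.
by rewrite ler_wpM2r// ler_wpM2l// qb.
Qed.

Let Ksqrt : exists C, forall x, 0 < x ->
  [/\ `|besK tau x| * Num.sqrt x <= C, `|- (2 * besK1 tau x)| * Num.sqrt x <= C &
   `|tau * besK tau x| * Num.sqrt x <= C].
Proof.
have [C C0 HC] := @besK_le R.
exists (C + 2 * C + tau * C) => x x0.
have [h1 h2] := HC tau x x0.
have s0 : 0 < Num.sqrt x by rewrite sqrtr_gt0.
have E (k : R) : `|k| * (Num.sqrt x * (1 + x) ^+ 3) <= C -> `|k| * Num.sqrt x <= C.
  move=> h; apply: (le_trans _ h); rewrite ler_wpM2l// ler_peMr ?(ltW s0)//.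
  by rewrite expr_ge1//; lra.
have tC : 0 <= tau * C by exact: mulr_ge0.
have := E _ h1; have := E _ h2 => k2 k1; split.
- lra.
- by rewrite normrN normrM [`|2|]ger0_norm// -mulrA; lra.
- by rewrite normrM (ger0_norm tau0) -mulrA; have := ler_wpM2l tau0 k1; lra.
Qed.

Let X x := cos (tau / 2 * ln (2 * x)) * - (2 * besK1 tau x) -
    sin (tau / 2 * ln (2 * x)) * (tau * besK tau x).
Let Y x := sin (tau / 2 * ln (2 * x)) * - (2 * besK1 tau x) +
    cos (tau / 2 * ln (2 * x)) * (tau * besK tau x).

Let X_at0 : X x @[x --> 0^'+] --> Gc.
Proof.
apply: (@cvg_at0_le _ _ _ ((2 + expR 1) * 2)) => x /andP[x0 _].
by rewrite -mulrA; exact: besK_gammaC.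
Qed.

Let Y_at0 : Y x @[x --> 0^'+] --> Gs.
Proof.
apply: (@cvg_at0_le _ _ _ ((2 + expR 1) * 2)) => x /andP[x0 _].
by rewrite -mulrA; exact: besK_gammaS.
Qed.

(** Replacing [jR] and [jI] by [cos] and [sin] costs products that vanish by [prod_at0]. The main
    part is [(Gc X + Gs Y) / (2 G2)], and [X], [Y] tend to [Gc], [Gs]. *)
Lemma besJK_wronskian_at0 :
  besJ1 x * besK tau x - besJ x * besK1 tau x @[x --> 0^'+] --> (2^-1 : R).
Proof.
have [C HC] := Ksqrt.
pose p1 x := jR x - cos (tau / 2 * ln (2 * x)).
pose p2 x := jI x - sin (tau / 2 * ln (2 * x)).
pose q1 x := - (2 * besK1 tau x).
pose q2 x := tau * besK tau x.
have H0 x : 0 < x -> `|besK tau x| * Num.sqrt x <= C by move=> /HC[].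
have H1 x : 0 < x -> `|q1 x| * Num.sqrt x <= C by move=> /HC[].
have H2 x : 0 < x -> `|q2 x| * Num.sqrt x <= C by move=> /HC[].
have -> : (fun x => besJ1 x * besK tau x - besJ x * besK1 tau x) =
  (fun x => (Gc * X x + Gs * Y x + (Gc * (p1 x * q1 x - p2 x * q2 x + 2 * (eR x * besK tau x)) +
    Gs * (p2 x * q1 x + p1 x * q2 x + 2 * (eI x * besK tau x)))) * (2 * G2)^-1).
  apply/funext => x; rewrite /besJ1 /besJ /X /Y /p1 /p2 /q1 /q2 -/Gc -/Gs -/G2.
  by field; rewrite G2n.
have -> : 2^-1 = (Gc * Gc + Gs * Gs + (Gc * (0 - 0 + 2 * 0) + Gs * (0 + 0 + 2 * 0))) *
    (2 * G2)^-1 :> R.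
  have E : Gc * Gc + Gs * Gs = G2 by rewrite -!expr2.
  by rewrite E; field; rewrite G2n.
apply: cvgMl; apply: cvgD; first by apply: cvgD; apply: cvgMr; [exact: X_at0|exact: Y_at0].
apply: cvgD; apply: cvgMr; apply: cvgD.
- by apply: cvgB; [exact: prod_at0 jR_near H1|exact: prod_at0 jI_near H2].
- by apply: cvgMr; exact: prod_at0 eR_near H0.
- by apply: cvgD; [exact: prod_at0 jI_near H1|exact: prod_at0 jR_near H2].
- by apply: cvgMr; exact: prod_at0 eI_near H0.
Qed.

(** The same splitting; the main part is a multiple of [Gc Y - Gs X], whose limit [Gc Gs - Gs Gc]
    cancels. *)
Lemma besJK_sym_at0 : tau ^+ 2 / 2 * (besJ x * besK tau x) +
  2 * (besJ1 x * besK1 tau x) @[x --> 0^'+] --> (0 : R).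
Proof.
have [C HC] := Ksqrt.
pose p1 x := jR x - cos (tau / 2 * ln (2 * x)).
pose p2 x := jI x - sin (tau / 2 * ln (2 * x)).
pose q1 x := - (2 * besK1 tau x).
pose q2 x := tau * besK tau x.
have H1 x : 0 < x -> `|q1 x| * Num.sqrt x <= C by move=> /HC[].
have H2 x : 0 < x -> `|q2 x| * Num.sqrt x <= C by move=> /HC[].
have -> : (fun x => tau ^+ 2 / 2 * (besJ x * besK tau x) + 2 * (besJ1 x * besK1 tau x)) =
  (fun x => (tau / 2 * (Gc * Y x - Gs * X x) +
   (tau / 2 * (Gc * (p1 x * q2 x + p2 x * q1 x) + Gs * (p2 x * q2 x - p1 x * q1 x)) -
    (Gc * (eR x * q1 x) + Gs * (eI x * q1 x)))) * G2^-1).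
  apply/funext => x; rewrite /besJ1 /besJ /X /Y /p1 /p2 /q1 /q2 -/Gc -/Gs -/G2.
  by field; rewrite G2n.
have E : (tau / 2 * (Gc * Gs - Gs * Gc) +
   (tau / 2 * (Gc * (0 + 0) + Gs * (0 - 0)) - (Gc * 0 + Gs * 0))) * G2^-1 = 0 :> R.
  by ring.
rewrite -[X in _ --> X]E; apply: cvgMl; apply: cvgD.
  by apply: cvgMr; apply: cvgB; apply: cvgMr; [exact: Y_at0|exact: X_at0].
apply: cvgB.
  apply: cvgMr; apply: cvgD; apply: cvgMr.
    by apply: cvgD; [exact: prod_at0 jR_near H2|exact: prod_at0 jI_near H1].
  by apply: cvgB; [exact: prod_at0 jI_near H2|exact: prod_at0 jR_near H1].
by apply: cvgD; apply: cvgMr; [exact: prod_at0 eR_near H1|exact: prod_at0 eI_near H1].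
Qed.

End BesselJReal.

(** * The complex-valued definitions *)

Section ComplexLinks.
Variable R : realType.
Implicit Types (x t : R) (n k : nat).

Local Notation Re := (@complex.Re R).
Local Notation Im := (@complex.Im R).

Lemma ReD (z w : R[i]) : Re (z + w) = Re z + Re w.
Proof. by case: z w => [a b] [c d]. Qed.

Lemma ImD (z w : R[i]) : Im (z + w) = Im z + Im w.
Proof. by case: z w => [a b] [c d]. Qed.

Lemma ReM_real (z : R[i]) x : Re (z * x%:C) = Re z * x.
Proof. by case: z => [a b] /=; rewrite mulr0 subr0. Qed.

Lemma ImM_real (z : R[i]) x : Im (z * x%:C) = Im z * x.
Proof. by case: z => [a b] /=; rewrite mulr0 add0r. Qed.

Lemma Re_le_normc (z : R[i]) : `|Re z| <= Normc.normc z.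
Proof.
case: z => a b /=; rewrite -sqrtr_sqr; apply: ler_wsqrtr.
by rewrite lerDl sqr_ge0.
Qed.

Lemma Im_le_normc (z : R[i]) : `|Im z| <= Normc.normc z.
Proof.
case: z => a b /=; rewrite -sqrtr_sqr; apply: ler_wsqrtr.
by rewrite lerDr sqr_ge0.
Qed.

Lemma normc_le (z : R[i]) : Normc.normc z <= `|Re z| + `|Im z|.
Proof.
case: z => a b /=; rewrite -[leRHS]ger0_norm ?addr_ge0// -sqrtr_sqr.
apply: ler_wsqrtr; rewrite sqrrD !real_normK ?num_real//.
by rewrite lerD2r lerDl mulrn_wge0// mulr_ge0.
Qed.

Lemma Re_series (u : nat -> R[i]) n : Re (series u n) = series (Re \o u) n.
Proof.
by rewrite /series /=; elim/big_rec2: _ => // i y z _ <-; rewrite ReD.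
Qed.

Lemma Im_series (u : nat -> R[i]) n : Im (series u n) = series (Im \o u) n.
Proof.
by rewrite /series /=; elim/big_rec2: _ => // i y z _ <-; rewrite ImD.
Qed.

Lemma cvg_complex (u : nat -> R[i]) (a b : R) :
  Re (u n) @[n --> \oo] --> a -> Im (u n) @[n --> \oo] --> b ->
  (u : nat -> R[i]^o) n @[n --> \oo] --> (a +i* b : R[i]^o).
Proof.
move=> ua ub; apply/cvgrPdist_le => e e0.
have e0' : 0 < Re e by move: e0; rewrite ltcE /= => /andP[_].
have eE : e = (Re e)%:C by rewrite RRe_real// gtr0_real.
have e2 : 0 < Re e / 2 by rewrite divr_gt0.
near=> n.
have h1 : `|a - Re (u n)| <= Re e / 2 by near: n; move/cvgrPdist_le : ua; exact.
have h2 : `|b - Im (u n)| <= Re e / 2 by near: n; move/cvgrPdist_le : ub; exact.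
rewrite eE; change (`|a +i* b - u n : R[i]| <= (Re e)%:C).
rewrite normc_def lecR; have := normc_le (a +i* b - u n).
move: h1 h2; case: (u n) => c d /= h1 h2 h; apply: (le_trans h); lra.
Unshelve. all: by end_near. Qed.

Lemma cseries_complex (u : nat -> R[i]) (a b : R) :
  series (Re \o u) n @[n --> \oo] --> a -> series (Im \o u) n @[n --> \oo] --> b ->
  cseries_cvg u /\ cseries_sum u = a +i* b.
Proof.
move=> ua ub.
have h : (series u : nat -> R[i]^o) n @[n --> \oo] --> (a +i* b : R[i]^o).
  apply: cvg_complex.
    by under eq_fun do rewrite Re_series.
  by under eq_fun do rewrite Im_series.
split; first by apply/cvg_ex; exists (a +i* b).
by apply: cvg_lim h.
Qed.

Lemma cexp_ReIm (a b : R) : cexp (a +i* b) = (expR a * cos b) +i* (expR a * sin b).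
Proof. by rewrite /cexp /=; simpc. Qed.

Lemma cexpE (z : R[i]) :
  cexp z = (expR (Re z) * cos (Im z)) +i* (expR (Re z) * sin (Im z)).
Proof. by case: z => a b; rewrite cexp_ReIm. Qed.

Lemma ccosh_imag (b : R) : ccosh (0 +i* b) = (cos b)%:C.
Proof.
rewrite /ccosh; have -> : - (0 +i* b) = (- 0) +i* (- b) by [].
rewrite !cexp_ReIm oppr0 expR0 !mul1r cosN sinN.
have -> : (cos b +i* sin b) + (cos b +i* - sin b) = (cos b)%:C * 2.
  by rewrite mulrDr mulr1; apply/eqP; rewrite eq_complex /= subrr addr0 !eqxx.
by rewrite mulfK// pnatr_eq0.
Qed.

Lemma lnX_expR t k : 0 < t -> expR (k%:R * ln t) = t ^+ k.
Proof. by move=> t0; rewrite mulrC expRM_natr lnK. Qed.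

Lemma natc k : k%:R = (k%:R : R)%:C :> R[i].
Proof. by rewrite rmorph_nat. Qed.

Lemma cGammaE (tau : R) k :
  cGamma ((0 +i* tau) + k%:R + 1) = gamC tau k +i* gamS tau k.
Proof.
rewrite /cGamma /cintegral addrK natc; congr (_ +i* _); apply: rayint_eq => t t0.
  rewrite ReM_real cexpE /=; simpc; rewrite /= ?(mulr0, subr0, add0r, addr0).
  by rewrite lnX_expR//; ring.
rewrite ImM_real cexpE /=; simpc; rewrite /= ?(mulr0, subr0, add0r, addr0).
by rewrite lnX_expR//; ring.
Qed.

Lemma cintegral_closed (f : R -> R[i]) (a b : R -> R) :
  (forall t, Re (f t) = a t) -> (forall t, Im (f t) = b t) ->
  ray_integrable a -> ray_integrable b ->
  cintegral `[0, +oo[ f = rayint a +i* rayint b.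
Proof.
move=> fa fb ia ib; rewrite /cintegral; congr (_ +i* _).
  under eq_Rintegral do rewrite fa.
  by rewrite /rayint Rintegral_itv_obnd_cbnd.
under eq_Rintegral do rewrite fb.
by rewrite /rayint Rintegral_itv_obnd_cbnd.
Qed.

Let two_sqrt x : 0 < x -> 2 * Num.sqrt (2 * x) = Num.sqrt (8 * x).
Proof.
move=> x0; have -> : 8 * x = 2 ^+ 2 * (2 * x) by ring.
by rewrite [RHS]sqrtrM ?sqr_ge0// sqrtr_sqr ger0_norm.
Qed.

Lemma besselK_real n x : 0 < x ->
  besselK (0 +i* n%:R) (2 * Num.sqrt (2 * x))%:C = (besK n%:R x)%:C.
Proof.
move=> x0; rewrite /besselK two_sqrt//; have z0 := sqrt8_gt0 x0.
set z := Num.sqrt _ in z0 *.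
have E t : cexp (- z%:C * (coshR t)%:C) * ccosh ((0 +i* n%:R) * t%:C) =
    (expR (- (z * coshR t)) * cos (n%:R * t))%:C.
  have -> : (0 +i* n%:R) * t%:C = 0 +i* (n%:R * t) :> R[i] by simpc.
  rewrite ccosh_imag.
  have -> : - z%:C * (coshR t)%:C = (- (z * coshR t)) +i* 0 by simpc.
  by rewrite cexp_ReIm cos0 sin0 mulr1 mulr0; simpc.
rewrite (@cintegral_closed _ (fun t => expR (- (z * coshR t)) * cos (n%:R * t)) (fun=> 0)).
- congr (_ +i* _); rewrite /rayint /Rintegral.
  by under eq_integral do rewrite /=; rewrite integral0.
- by move=> t; rewrite E.
- by move=> t; rewrite E.
- exact: (Nint_integrable n%:R (@poscont_expN R) (@rapid_expN R) z0).
- by have := ray_integrableZ 0 (@ray_integrable_exp R 1 ltr01); under eq_fun do rewrite mul0r.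
Qed.

Lemma besselK_kei u x : 0 < x ->
  Im (besselK 0 (4 * cexp (0 +i* (pi / 4)) * (Num.sqrt (coshR u))%:C * (Num.sqrt x)%:C))
  = kei (x * coshR u).
Proof.
move=> x0; have c0 := coshR_gt0 u.
pose z := Num.sqrt (8 * (x * coshR u)).
have z0 : 0 < z by apply: sqrt8_gt0; rewrite mulr_gt0.
have cs : cos (pi / 4) = sin (pi / 4) :> R.
  have := @tan_piquarter R; rewrite /tan.
  have cn : cos (pi / 4) != 0 :> R.
    rewrite gt_eqF// cos_gt0_pihalf//; have := @pi_gt0 R => p0.
    by apply/andP; split; lra.
  by move=> /(congr1 (fun y => y * cos (pi / 4))); rewrite divfK// mul1r.
have c2 : cos (pi / 4) = Num.sqrt 2 / 2 :> R.
  have c0' : 0 <= cos (pi / 4) :> R.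
    apply: cos_ge0_pihalf; have := @pi_gt0 R => p0; by apply/andP; split; lra.
  have h := cos2Dsin2 (pi / 4 : R); rewrite -cs in h.
  apply/eqP; rewrite -(@eqrXn2 _ 2)//.
  by rewrite expr_div_n sqr_sqrtr//; apply/eqP; lra.
have zE : 4 * cos (pi / 4) * Num.sqrt (coshR u) * Num.sqrt x = z.
  rewrite c2 /z.
  have -> : 8 * (x * coshR u) = 2 ^+ 2 * (2 * (coshR u * x)) by ring.
  rewrite [RHS]sqrtrM ?sqr_ge0// sqrtr_sqr ger0_norm//.
  by rewrite [Num.sqrt (2 * _)]sqrtrM// [Num.sqrt (coshR u * _)]sqrtrM ?(ltW c0)//; field.
have -> : 4 * cexp (0 +i* (pi / 4)) * (Num.sqrt (coshR u))%:C * (Num.sqrt x)%:C = z +i* z.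
  rewrite cexp_ReIm expR0 !mul1r -cs natc.
  by apply/eqP; rewrite eq_complex /=; simpc; rewrite /= zE !eqxx.
have E t : cexp (- (z +i* z) * (coshR t)%:C) * ccosh (0 * t%:C) =
   (expR (- (z * coshR t)) * cos (z * coshR t)) +i*
   (- (expR (- (z * coshR t)) * sin (z * coshR t))).
  have -> : 0 * t%:C = 0 +i* 0 :> R[i] by simpc.
  rewrite ccosh_imag cos0.
  have -> : - (z +i* z) * (coshR t)%:C = (- (z * coshR t)) +i* (- (z * coshR t)) by simpc.
  by rewrite cexp_ReIm cosN sinN mulr1 mulrN.
have cc lam : poscont (fun q : R => expR (- q) * cos (lam * q)).
  move=> q _; have d : is_derive q (1 : R) (fun q => expR (- q) * cos (lam * q))
    (- (expR (- q) * (cos (lam * q) + lam * sin (lam * q)))) by dv; ring.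
  exact: dv_cont d.
have cs' lam : poscont (fun q : R => expR (- q) * sin (lam * q)).
  move=> q _; have d : is_derive q (1 : R) (fun q => expR (- q) * sin (lam * q))
    (expR (- q) * (lam * cos (lam * q) - sin (lam * q))) by dv; ring.
  exact: dv_cont d.
have iE := Nint_integrable 0 (cc 1) (expcos_bound 1) z0.
have iS := Nint_integrable 0 (cs' 1) (expsin_bound 1) z0.
have is' : ray_integrable (fun t => expR (- (z * coshR t)) * sin (z * coshR t)).
  by apply: (ray_integrable_eq _ iS) => t _; rewrite !mul0r cos0 mulr1 mul1r.
rewrite /besselK (@cintegral_closed _ (fun t => expR (- (z * coshR t)) * cos (z * coshR t))
  (fun t => - (expR (- (z * coshR t)) * sin (z * coshR t)))).
- rewrite /= /kei /NX /Nint -/z.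
  under rayint_eq do rewrite -mulN1r.
  rewrite (rayintZ _ is') mulN1r; congr (- _); apply: rayint_eq => t _.
  by rewrite mul0r cos0 mulr1.
- by move=> t; rewrite E.
- by move=> t; rewrite E.
- by apply: (ray_integrable_eq _ iE) => t _; rewrite !mul0r cos0 mulr1 mul1r.
- exact: ray_integrableN.
Qed.

Section BesselJ.
Variable tau : R.
Hypothesis G0 : 0 < gam_sqr tau 0.

Let G k : R[i] := gamC tau k +i* gamS tau k.
Let al k : R[i] := jre tau k +i* jim tau k.

Let G_rec k : G k.+1 = (k.+1%:R +i* tau) * G k.
Proof.
rewrite /G gamC_rec gamS_rec; apply/eqP; rewrite eq_complex /=.
by apply/andP; split; apply/eqP; ring.
Qed.

Let al_rec k : k.+1%:R * (k.+1%:R +i* tau) * al k.+1 = - al k.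
Proof.
have -> : k.+1%:R * (k.+1%:R +i* tau) * al k.+1 =
   (k.+1%:R * (k.+1%:R * jre tau k.+1 - tau * jim tau k.+1)) +i*
   (k.+1%:R * (k.+1%:R * jim tau k.+1 + tau * jre tau k.+1)).
  rewrite natc /al; apply/eqP; rewrite eq_complex /=.
  by apply/andP; split; apply/eqP; ring.
rewrite jre_rec jim_rec /al; apply/eqP; rewrite eq_complex /=.
by apply/andP; split; apply/eqP; rewrite mulrC divfK.
Qed.

(** The functional equation reduces every Gamma value in the series to [Gamma (1 + i tau)], which
    then leaves the sum as a common denominator. *)
Let al_G k : al k * (k`!%:R * G k) = (-1) ^+ k * G 0%N.
Proof.
elim: k => [|k IH].
  have -> : al 0%N = 1 by apply/eqP; rewrite eq_complex /= !eqxx.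
  by rewrite fact0 expr0 !mul1r.
transitivity (- (al k * (k`!%:R * G k))).
  by rewrite -mulNr -al_rec factS natrM G_rec; ring.
by rewrite IH exprS; ring.
Qed.

Let G0n : G 0%N != 0.
Proof.
apply/eqP => /eqP; rewrite eq_complex /= => /andP[/eqP h1 /eqP h2].
by move: G0; rewrite /gam_sqr h1 h2 expr0n addr0 ltxx.
Qed.

(** A zero of [Gamma (k + 1 + i tau)] would annihilate the left side of [al_G], while the right side
    is nonzero. *)
Let Gn k : k`!%:R * G k != 0.
Proof.
apply/negP => /eqP h; have := al_G k; rewrite h mulr0 => /esym/eqP.
by rewrite mulf_eq0 (negPf G0n) orbF signr_eq0.
Qed.

Let coef k : (-1) ^+ k / (k`!%:R * G k) = al k / G 0%N.
Proof.
by apply/eqP; rewrite (eqr_div _ _ (Gn k) G0n) al_G.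
Qed.

Lemma besselJ_besJ x : 0 < x ->
  Re (besselJ (0 +i* tau) (2 * Num.sqrt (2 * x))) = besJ tau x.
Proof.
move=> x0; have x2 : 0 < 2 * x by rewrite mulr_gt0.
pose c := cos (tau / 2 * ln (2 * x)); pose s := sin (tau / 2 * ln (2 * x)).
pose g2 := gam_sqr tau 0; pose gc := gamC tau 0; pose gs := gamS tau 0.
have g2n : g2 != 0 by rewrite gt_eqF.
(* [hr + i hi] is [w^(i tau / 2) / Gamma (1 + i tau)] at [w = 2 x], written with the conjugate of
   the denominator. *)
pose hr := (gc * c + gs * s) / g2; pose hi := (gc * s - gs * c) / g2.
have H : (c +i* s) / G 0%N = hr +i* hi.
  apply: (canLR (mulfK G0n)); rewrite /G -/gc -/gs.
  have E : gc ^+ 2 + gs ^+ 2 = g2 by [].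
  apply/eqP; rewrite eq_complex /=; apply/andP; split; apply/eqP.
    apply: (mulIf g2n); rewrite /hr /hi mulrBl.
    have -> : (gc * c + gs * s) / g2 * gc * g2 = (gc * c + gs * s) * gc by field.
    have -> : (gc * s - gs * c) / g2 * gs * g2 = (gc * s - gs * c) * gs by field.
    by rewrite -E; ring.
  apply: (mulIf g2n); rewrite /hr /hi mulrDl.
  have -> : (gc * c + gs * s) / g2 * gs * g2 = (gc * c + gs * s) * gs by field.
  have -> : (gc * s - gs * c) / g2 * gc * g2 = (gc * s - gs * c) * gc by field.
  by rewrite -E; ring.
pose u k := (-1) ^+ k * cexp (((0 +i* tau) + (2 * k)%N%:R) *
    (ln (2 * Num.sqrt (2 * x) / 2))%:C) / (k`!%:R * cGamma ((0 +i* tau) + k%:R + 1)).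
have uE k : u k = (hr * (jre tau k * (2 * x) ^+ k) - hi * (jim tau k * (2 * x) ^+ k)) +i*
    (hr * (jim tau k * (2 * x) ^+ k) + hi * (jre tau k * (2 * x) ^+ k)).
  rewrite /u cGammaE -/(G k).
  have -> : 2 * Num.sqrt (2 * x) / 2 = Num.sqrt (2 * x) by field.
  have ln2 : ln (2 * x) = 2 * ln (Num.sqrt (2 * x)).
    by rewrite -{1}(sqr_sqrtr (ltW x2)) lnXn ?sqrtr_gt0// -[LHS]mulr_natl.
  have -> : cexp (((0 +i* tau) + (2 * k)%N%:R) * (ln (Num.sqrt (2 * x)))%:C) =
      ((2 * x) ^+ k)%:C * (c +i* s).
    have -> : ((0 +i* tau) + (2 * k)%N%:R) * (ln (Num.sqrt (2 * x)))%:C =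
        (k%:R * ln (2 * x)) +i* (tau / 2 * ln (2 * x)).
      rewrite natc; apply/eqP; rewrite eq_complex /= ln2 natrM.
      by apply/andP; split; apply/eqP; field.
    rewrite cexp_ReIm lnX_expR//; apply/eqP; rewrite eq_complex /= -/c -/s.
    by apply/andP; split; apply/eqP; ring.
  have -> : (-1) ^+ k * (((2 * x) ^+ k)%:C * (c +i* s)) / (k`!%:R * G k) =
     ((c +i* s) / G 0%N) * al k * ((2 * x) ^+ k)%:C.
    transitivity ((-1) ^+ k / (k`!%:R * G k) * (((2 * x) ^+ k)%:C * (c +i* s))).
      by ring.
    by rewrite coef; ring.
  rewrite H /al; apply/eqP; rewrite eq_complex /=.
  by apply/andP; split; apply/eqP; ring.
have cv (p q : R) (a b : nat -> R) : fact_bounded a -> fact_bounded b ->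
    series (fun k => p * (a k * (2 * x) ^+ k) + q * (b k * (2 * x) ^+ k)) n @[n --> \oo] -->
    p * psum a (2 * x) + q * psum b (2 * x).
  move=> fa fb.
  have -> : (fun n => series (fun k => p * (a k * (2 * x) ^+ k) + q * (b k * (2 * x) ^+ k)) n) =
     (fun n => p * pseries a (2 * x) n + q * pseries b (2 * x) n).
    apply/funext => n; rewrite /pseries /series /= !mulr_sumr -big_split /=.
    by apply: eq_bigr.
  by apply: cvgD; apply: cvgMr; exact: psum_cvg.
have c1 : series (Re \o u) n @[n --> \oo] --> hr * jU tau (2 * x) - hi * jV tau (2 * x).
  have := cv hr (- hi) _ _ (@jre_bounded R tau) (@jim_bounded R tau).
  rewrite mulNr; apply: cvg_trans; apply: near_eq_cvg; apply: nearW => n; congr (series _ n).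
  by apply/funext => k /=; rewrite uE mulNr.
have c2 : series (Im \o u) n @[n --> \oo] --> hr * jV tau (2 * x) + hi * jU tau (2 * x).
  have := cv hr hi _ _ (@jim_bounded R tau) (@jre_bounded R tau).
  apply: cvg_trans; apply: near_eq_cvg; apply: nearW => n; congr (series _ n).
  by apply/funext => k /=; rewrite uE.
have [_ hs] := cseries_complex c1 c2.
rewrite /besselJ -/u hs /=.
rewrite /besJ /jR /jI -/c -/s -/gc -/gs -/g2 /hr /hi; field; exact: g2n.
Qed.

End BesselJ.

End ComplexLinks.

(** * Termwise integration against [Psi] *)

Section Kernel.
Variable R : realType.
Implicit Types (n : nat) (x u t : R).

Lemma psi_integrand_cont n x u : 0 < x ->
  {for u, continuous (fun u => kei (x * coshR u) * sinhR u * sin (n%:R * u))}.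
Proof.
move=> x0; have K := @kei_dv R; have xc : 0 < x * coshR u by rewrite mulr_gt0// coshR_gt0.
apply: (@dv_cont R _ u (kei1 (x * coshR u) / (x * coshR u) * (x * sinhR u) * sinhR u * sin (n%:R * u)
  + kei (x * coshR u) * coshR u * sin (n%:R * u)
  + kei (x * coshR u) * sinhR u * (n%:R * cos (n%:R * u)))).
by dv => //; ring.
Qed.

Lemma psi_integrable n x : 0 < x ->
  lebesgue_measure.-integrable `[0, pi]
    (EFin \o (fun u => kei (x * coshR u) * sinhR u * sin (n%:R * u))).
Proof.
move=> x0; apply: continuous_compact_integrable; first exact: segment_compact.
by apply: continuous_subspaceT => u; exact: psi_integrand_cont.
Qed.

Lemma Psi_kei n x : 0 < x -> Psi n x =
  \int[lebesgue_measure]_(u in `[0, pi]) (kei (x * coshR u) * sinhR u * sin (n%:R * u)).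
Proof. by move=> x0; apply: eq_Rintegral => u _; congr (_ * _ * _); exact: besselK_kei. Qed.

Lemma sinhR_le_exp t : 0 <= t -> `|sinhR t| <= expR t.
Proof.
move=> t0; rewrite ger0_norm ?sinhR_ge0// /sinhR.
have := expR_gt0 t; have := expR_gt0 (- t); lra.
Qed.

Lemma psi_integrand_bounded : exists2 M : R, 0 <= M & forall n x u, 0 < x -> 0 <= u <= pi ->
  `|kei (x * coshR u) * sinhR u * sin (n%:R * u)| <= M.
Proof.
have [M M0 kb] := kei_ker_bounds R.
exists (M * expR pi) => [|n x u x0 /andP[u0 up]]; first by rewrite mulr_ge0// expR_ge0.
have xc : 0 < x * coshR u by rewrite mulr_gt0// coshR_gt0.
have [[k1 _] _ _ _] := kb _ xc.
rewrite normrM -[leRHS]mulr1; apply: ler_pM => //; last exact: norm_sin_le1.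
rewrite normrM; apply: ler_pM => //.
by rewrite (le_trans (sinhR_le_exp u0))// ler_expR.
Qed.

Lemma Psi_bounded : exists2 M : R, 0 <= M & forall n x, 0 < x -> `|Psi n x| <= M.
Proof.
have [M M0 kb] := psi_integrand_bounded.
exists (M * pi) => [|n x x0]; first by rewrite mulr_ge0// pi_ge0.
rewrite (Psi_kei n x0); apply: le_trans; first by apply: le_normr_Rintegral => //; exact: psi_integrable.
have -> : M * pi = \int[lebesgue_measure]_(u in `[0, pi]) M :> R.
  rewrite Rintegral_cst//; congr (M * _).
  rewrite -[LHS]/(fine pi%:E); congr fine; symmetry.
  by rewrite [LHS]lebesgue_measure_itv /= lte_fin pi_gt0 EFinN sube0.
apply: le_Rintegral => //.
- by have := integrable_norm (psi_integrable n x0).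
- by apply: continuous_compact_integrable; [exact: segment_compact|apply: continuous_subspaceT => u; exact: cst_continuous].
by move=> u; rewrite /= in_itv/= => uu; exact: kb.
Qed.

(** It supplies the measurability of [Psi n] on the half-line; the majorant is the constant bound of
    the integrand on [[0, pi]]. *)
Lemma Psi_cont n x : 0 < x -> {for x, continuous (Psi n)}.
Proof.
move=> x0; have [M M0 kb] := psi_integrand_bounded.
pose F x := \int[lebesgue_measure]_(u in `[0, pi]) (kei (x * coshR u) * sinhR u * sin (n%:R * u)).
suff cF : {for x, continuous (F : R -> R)}.
  change (Psi n y @[y --> x] --> Psi n x).
  have -> : Psi n x = F x by exact: Psi_kei.
  apply: cvg_trans cF; apply: near_eq_cvg.
  by near=> y; rewrite (Psi_kei n)//; near: y; exact: lt_nbhsr.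
have xI : (x : R) \in (`]0, (x + 1)[%classic : set R).
  by rewrite inE/= in_itv/= x0 ltrDl ltr01.
have ciM : lebesgue_measure.-integrable `[0, pi] (EFin \o (fun=> M : R)).
  by apply: continuous_compact_integrable; [exact: segment_compact|apply: continuous_subspaceT => u; exact: cst_continuous].
suff cF : {in (`]0, (x + 1)[%classic : set R), continuous F} by exact: cF.
apply: (@continuity_under_integral R _ _ lebesgue_measure
  (fun x u => kei (x * coshR u) * sinhR u * sin (n%:R * u)) `[0, pi] _ 0 (x + 1) _ _ (fun=> M)) => //.
- by move=> y; rewrite /= in_itv/= => /andP[y0 _]; exact: psi_integrable.
- apply: aeW => u _ y; rewrite inE/= in_itv/= => /andP[y0 _].
  have yc : 0 < y * coshR u by rewrite mulr_gt0// coshR_gt0.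
  have K := @kei_dv R.
  apply: (@dv_cont R _ y (kei1 (y * coshR u) / (y * coshR u) * coshR u * sinhR u * sin (n%:R * u))).
  by dv => //; ring.
- move=> y; rewrite /= in_itv/= => /andP[y0 _]; apply: aeW => u; rewrite /= in_itv/= => uu.
  exact: kb.
Unshelve. all: by end_near. Qed.

Lemma rint_FTC (a b : R) (f F : R -> R) : a < b -> continuous f ->
  (forall x, is_derive x (1 : R) F (f x)) ->
  \int[lebesgue_measure]_(x in `[a, b]) f x = F b - F a.
Proof.
move=> ab cf dF.
have cF : continuous F by move=> x; exact: dv_cont (dF x).
rewrite /Rintegral (@continuous_FTC2 R f F a b ab)//.
- by apply: continuous_subspaceT.
- split=> [x _||].
  + by have [] := dF x.
  + by apply: cvg_at_right_filter; exact: cF.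
  + by apply: cvg_at_left_filter; exact: cF.
by move=> x _; rewrite derive1E; exact: (@derive_val _ _ _ _ _ _ _ (dF x)).
Qed.

Lemma rint_sin_sin n m : (0 < n)%N -> (0 < m)%N ->
  \int[lebesgue_measure]_(u in `[0, pi]) (sin (n%:R * u) * sin (m%:R * u)) =
  (if n == m then pi / 2 else 0) :> R.
Proof.
move=> n0 m0.
have sinpi k : sin (k%:R * pi) = 0 :> R.
  rewrite mulr_natl; elim: k => [|k IH]; first by rewrite mulr0n sin0.
  by rewrite mulrSr sinDpi IH oppr0.
have nm0 : n%:R + m%:R != 0 :> R by rewrite gt_eqF// ltr_wpDr// ltr0n.
have cint : continuous (fun u : R => sin (n%:R * u) * sin (m%:R * u)).
  move=> u; apply: (@dv_cont R _ u (n%:R * cos (n%:R * u) * sin (m%:R * u)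
    + sin (n%:R * u) * (m%:R * cos (m%:R * u)))).
  by dv => //; ring.
have prod_sum u : sin (n%:R * u) * sin (m%:R * u) =
    (cos ((n%:R - m%:R) * u) - cos ((n%:R + m%:R) * u)) / 2 :> R.
  by rewrite (mulrBl u) (mulrDl _ _ u) cosB cosD; field.
case: eqP => [nm|/eqP nm].
  pose F u : R := (u - sin ((n%:R + m%:R) * u) / (n%:R + m%:R)) / 2.
  have dF u : is_derive u (1 : R) F (sin (n%:R * u) * sin (m%:R * u)).
    rewrite prod_sum {1}nm subrr mul0r cos0 /F.
    by dv => //; field; exact: nm0.
  rewrite (rint_FTC (pi_gt0 R) cint dF) /F mulr0 sin0 -natrD sinpi; ring.
have nm1 : n%:R - m%:R != 0 :> R by rewrite subr_eq0 eqr_nat.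
pose F u : R := (sin ((n%:R - m%:R) * u) / (n%:R - m%:R) -
  sin ((n%:R + m%:R) * u) / (n%:R + m%:R)) / 2.
have dF u : is_derive u (1 : R) F (sin (n%:R * u) * sin (m%:R * u)).
  rewrite prod_sum /F.
  by dv => //; field; rewrite nm0 nm1.
rewrite (rint_FTC (pi_gt0 R) cint dF) /F !mulr0 sin0 -natrD sinpi.
by rewrite (mulrBl pi) sinB !sinpi; ring.
Qed.
End Kernel.

(** * The terms of the series: uniform bounds and their integrals against [kei] *)

Section ProductKernel.
Variable R : realType.
Implicit Types (n m : nat) (x u t : R).

Lemma gam_sqr_gt0 m : 0 < gam_sqr m%:R 0 :> R.
Proof. by apply: lt_le_trans (gam_sqr_lower R m); rewrite divr_gt0// expR_gt0. Qed.

(** The term of index [m] with coefficient 1. *)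
Definition jk m x : R := besJ m%:R x * besK m%:R x / coshR (pi * m%:R / 2).

Lemma besJ_sqr_le m x : 0 < x -> besJ m%:R x ^+ 2 <= 4 / gam_sqr m%:R 0.
Proof.
move=> x0; apply: le_trans (besJ_energy (gam_sqr_gt0 m) x0).
rewrite lerDl mulr_ge0 ?sqr_ge0// invr_ge0 addr_ge0// ?divr_ge0 ?sqr_ge0//.
by rewrite mulr_ge0// ltW.
Qed.

(** The exponentials of [|Gamma (1 + i m)|^2 >= e^(- pi m - 1) / 4] and
    [cosh^2 (pi m / 2) >= e^(pi m) / 4] cancel, so the square is at most [4 * 16 e = 64 e], below
    [(8 e)^2]. *)
Lemma besJ_cosh_le m x : 0 < x -> `|besJ m%:R x / coshR (pi * m%:R / 2)| <= 8 * expR 1.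
Proof.
move=> x0; set c := coshR _; have c0 : 0 < c := coshR_gt0 _.
have G0 := gam_sqr_gt0 m; have J := besJ_sqr_le m x0.
have e0 : 0 < expR 1 :> R := expR_gt0 1.
have e1 : 1 <= expR 1 :> R by rewrite -(@expR0 R) ler_expR.
rewrite -ler_sqr ?nnegrE ?mulr_ge0 ?(ltW e0)// real_normK ?num_real//.
have cl : expR (pi * m%:R) / 4 <= c ^+ 2.
  have -> : pi * m%:R = pi * m%:R / 2 + pi * m%:R / 2 :> R by field.
  rewrite expRD /c /coshR; set p := expR (pi * m%:R / 2); set q := expR (- _).
  have p0 : 0 < p := expR_gt0 _; have q0 : 0 < q := expR_gt0 _.
  have := mulr_ge0 (ltW p0) (ltW q0); have := sqr_ge0 q; rewrite !expr2; lra.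
have gl : (expR 1)^-1 / 16 <= gam_sqr m%:R 0 * c ^+ 2.
  have := ler_pM _ _ (gam_sqr_lower R m) cl.
  rewrite !divr_ge0 ?expR_ge0// => /(_ isT isT); apply: le_trans; apply: eq_le_r.
  rewrite opprD expRD !expRN; have := expR_gt0 (pi * m%:R : R).
  move: (expR (_ * _)) => p p0; field; rewrite !gt_eqF//.
have d0 : 0 < gam_sqr m%:R 0 * c ^+ 2 by rewrite mulr_gt0// exprn_gt0.
have : (besJ m%:R x / c) ^+ 2 <= 4 / (gam_sqr m%:R 0 * c ^+ 2).
  rewrite expr_div_n (invfM (gam_sqr _ _)) [leRHS]mulrA; apply: ler_wpM2r; last exact: besJ_sqr_le.
  by rewrite invr_ge0 sqr_ge0.
move/le_trans; apply; rewrite ler_pdivrMr//.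
apply: le_trans (_ : (8 * expR 1) ^+ 2 * ((expR 1)^-1 / 16) <= _).
  have -> : (8 * expR 1) ^+ 2 * ((expR 1)^-1 / 16) = 4 * expR 1 :> R.
    by field; rewrite gt_eqF.
  lra.
by rewrite ler_wpM2l// sqr_ge0.
Qed.

(** The constant is common to all [m], so a summable coefficient sequence yields a single multiple
    of [decay] dominating all partial sums. *)
Lemma jk_le : exists2 M : R, 0 <= M & forall m x, 0 < x -> `|jk m x| <= M * decay x.
Proof.
have [C C0 KC] := besK_le R.
exists (8 * expR 1 * C) => [|m x x0]; first by rewrite !mulr_ge0// expR_ge0.
rewrite /jk mulrAC normrM -[leRHS]mulrA; apply: ler_pM => //; first exact: besJ_cosh_le.
have [KC1 _] := KC m%:R _ x0.
have s0 : 0 < Num.sqrt x by rewrite sqrtr_gt0.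
have x1 : 1 <= 1 + x by rewrite lerDl ltW.
have p0 : 0 < Num.sqrt x * (1 + x) ^+ 2 by rewrite mulr_gt0// exprn_gt0// (lt_le_trans ltr01).
rewrite /decay ler_pdivlMr//; apply: le_trans KC1.
by rewrite ler_wpM2l// ler_wpM2l ?(ltW s0)// ler_weXn2l.
Qed.

Lemma jk_cont m x : 0 < x -> {for x, continuous (jk m)}.
Proof.
move=> x0; have dJ := besJ_dv (gam_sqr_gt0 m) x0; have dK := besK_dv m%:R x0.
apply: (@dv_cont R _ x ((besJ1 m%:R x / x * besK m%:R x + besJ m%:R x * (besK1 m%:R x / x))
  / coshR (pi * m%:R / 2))).
by rewrite /jk; dv => //; ring.
Qed.

Lemma jk_integrable m : ray_integrable (jk m).
Proof.
have [M M0 jkM] := jk_le.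
apply: (@ray_integrable_le _ _ (fun x => M * decay x)).
- by apply: ray_measurable; exact: jk_cont.
- by move=> x; exact: jkM.
exact: ray_integrableZ (ray_integrable_decay R).
Qed.

Lemma kei_jk_integrable m t : ray_integrable (fun x => kei (x * coshR t) * jk m x).
Proof.
have [M M0 jkM] := jk_le; have [N N0 kb] := kei_ker_bounds R.
apply: (@ray_integrable_le _ _ (fun x => N * M * decay x)).
- apply: ray_measurable => x x0; apply: cvgM; last exact: jk_cont.
  have K := @kei_dv R; have xc : 0 < x * coshR t by rewrite mulr_gt0// coshR_gt0.
  apply: (@dv_cont R _ x (kei1 (x * coshR t) / (x * coshR t) * coshR t)).
  by dv => //; ring.
- move=> x x0; have xc : 0 < x * coshR t by rewrite mulr_gt0// coshR_gt0.
  have [[k1 _] _ _ _] := kb _ xc.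
  by rewrite normrM -[leRHS]mulrA; apply: ler_pM => //; exact: jkM.
exact: ray_integrableZ (ray_integrable_decay R).
Qed.

Lemma sinhR_double t : sinhR (t + t) = 2 * (sinhR t * coshR t).
Proof. by rewrite /sinhR /coshR opprD !expRD; field. Qed.

Lemma rayint_kei_jk m t : (0 < m)%N -> 0 <= t ->
  rayint (fun x => kei (x * coshR t) * jk m x) * sinhR t =
  - (pi / 16) * sin (m%:R * t) / sinhR (pi * m%:R).
Proof.
move=> m0 t0; have G0 := gam_sqr_gt0 m.
have mR : 0 < m%:R :> R by rewrite ltr0n.
have [C C0 KC] := besK_le R.
set tau := m%:R in mR G0 *.
have J2 x (x0 : 0 < x) := besJ_energy G0 x0.
(* One constant for both [J] and [J1 / (1 + x)]: [(1 + tau)^2 (1 + x)^2] dominates the energy weight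
   [2 x + tau^2 / 4], and [q <= (1 + q)^2] avoids a square root of
   [q = 4 / |Gamma (1 + i tau)|^2]. *)
pose B : R := (1 + tau) * (1 + 4 / gam_sqr tau 0).
have q0 : 0 <= 4 / gam_sqr tau 0 :> R by rewrite divr_ge0 ?(ltW G0).
have B0 : 0 <= B by rewrite mulr_ge0// addr_ge0// ltW.
have qB : 4 / gam_sqr tau 0 * (1 + tau) ^+ 2 <= B ^+ 2.
  rewrite /B exprMn [leRHS]mulrC ler_wpM2r ?sqr_ge0//.
  move: q0; move: (4 / _) => q q0; nra.
have den x : 0 < x -> 0 < 2 * x + tau ^+ 2 / 4 by move=> x0; nra.
have Jle x : 0 < x -> `|besJ tau x| <= B.
  move=> x0; rewrite -ler_sqr ?nnegrE// real_normK ?num_real//.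
  apply: le_trans (besJ_sqr_le m x0) _; apply: le_trans qB.
  by rewrite -/tau ler_peMr// expr_ge1//; lra.
have J1le x : 0 < x -> `|besJ1 tau x| <= B * (1 + x).
  move=> x0; have x1 : 0 <= B * (1 + x) by rewrite mulr_ge0//; lra.
  rewrite -ler_sqr ?nnegrE// real_normK ?num_real//.
  rewrite [leRHS]exprMn.
  have h : besJ1 tau x ^+ 2 <= 4 / gam_sqr tau 0 * (2 * x + tau ^+ 2 / 4).
    rewrite -ler_pdivrMr ?den//; apply: le_trans (J2 _ x0).
    by rewrite lerDr sqr_ge0.
  apply: le_trans h _; apply: le_trans (ler_wpM2r (sqr_ge0 (1 + x)) qB).
  by rewrite -[leRHS]mulrA ler_wpM2l//; nra.
have dK x : 0 < x -> is_derive x (1 : R) (besK tau) (besK1 tau x / x) by exact: besK_dv.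
have dK1 x : 0 < x -> is_derive x (1 : R) (besK1 tau) ((2 * x - tau ^+ 2 / 4) * besK tau x / x).
  by exact: besK1_dv.
have Kle x (x0 : 0 < x) := (KC tau x x0).1; have K1le x (x0 : 0 < x) := (KC tau x x0).2.
have := rayint_kei_product mR B0 C0 (besJ_dv G0) (besJ1_dv G0) dK dK1 Jle J1le
  Kle K1le
  (besJK_wronskian_at0 (ltW mR) G0) (besJK_sym_at0 (ltW mR) G0) t0.
have c0 : coshR (pi * m%:R / 2) != 0 :> R by rewrite gt_eqF// coshR_gt0.
rewrite (@rayint_eq _ _ (fun x => coshR (pi * m%:R / 2) * (kei (x * coshR t) * jk m x))); last first.
  by move=> x x0; rewrite /jk -/tau; field.
rewrite rayintZ; last exact: kei_jk_integrable.
move: (rayint _) => I.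
have -> : sinhR (pi * tau) = 2 * (sinhR (tau * (pi / 2)) * coshR (pi * tau / 2)).
  have -> : tau * (pi / 2) = pi * tau / 2 by field.
  by rewrite -sinhR_double; congr sinhR; field.
have s0 : sinhR (tau * (pi / 2)) != 0.
  have h : 0 < tau * (pi / 2) by rewrite mulr_gt0// divr_gt0// pi_gt0.
  by rewrite gt_eqF// (lt_le_trans h)// sinhR_ge// ltW.
move: s0 c0; rewrite -/tau; move: (sinhR (_ * (_ / _))) (coshR _) (sinhR t) => s c st s0 c0 H.
have -> : I * st = (c * I * st * s) / (c * s) by field; rewrite c0 s0.
by rewrite H; field; rewrite c0 s0.
Qed.

End ProductKernel.

(** * Exchange of real integrals under a product majorant *)

Section RealFubini.
Variables (d1 d2 : measure_display) (T1 : measurableType d1) (T2 : measurableType d2).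
Variables (R : realType) (m1 : {sigma_finite_measure set T1 -> \bar R}).
Variable m2 : {sigma_finite_measure set T2 -> \bar R}.

Lemma integrable_prod_dom (F : T1 * T2 -> R) (a : T1 -> R) (b : T2 -> R) :
  measurable_fun setT F ->
  m1.-integrable setT (EFin \o a) -> m2.-integrable setT (EFin \o b) ->
  (forall x u, `|F (x, u)| <= `|a x| * `|b u|) ->
  (m1 \x m2)%E.-integrable setT (EFin \o F).
Proof.
move=> mF ia ib Fab.
have /integrableP[ma la] := ia; have /integrableP[mb lb] := ib.
have mF' : measurable_fun setT (EFin \o F) by apply/measurable_EFinP.
apply: (integrable12ltyP m1 m2 mF').2.
set J := (\int[m2]_u `|(b u)%:E|)%E in lb.
have J0 : (0 <= J)%E by apply: integral_ge0.
have inner x : (\int[m2]_u `|(EFin \o F) (x, u)| <= J * `|(a x)%:E|)%E.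
  rewrite muleC -ge0_integralZl//; last by apply: measurableT_comp.
  apply: ge0_le_integral => //.
  - apply: measurableT_comp => //; apply: (measurableT_comp mF'); exact: pair1_measurable.
  - by apply: measurable_funeM; apply: measurableT_comp.
  by move=> u _; rewrite /= -EFinM lee_fin.
apply: (@le_lt_trans _ _ (\int[m1]_x (J * `|(a x)%:E|))%E).
  apply: ge0_le_integral => //.
  - by move=> x _; apply: integral_ge0.
  - apply: (@measurable_fun_fubini_tonelli_F _ _ _ _ _ m2 (fun z => `|(EFin \o F) z|)%E) => //.
    by apply: measurableT_comp.
  - by apply: measurable_funeM; apply: measurableT_comp.
rewrite ge0_integralZl//; last by apply: measurableT_comp.
by apply: lte_mul_pinfty => //; rewrite ?integral_ge0// ge0_fin_numE ?integral_ge0.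
Qed.

(** The majorant makes every section integrable, not only almost every one, so that taking [fine] of
    the inner integrals loses nothing. *)
Lemma Rintegral_swap (F : T1 * T2 -> R) (a : T1 -> R) (b : T2 -> R) :
  measurable_fun setT F ->
  m1.-integrable setT (EFin \o a) -> m2.-integrable setT (EFin \o b) ->
  (forall x u, `|F (x, u)| <= `|a x| * `|b u|) ->
  \int[m1]_x (\int[m2]_u F (x, u)) = \int[m2]_u (\int[m1]_x F (x, u)).
Proof.
move=> mF ia ib Fab; have iF := integrable_prod_dom mF ia ib Fab.
have := Fubini iF.
have i1 x : m2.-integrable setT (EFin \o (fun u => F (x, u))).
  apply: (@le_integrable _ _ _ m2 setT _ _ (EFin \o (fun u => `|a x| * `|b u|))) => //.
  - apply/measurable_EFinP; apply: (measurableT_comp mF); exact: pair1_measurable.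
  - by move=> u _ /=; rewrite lee_fin [leRHS]ger0_norm// mulr_ge0.
  by apply: (integrableZl _ _ (integrable_norm ib)).
have i2 u : m1.-integrable setT (EFin \o (fun x => F (x, u))).
  apply: (@le_integrable _ _ _ m1 setT _ _ (EFin \o (fun x => `|b u| * `|a x|))) => //.
  - apply/measurable_EFinP; apply: (measurableT_comp mF); exact: pair2_measurable.
  - by move=> x _ /=; rewrite lee_fin [leRHS]ger0_norm ?mulr_ge0// mulrC.
  by apply: (integrableZl _ _ (integrable_norm ia)).
move=> E; rewrite /Rintegral; congr fine.
under eq_integral => x _ do rewrite fineK ?(integrable_fin_num _ (i1 x))//.
under [RHS]eq_integral => u _ do rewrite fineK ?(integrable_fin_num _ (i2 u))//.
exact: E.
Qed.

End RealFubini.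

(** * Orthogonality of [Psi n] to the terms of the series *)

Section FubiniPsi.
Variable R : realType.
Implicit Types (n m : nat) (x u t : R).
Local Notation mu := (@lebesgue_measure R).
Local Notation ray := (`]0, +oo[%classic : set R).
Local Notation seg := (`[0, pi]%classic : set R).

Lemma coshR_measurable : measurable_fun setT (@coshR R).
Proof.
apply: continuous_measurable_fun => t.
apply: (@dv_cont R (fun u => coshR u) t (sinhR t)).
by dv => //; ring.
Qed.

Lemma rayint_Psi_jk n m : (0 < n)%N -> (0 < m)%N ->
  rayint (fun x => Psi n x * jk m x) =
  if n == m then - (pi ^+ 2 / 32) / sinhR (pi * m%:R) else 0.
Proof.
move=> n0 m0; have [M M0 kb] := kei_ker_bounds R.
(* The three factors are extended by 0, so that Fubini applies on the whole plane. [k] is then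
   bounded and measurable on all of the line, and the product is dominated by [|M p x| |q u|]. *)
pose k : R -> R := (@kei R) \_ ray; pose p : R -> R := (@jk R m) \_ ray.
pose q : R -> R := (fun u => sinhR u * sin (n%:R * u)) \_ seg.
pose F (z : R * R) : R := k (z.1 * coshR z.2) * p z.1 * q z.2.
have kM y : `|k y| <= M.
  rewrite /k patchE; case: ifPn => [|_]; last by rewrite normr0.
  by rewrite inE => /in_ray y0; have [[]] := kb _ y0.
have mk : measurable_fun setT k.
  have cM : measurable_fun ray (@kei R).
    by apply: ray_measurable => x x0; exact: dv_cont (kei_dv x0).
  exact: (measurable_restrictT (@kei R) (measurable_itv `]0, +oo[)).1.
have ip : mu.-integrable setT (EFin \o p).
  have := jk_integrable R m; rewrite /ray_integrable integrable_mkcond//.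
  by rewrite restrict_EFin.
have iq : mu.-integrable setT (EFin \o q).
  have : mu.-integrable seg (EFin \o (fun u : R => sinhR u * sin (n%:R * u))).
    apply: continuous_compact_integrable; first exact: segment_compact.
    apply: continuous_subspaceT => u.
    apply: (@dv_cont R _ u (coshR u * sin (n%:R * u) + sinhR u * (n%:R * cos (n%:R * u)))).
    by dv => //; ring.
  by rewrite integrable_mkcond// restrict_EFin.
have iMp : mu.-integrable setT (EFin \o (fun x => M * p x)).
  by have := integrableZl measurableT M ip; apply: eq_integrable.
have mp : measurable_fun setT p by have /integrableP[/measurable_EFinP] := ip.
have mq : measurable_fun setT q by have /integrableP[/measurable_EFinP] := iq.
have mF : measurable_fun setT F.
  apply: measurable_funM; last by apply: measurableT_comp.
  apply: measurable_funM; last by apply: measurableT_comp.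
  apply: measurableT_comp => //; apply: measurable_funM => //.
  by apply: measurableT_comp => //; exact: coshR_measurable.
have := @Rintegral_swap _ _ _ _ R mu mu F _ _ mF iMp iq.
have Fab x u : `|F (x, u)| <= `|M * p x| * `|q u|.
  rewrite /F /= !normrM ler_wpM2r// ler_wpM2r// (ger0_norm M0); exact: kM.
move=> /(_ Fab).
have -> : \int[mu]_x \int[mu]_u F (x, u) = rayint (fun x => Psi n x * jk m x).
  rewrite /rayint [RHS]Rintegral_mkcond; apply: eq_Rintegral => x _.
  rewrite [RHS]patchE; case: ifPn => [|nx].
    rewrite inE => /in_ray x0; rewrite (Psi_kei n x0) -RintegralZr//; last exact: psi_integrable.
    rewrite [RHS]Rintegral_mkcond; apply: eq_Rintegral => u _.
    rewrite /F /q /k /p /= !patchE mem_set; last by apply: mem_ray; rewrite mulr_gt0// coshR_gt0.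
    rewrite mem_set; last exact: mem_ray.
    case: ifPn => _; last by rewrite mulr0.
    by ring.
  rewrite /F /p /= patchE (negbTE nx); under eq_Rintegral => u _ do rewrite mulr0 mul0r.
  by rewrite Rintegral_cst// mul0r.
have -> : \int[mu]_u \int[mu]_x F (x, u) =
    - (pi / 16) / sinhR (pi * m%:R) * \int[mu]_(u in seg) (sin (n%:R * u) * sin (m%:R * u)).
  rewrite -RintegralZl//; last first.
    apply: continuous_compact_integrable; first exact: segment_compact.
    apply: continuous_subspaceT => u.
    apply: (@dv_cont R _ u (n%:R * cos (n%:R * u) * sin (m%:R * u) + sin (n%:R * u) * (m%:R * cos (m%:R * u)))).
    by dv => //; ring.
  rewrite [RHS]Rintegral_mkcond; apply: eq_Rintegral => u _.
  rewrite [RHS]patchE; case: ifPn => [|nu].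
    rewrite inE /= in_itv/= => /andP[u0 up].
    transitivity (rayint (fun x => kei (x * coshR u) * jk m x) * sinhR u * sin (n%:R * u)).
      rewrite -mulrA -RintegralZr//; last exact: kei_jk_integrable.
      rewrite [RHS]Rintegral_mkcond; apply: eq_Rintegral => x _.
      have us : u \in seg by rewrite inE /= in_itv/= u0 up.
      rewrite [RHS]patchE; case: ifPn => [|nx].
        rewrite inE => /in_ray x0.
        have xc : 0 < x * coshR u by rewrite mulr_gt0// coshR_gt0.
        by rewrite /F /q /k /p /= !patchE (mem_set (mem_ray x0)) (mem_set (mem_ray xc)) us.
      by rewrite /F /p /= patchE (negbTE nx) mulr0 mul0r.
    by rewrite rayint_kei_jk//; ring.
  rewrite /F /q /= patchE (negbTE nu); under eq_Rintegral => x _ do rewrite mulr0.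
  by rewrite Rintegral_cst// mul0r.
move=> ->; rewrite (rint_sin_sin R n0 m0); case: ifP => _; last by rewrite mulr0.
have s0 : 0 < pi * m%:R :> R by rewrite mulr_gt0 ?pi_gt0// ltr0n.
by field; rewrite gt_eqF// (lt_le_trans s0)// sinhR_ge// ltW.
Qed.
End FubiniPsi.

(** * Termwise integration for a real summable sequence *)

Section SeriesIntegral.
Variable R : realType.
Variables (c : nat -> R) (W : R).
Hypothesis cW : forall N, \sum_(0 <= k < N) `|c k| <= W.
Implicit Types (n k N : nat) (x : R).
Local Notation mu := (@lebesgue_measure R).
Local Notation ray := (`]0, +oo[%classic : set R).

Definition jk_series x := limn (series (fun k => c k * jk k x)).

Let W0 : 0 <= W. Proof. by have := cW 0; rewrite big_geq. Qed.

Lemma jk_partial_le : exists2 M : R, 0 <= M & forall N x, 0 < x ->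
  \sum_(0 <= k < N) `|c k * jk k x| <= M * decay x.
Proof.
have [M M0 jM] := jk_le R.
exists (W * M) => [|N x x0]; first exact: mulr_ge0.
apply: (@le_trans _ _ (\sum_(0 <= k < N) `|c k| * (M * decay x))).
  by apply: ler_sum => k _; rewrite normrM ler_wpM2l// jM.
by rewrite -mulr_suml -[leRHS]mulrA ler_wpM2r// mulr_ge0// ltW// decay_gt0.
Qed.

Lemma jk_series_cvg x : 0 < x ->
  series (fun k => c k * jk k x) N @[N --> \oo] --> jk_series x.
Proof.
move=> x0; have [M M0 pM] := jk_partial_le.
apply: normed_cvg; apply: nondecreasing_is_cvgn.
  by apply: nondecreasing_series => k _ _ /=.
exists (M * decay x) => _ [N _ <-]; exact: pM.
Qed.

Lemma Psi_jk_integrable n k : ray_integrable (fun x => Psi n x * jk k x).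
Proof.
have [M M0 PM] := Psi_bounded R; have [C C0 jC] := jk_le R.
apply: (@ray_integrable_le _ _ (fun x => M * C * decay x)).
- apply: ray_measurable => x x0; apply: cvgM; [exact: Psi_cont|exact: jk_cont].
- by move=> x x0; rewrite normrM -[leRHS]mulrA; apply: ler_pM => //; [exact: PM|exact: jC].
exact: ray_integrableZ (ray_integrable_decay R).
Qed.

Lemma rayint_partial n N :
  ray_integrable (fun x => Psi n x * series (fun k => c k * jk k x) N) /\
  rayint (fun x => Psi n x * series (fun k => c k * jk k x) N) =
  \sum_(0 <= k < N) c k * rayint (fun x => Psi n x * jk k x).
Proof.
elim: N => [|N [IHi IH]].
  split.
    apply: (@ray_integrable_eq _ (fun x => 0 * decay x)).
      by move=> x x0; rewrite /series /= big_geq// mulr0 mul0r.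
    exact: ray_integrableZ (ray_integrable_decay R).
  rewrite big_geq// (@rayint_eq _ _ (fun x => 0 * decay x)).
    by rewrite rayintZ ?mul0r//; exact: ray_integrable_decay.
  by move=> x x0; rewrite /series /= big_geq// mulr0 mul0r.
have iZ := ray_integrableZ (c N) (Psi_jk_integrable n N).
have E x : Psi n x * series (fun k => c k * jk k x) N.+1 =
    Psi n x * series (fun k => c k * jk k x) N + c N * (Psi n x * jk N x).
  by rewrite /series /= big_nat_recr//=; ring.
split.
  apply: (ray_integrable_eq _ (ray_integrableD IHi iZ)) => x x0; exact/esym/E.
rewrite big_nat_recr//= -IH -(rayintZ (c N) (Psi_jk_integrable n N)) -(rayintD IHi iZ).
by apply: rayint_eq => x _.
Qed.

Lemma rayint_Psi_series n :
  ray_integrable (fun x => Psi n x * jk_series x) /\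
  \sum_(0 <= k < N) c k * rayint (fun x => Psi n x * jk k x) @[N --> \oo] -->
  rayint (fun x => Psi n x * jk_series x).
Proof.
have [M M0 PM] := Psi_bounded R; have [C C0 pC] := jk_partial_le.
pose f N x := (Psi n x * series (fun k => c k * jk k x) N)%:E.
pose g x := (Psi n x * jk_series x)%:E.
have mf N : measurable_fun ray (f N).
  by apply/measurable_EFinP; exact: ray_integrable_meas (rayint_partial n N).1.
have fg x : ray x -> f ^~ x @ \oo --> g x.
  move=> /in_ray x0; apply: cvg_EFin; first by apply: nearW.
  by apply: cvgMr; exact: jk_series_cvg.
have mg : measurable_fun ray g by exact: emeasurable_fun_cvg mf fg.
have ib : mu.-integrable ray (EFin \o (fun x => M * C * decay x)).
  exact: ray_integrableZ (ray_integrable_decay R).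
have fb x N : ray x -> (`|f N x| <= (M * C * decay x)%:E)%E.
  move=> /in_ray x0; rewrite /f /= lee_fin normrM -[leRHS]mulrA.
  apply: ler_pM => //; first exact: PM.
  by apply: le_trans (pC N x x0); exact: ler_norm_sum.
have [ig _ lim] : [/\ mu.-integrable ray g, (\int[mu]_(x in ray) `|f N x - g x|)%E @[N --> \oo] --> 0%E &
    (\int[mu]_(x in ray) f N x)%E @[N --> \oo] --> (\int[mu]_(x in ray) g x)%E].
  by apply: dominated_convergence ib _ => //; apply: aeW => x; [exact: fg|move=> N; exact: fb].
split=> //.
have -> : (fun N => \sum_(0 <= k < N) c k * rayint (fun x => Psi n x * jk k x)) =
  (fun N => fine (\int[mu]_(x in ray) f N x)).
  by apply/funext => N; rewrite -(rayint_partial n N).2.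
apply: fine_cvg; rewrite fineK//.
exact: integrable_fin_num.
Qed.

(** The orthogonality relation is for indices from 1 on, and [c 0 = 0] disposes of the remaining
    term. The partial sums of [rayint_Psi_series] are then constant once [N > n]. *)
Lemma rayint_Psi_series_coef n : c 0%N = 0 -> (0 < n)%N ->
  rayint (fun x => Psi n x * jk_series x) = c n * (- (pi ^+ 2 / 32) / sinhR (pi * n%:R)).
Proof.
move=> c0 n0; have [_ cv] := rayint_Psi_series n.
apply: cvg_unique cv _ => //.
apply: cvg_near_cst; near=> N.
have nN : (n < N)%N by near: N; exact: nbhs_infty_gt.
rewrite big_mkord (bigD1 (Ordinal nN))//= big1 ?addr0.
  by rewrite rayint_Psi_jk// eqxx.
move=> [[|k] kN] /=; first by rewrite c0 mul0r.
move=> kn; rewrite rayint_Psi_jk// ifN ?mulr0// eq_sym.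
by apply: contra kn => /eqP kn; apply/eqP/val_inj.
Unshelve. all: by end_near. Qed.

End SeriesIntegral.

(** * The transform of a complex sequence, and its inversion *)

Section TransformSeries.
Variable R : realType.

Lemma transform_term_jk (a : nat -> R[i]) (x : R) n : 0 < x ->
  transform_term a x n = (complex.Re (a n) * jk n x) +i* (complex.Im (a n) * jk n x).
Proof.
move=> x0; rewrite /transform_term besselK_real// besselJ_besJ//; last exact: gam_sqr_gt0.
rewrite /jk; move: (coshR _) (besJ _ _) (besK _ _) => c J K.
rewrite -fmorphV /= -!mulrA -!rmorphM /=.
case: (a n) => p q; apply/eqP; rewrite eq_complex /=.
by apply/andP; split; apply/eqP; ring.
Qed.

Lemma transform_jk_series (a : nat -> R[i]) (W x : R) :
  (forall N, \sum_(0 <= k < N) Normc.normc (a k) <= W) -> 0 < x ->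
  cseries_cvg (transform_term a x) /\
  transform a x = jk_series (@complex.Re R \o a) x +i* jk_series (@complex.Im R \o a) x.
Proof.
move=> aW x0; apply: cseries_complex.
- have cW N : \sum_(0 <= k < N) `|(@complex.Re R \o a) k| <= W.
    by apply: le_trans (aW N); apply: ler_sum => k _; exact: Re_le_normc.
  have := jk_series_cvg cW x0; apply: cvg_trans; apply: near_eq_cvg; apply: nearW => N.
  by congr (series _ N); apply/funext => k; rewrite /= transform_term_jk.
have cW N : \sum_(0 <= k < N) `|(@complex.Im R \o a) k| <= W.
  by apply: le_trans (aW N); apply: ler_sum => k _; exact: Im_le_normc.
have := jk_series_cvg cW x0; apply: cvg_trans; apply: near_eq_cvg; apply: nearW => N.
by congr (series _ N); apply/funext => k; rewrite /= transform_term_jk.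
Qed.

(** The sum in the hypothesis starts at 1 and the partial sums at 0, hence the extra [w 0]. *)
Lemma l1_partial_le (w : nat -> R) : (forall n, 0 <= w n) ->
  (\sum_(1 <= n <oo) (w n)%:E < +oo)%E ->
  exists W, forall N, \sum_(0 <= k < N) w k <= W.
Proof.
move=> w0 fin; set S := (\sum_(1 <= n <oo) _)%E in fin.
have S0 : (0 <= S)%E by apply: nneseries_ge0 => n _ _; rewrite lee_fin.
have Sf : S \is a fin_num by rewrite ge0_fin_numE.
exists (w 0%N + fine S) => -[|N]; first by rewrite big_geq// addr_ge0// fine_ge0.
rewrite big_nat_recl// lerD2l -lee_fin fineK// -sumEFin.
rewrite -(big_add1 _ _ 0 N.+1 predT (fun k => (w k)%:E)).
by apply: nneseries_lim_ge => n _ _; rewrite lee_fin.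
Qed.

End TransformSeries.

(** At [n = 0] the factor [sinh (pi n)] vanishes, so the inversion formula there forces [a 0 = 0];
    this is the condition in the last clause, while both convergence statements hold for every
    summable [a]. Real and imaginary parts of [a] are inverted separately, the kernel being real. *)
Theorem theorem3 (R : realType) (a : nat -> R[i])
    (a_l1 : (\sum_(1 <= n <oo) (Normc.normc (a n))%:E < +oo)%E) :
  (forall x : R, 0 < x -> cseries_cvg (transform_term a x))
  /\ (forall n : nat,
        cintegrable `]0, +oo[ (fun x : R => (Psi n x)%:C * transform a x))
  /\ (a 0%N = 0 ->
      forall n : nat,
        a n = (- (32 / pi ^+ 2) * sinhR (pi * n%:R))%:C
              * cintegral `]0, +oo[
                  (fun x : R => (Psi n x)%:C * transform a x)).
Proof.
have [W aW] := l1_partial_le (fun n => le_trans (normr_ge0 _) (Re_le_normc (a n))) a_l1.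
have cRe N : \sum_(0 <= k < N) `|(@complex.Re R \o a) k| <= W.
  by apply: le_trans (aW N); apply: ler_sum => k _; exact: Re_le_normc.
have cIm N : \sum_(0 <= k < N) `|(@complex.Im R \o a) k| <= W.
  by apply: le_trans (aW N); apply: ler_sum => k _; exact: Im_le_normc.
have E n x : 0 < x -> (Psi n x)%:C * transform a x =
    (Psi n x * jk_series (@complex.Re R \o a) x) +i* (Psi n x * jk_series (@complex.Im R \o a) x).
  move=> x0; rewrite (transform_jk_series aW x0).2.
  by apply/eqP; rewrite eq_complex /= !mul0r subr0 addr0 !eqxx.
split; first by move=> x x0; exact: (transform_jk_series aW x0).1.
split=> [n|a0 n].
  split.
    apply: (ray_integrable_eq _ (rayint_Psi_series cRe n).1) => x x0.
    by rewrite E.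
  apply: (ray_integrable_eq _ (rayint_Psi_series cIm n).1) => x x0.
  by rewrite E.
case: n => [|n].
  by rewrite a0 mulr0 /sinhR oppr0 subrr mul0r mulr0 mul0r.
have -> : cintegral `]0, +oo[ (fun x : R => (Psi n.+1 x)%:C * transform a x) =
    rayint (fun x => Psi n.+1 x * jk_series (@complex.Re R \o a) x) +i*
    rayint (fun x => Psi n.+1 x * jk_series (@complex.Im R \o a) x).
  by rewrite /cintegral; congr (_ +i* _); apply: rayint_eq => x x0; rewrite E.
have p0 : pi != 0 :> R by rewrite gt_eqF// pi_gt0.
have t0 : 0 < pi * n.+1%:R :> R by rewrite mulr_gt0// pi_gt0.
have s0 : sinhR (pi * n.+1%:R) != 0 :> R by rewrite gt_eqF// (lt_le_trans t0)// sinhR_ge// ltW.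
rewrite (rayint_Psi_series_coef cRe)//=; last by rewrite a0.
rewrite (rayint_Psi_series_coef cIm)//=; last by rewrite a0.
move: s0 p0; move: (sinhR _) => s; move: pi => P s0 p0.
case: (a n.+1) => p q /=; apply/eqP; rewrite eq_complex /= !mul0r subr0 addr0.
by apply/andP; split; apply/eqP; field; rewrite ?s0 ?p0.
Qed.
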